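(* Let $W$ be a complex vector space of dimension 6 and let $\mathbb{P}(A)\subset \mathrm{Pf}\subset\mathbb{P}(\bigwedge^2 W^* )$ be an $n$-dimensional stable linear space. Then the following hold: (1) $n\ge 3$; (2) a general plane $\mathbb{P}(B)\subset \mathbb{P}(A)$ satisfies $\mathbb{P}(B)\cap \mathrm{Gr}(2,W^* )=\emptyset$; (3) any plane $\mathbb{P}(B)\subset \mathbb{P}(A)$ such that $\mathbb{P}(B)\cap \mathrm{Gr}(2,W^* )=\emptyset$ is $SL(W)$-equivalent to the plane $$\pi_g=\langle e_1\wedge e_4+e_2\wedge e_5,\ e_1\wedge e_6+e_3\wedge e_5,\ e_2\wedge e_6-e_3\wedge e_4\rangle$$ for a basis $e_1,\ldots,e_6$ of $W^*$; (4) $n\le 5$.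
   Context: The base field is $\mathbb{C}$. $\mathbb{P}(\bigwedge^2 W^* )\simeq\mathbb{P}^{14}$ is the projective space of lines in the space $\bigwedge^2W^*$ of skew-symmetric bilinear forms on $W$. The rank of a form is the (even) rank of the corresponding $6\times 6$ skew-symmetric matrix. $\mathrm{Pf}=\{\omega\in\mathbb{P}(\bigwedge^2W^* ): \mathrm{rk}(\omega)\le 4\}$ is the Pfaffian hypersurface, and $\mathrm{Gr}(2,W^* )=\{\omega: \mathrm{rk}(\omega)=2\}$ is the Plücker-embedded Grassmannian of 2-dimensional subspaces of $W^*$. An $n$-dimensional linear space (linear system of skew-symmetric forms) is $\mathbb{P}(A)\subset \mathbb{P}(\bigwedge^2W^* )$ with $A\subset\bigwedge^2W^*$ a linear subspace of dimension $n+1$; a plane is a 2-dimensional linear space. Angle brackets denote (projective) linear span. ''A general plane'' means every plane in a non-empty Zariski open subset of the Grassmannian of planes in $\mathbb{P}(A)$. Action and stability: $g\in GL(W)$ acts on forms by $M_\omega\mapsto gM_\omega g^T$ on the representing skew-symmetric matrices, hence on linear subspaces; two linear spaces are $SL(W)$-equivalent if they lie in the same $SL(W)$-orbit. Let $V_{n+1}$ be a complex vector space of dimension $n+1$. Choosing an injective linear map $\phi:V_{n+1}\to\bigwedge^2W^*$ with image $A$, one regards $A$ as a vector of $V_{n+1}^*\otimes\bigwedge^2W^*$, on which $SL(W)$ acts through the second factor. $\mathbb{P}(A)$ is stable if the orbit $SL(W)\cdot A$ is closed in $V_{n+1}^*\otimes\bigwedge^2W^*$ and the stabilizer of $A$ (as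 a vector of this space) in $SL(W)$ is finite; this does not depend on the choice of $\phi$. *)

(* Defs.v *)
From mathcomp Require Export all_boot all_order all_algebra.
From mathcomp Require Export reals complex mpoly.

Set Implicit Arguments.
Unset Strict Implicit.
Unset Printing Implicit Defensive.

Import GRing.Theory.
Local Open Scope ring_scope.

(* [W] is identified with F^6, and [\wedge^2 W^*] with the skew-symmetric
   matrices in 'M[F]_6; a linear space P(A) is given by A : {vspace 'M[F]_6},
   so that P(A) has projective dimension n when [\dim A = n.+1], and points of
   P(A) are represented by the nonzero elements of A. *)

Section Zariski.
Variables (F : fieldType) (E : vectType F).

(* The topologies below do not depend on the basis of E used for coordinates. *)
Definition coords (x : E) (i : 'I_(\dim {:E})) : F := coord (vbasis {:E}) i x.

Definition zariski_closed (Z : E -> Prop) : Prop :=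
  exists Q : {mpoly F[\dim {:E}]} -> Prop,
    forall x, Z x <-> forall q, Q q -> q.@[coords x] = 0.

(* The coordinates are indexed by all maps 'I_k -> 'I_(\dim {:E}) instead of only
   the increasing ones: the additional coordinates are zero or repeat the others
   up to sign, hence the induced topology is the same. *)
Definition plucker k (X : k.-tuple E)
    (s : 'I_#|{: {ffun 'I_k -> 'I_(\dim {:E})}}|) : F :=
  \det (\matrix_(i, j) coords (tnth X i) ((enum_val s : {ffun _ -> _}) j)).

(* Zariski open subsets of the Grassmannian of k-dimensional subspaces of A;
   since the polynomials are homogeneous, the choice of X is immaterial. *)
Definition grass_open k (A : {vspace E}) (U : {vspace E} -> Prop) : Prop :=
  exists Q : {mpoly F[#|{: {ffun 'I_k -> 'I_(\dim {:E})}}|]} -> Prop,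
    (forall q, Q q -> exists d : nat, q \is d.-homog) /\
    (forall (B : {vspace E}) (X : k.-tuple E),
       (B <= A)%VS -> \dim B = k -> basis_of B X ->
       (U B <-> exists2 q, Q q & q.@[plucker X] != 0)).

Definition for_general_subspace k (A : {vspace E}) (P : {vspace E} -> Prop) :=
  exists U : {vspace E} -> Prop,
    [/\ grass_open k A U,
        exists B : {vspace E}, [/\ (B <= A)%VS, \dim B = k & U B] &
        forall B : {vspace E}, (B <= A)%VS -> \dim B = k -> U B -> P B].

End Zariski.

Section SkewForms.
Variable F : fieldType.

Definition skew (M : 'M[F]_6) : Prop := M^T = - M.

Definition in_Pf (M : 'M[F]_6) : Prop := skew M /\ (\rank M <= 4)%N.

Definition in_Gr2 (M : 'M[F]_6) : Prop := skew M /\ \rank M = 2%N.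

Definition misses_Gr2 (B : {vspace 'M[F]_6}) : Prop :=
  forall M, M \in B -> M != 0 -> ~ in_Gr2 M.

(* M |-> g *m M *m g^T *)
Definition form_act (g : 'M[F]_6) : 'End('M[F]_6) :=
  linfun (mulmxr g^T \o mulmx g).

Definition SL_equiv (B B' : {vspace 'M[F]_6}) : Prop :=
  exists2 g : 'M[F]_6, \det g = 1 & (form_act g @: B)%VS = B'.

(* A tensor in V^* (x) \wedge^2 W^*, with V = F^m, is a linear map from V to
   'M[F]_6 with skew-symmetric values. These maps form a linear subspace of
   'Hom('rV[F]_m, 'M[F]_6), so that an orbit of such tensors is closed in one of
   the two spaces iff it is closed in the other. *)
Definition tensor_act m (g : 'M[F]_6) (phi : 'Hom('rV[F]_m, 'M[F]_6)) :=
  (form_act g \o phi)%VF.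

Definition SL_orbit m (phi psi : 'Hom('rV[F]_m, 'M[F]_6)) : Prop :=
  exists2 g : 'M[F]_6, \det g = 1 & psi = tensor_act g phi.

Definition SL_stab m (phi : 'Hom('rV[F]_m, 'M[F]_6)) (g : 'M[F]_6) : Prop :=
  \det g = 1 /\ tensor_act g phi = phi.

Definition stable_tensor m (phi : 'Hom('rV[F]_m, 'M[F]_6)) : Prop :=
  zariski_closed (SL_orbit phi) /\
  exists s : seq 'M[F]_6, forall g, SL_stab phi g -> g \in s.

Definition stable (A : {vspace 'M[F]_6}) : Prop :=
  exists phi : 'Hom('rV[F]_(\dim A), 'M[F]_6),
    [/\ lker phi = 0%VS, limg phi = A & stable_tensor phi].

(* Linear forms on W are row vectors, and u /\ v is the form
   (x, y) |-> u(x) v(y) - v(x) u(y). *)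
Definition wedge (u v : 'rV[F]_6) : 'M[F]_6 := u^T *m v - v^T *m u.

Definition pi_g (e : 6.-tuple 'rV[F]_6) : {vspace 'M[F]_6} :=
  let e1 := e`_0 in let e2 := e`_1 in let e3 := e`_2 in
  let e4 := e`_3 in let e5 := e`_4 in let e6 := e`_5 in
  <<[:: wedge e1 e4 + wedge e2 e5; wedge e1 e6 + wedge e3 e5;
        wedge e2 e6 - wedge e3 e4]%R>>%VS.

End SkewForms.

(* Main.v *)
From HB Require Import structures.
Require Import Defs.
From mathcomp Require Import boolp ring.

(* Stability is used through one-parameter subgroups only: in a stable A no vector of
   W is in the kernel of all forms, and no 3-dimensional subspace of W is isotropic
   for all forms.

   A form of maximal rank in A has a kernel that is isotropic for all of A; hence the
   maximal rank is 4. If the kernels of any two forms of rank 4 met, they would share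
   a line or lie in a common 3-space, which would be isotropic. So there are M, N in A
   with W = ker M + ker N + (a plane), and they can be normalized simultaneously. The
   vanishing of the Pfaffian of T + x M + y N then forces the block of T in A on
   ker M x ker N to be symmetric. If all these blocks are singular, there is an
   isotropic 3-space; otherwise A contains, in suitable coordinates W = F^3 (x) F^2,
   the plane (/\^2 F^3) (x) I, which is a copy of pi_g.

   The Pfaffian also shows that A lies in (/\^2 F^3) (x) S^2 F^2, and that, modulo I,
   it is a linear space of 3 x 2 matrices of rank at most 1. Such a space is contained
   in F^3 (x) d or in e (x) F^2. In the first case d is not isotropic by stability, so
   A lies in /\^2 U + /\^2 U' with W^* = U + U', and planes without forms of rank 2
   are graphs of isomorphisms between /\^2 U and /\^2 U'. In the second case the forms
   of rank 2 in A lie on a conic in the plane e (x) S^2 F^2. *)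

Set Implicit Arguments.
Unset Strict Implicit.
Unset Printing Implicit Defensive.

Import GRing.Theory Num.Theory.
Local Open Scope ring_scope.

(** * One-parameter subgroups and instability *)

(** Bound (1) comes from the vector (1, i), isotropic for the symmetric form I: if A were only (/\^2
    F^3) (x) I, the 3-space F^3 (x) (1, i) would be isotropic for all of A. Bound (4) counts
    coordinates: at most 3 + 3 in /\^2 U + /\^2 U', and at most 2 + 3 in the other case, two scalars
    and a symmetric 2 x 2 block. The Pfaffian is never obtained as a square root of the determinant:
    for a skew-symmetric G with Pfaffian pf, x G = 0 implies pf x = 0, which is enough to make pf
    vanish on singular forms. Algebraic closedness enters through square roots (to factor a
    symmetric block as h h^T, to diagonalize by an orthogonal matrix, to find a singular member in a
    pencil of symmetric blocks) and through the sixth root that moves an element of GL(W) into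
    SL(W). *)

Section InfiniteField.
Variable F : numFieldType.

Lemma natr_inj_pos : injective (fun k : nat => k.+1%:R : F).
Proof. by move=> i j /eqP; rewrite eqr_nat => /eqP []. Qed.

Lemma poly_eq0_off0 (p : {poly F}) : (forall t : F, t != 0 -> p.[t] = 0) -> p = 0.
Proof.
move=> p0; pose rs := [seq k.+1%:R : F | k <- iota 0 (size p)].
apply: (@roots_geq_poly_eq0 _ _ rs); last by rewrite size_map size_iota.
  by apply/allP=> _ /mapP[k _ ->]; apply/rootP/p0; rewrite pnatr_eq0.
by rewrite map_inj_uniq ?iota_uniq //; apply: natr_inj_pos.
Qed.

Lemma horner_det n (m : 'M[{poly F}]_n) t :
  (\det m).[t] = \det (map_mx (horner_eval t) m).
Proof. by rewrite -[LHS]/(horner_eval t _) -det_map_mx. Qed.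

Lemma rank_rows m n (A : 'M[F]_(m, n)) r : (r <= \rank A)%N ->
  exists2 B : 'M_(r, n), row_free B & (B <= A)%MS.
Proof.
move=> r_le; exists ((pid_mx r : 'M_(r, \rank A)) *m row_base A); last first.
  by apply: submx_trans (submxMl _ _) _; rewrite eq_row_base.
by rewrite /row_free mxrankMfree ?row_base_free // rank_pid_mx.
Qed.

Lemma det_pencil_near0 n (a b : 'M[F]_n) : \det a != 0 ->
  exists2 t : F, t != 0 & \det (a + t *: b) != 0.
Proof.
move=> a_neq0.
pose p := \det (map_mx polyC a + 'X *: map_mx polyC b).
have pE t : p.[t] = \det (a + t *: b).
  rewrite horner_det; congr (\det _); apply/matrixP=> i j.
  by rewrite !mxE /horner_eval !hornerE.
(* The factor 'X makes 0 a root, so a non-root of [q] is automatically nonzero. *)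
pose q := 'X * p.
have q_neq0 : q != 0.
  rewrite mulf_neq0 ?polyX_eq0 //; apply: contraNneq a_neq0 => p0.
  by rewrite -[a]addr0 -[0](scale0r b) -pE p0 horner0.
have [t _ t_root] : exists2 t, t \in predT & ~~ root q t.
  pose rs := [seq k.+1%:R : F | k <- iota 0 (size q)].
  have [/allP all_roots|/allPn[t _ t_root]] := boolP (all (root q) rs); last by exists t.
  case/eqP: q_neq0; apply: (@roots_geq_poly_eq0 _ _ rs).
  - exact/allP.
  - by rewrite map_inj_uniq ?iota_uniq //; apply: natr_inj_pos.
  - by rewrite size_map size_iota.
move: t_root; rewrite rootM negb_or => /andP[t_neq0 pt_neq0].
exists t; first by rewrite rootX in t_neq0.
by rewrite -pE.
Qed.

(** Compressed by [v] and [u], M becomes an identity matrix of size \rank M, and the compression of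
    M + t N stays invertible for some nonzero t. *)
Lemma rank_pencil_near0 m n (M N : 'M[F]_(m, n)) :
  exists2 t : F, t != 0 & (\rank M <= \rank (M + t *: N)%R)%N.
Proof.
have [u uM] := row_freeP (row_base_free M).
have [v vM] : exists v, v *m M = row_base M.
  by have /submxP[v] : (row_base M <= M)%MS; [rewrite eq_row_base | exists v].
have [|t t_neq0] := @det_pencil_near0 _ (v *m M *m u) (v *m N *m u).
  by rewrite vM uM det1 oner_eq0.
rewrite -unitfE -[_ \is a GRing.unit]/(_ \in unitmx) => unit_t.
exists t => //; rewrite -[X in (X <= _)%N](mxrank_unit unit_t).
have ->: v *m M *m u + t *: (v *m N *m u) = v *m (M + t *: N) *m u.
  by rewrite mulmxDr mulmxDl -scalemxAr -scalemxAl.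
apply: (leq_trans (mxrankM_maxl _ _)).
exact: mxrankM_maxr.
Qed.

(* Otherwise the minor bordering a maximal nonzero minor of M with x and y has a
   nonzero linear term in t. *)
Lemma ker_isotropic m n (M N : 'M[F]_(m, n)) (x : 'rV_m) (y : 'rV_n) :
    (forall t : F, (\rank (M + t *: N)%R <= \rank M)%N) ->
  x *m M = 0 -> M *m y^T = 0 -> x *m N *m y^T = 0.
Proof.
move=> rk_le xM My.
set r := \rank M in rk_le.
have [u uM] := row_freeP (row_base_free M).
have [v vM] : exists v, v *m M = row_base M.
  by have /submxP[v] : (row_base M <= M)%MS; [rewrite eq_row_base | exists v].
pose a := v *m N *m u; pose b := v *m N *m y^T; pose c := x *m N *m u.
pose d := x *m N *m y^T.
(* [big t] is the bordered minor of M + t N with its last column divided by t. The rank bound makes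
   its determinant vanish for t != 0, hence also at t = 0, where it is block triangular with corner
   [d]. *)
pose big t : 'M_(r + 1) := block_mx (1%:M + t *: a) b (t *: c) d.
pose P := map_mx polyC a; pose Q := block_mx (1%:M + 'X *: P) (map_mx polyC b)
  ('X *: map_mx polyC c) (map_mx polyC d) : 'M_(r + 1).
have QE t : (\det Q).[t] = \det (big t).
  rewrite horner_det; congr (\det _); apply/matrixP=> i j.
  rewrite !mxE; case: (split i) => i'; rewrite !mxE; case: (split j) => j';
  by rewrite !mxE /horner_eval !(hornerE, hornerMn).
have Q0 : \det Q = 0.
  apply: poly_eq0_off0 => t t_neq0; rewrite QE.
  have eq_big : block_mx (1%:M + t *: a) (t *: b) (t *: c) (t *: d) =
      big t *m block_mx 1%:M 0 0 t%:M.
    by rewrite mulmx_block !mulmx0 !mulmx1 !addr0 !add0r !mul_mx_scalar.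
  have eq_MN : block_mx (1%:M + t *: a) (t *: b) (t *: c) (t *: d) =
      col_mx v x *m (M + t *: N) *m row_mx u y^T.
    rewrite !mul_col_mx !mul_mx_row /block_mx.
    rewrite !mulmxDr !mulmxDl -!scalemxAr -!scalemxAl vM uM -vM -(mulmxA v M) My.
    by rewrite xM mul0mx mulmx0 mul0mx !add0r.
  apply/eqP; rewrite -[_ == 0]negbK; apply/negP => det_neq0.
  have : big t *m block_mx 1%:M 0 0 t%:M \in unitmx.
    rewrite unitmxE det_mulmx unitrM unitfE det_neq0 det_ublock det1 mul1r.
    by rewrite det_scalar1 unitfE.
  move/mxrank_unit; rewrite -eq_big eq_MN => eq_rk.
  have : (r + 1 <= r)%N.
    rewrite -[X in (X <= _)%N]eq_rk.
    apply: (leq_trans (mxrankM_maxl _ _)); apply: leq_trans (rk_le t).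
    exact: mxrankM_maxr.
  by rewrite addn1 ltnn.
have := QE 0; rewrite Q0 horner0 /big !scale0r addr0 det_ublock det1 mul1r.
rewrite {1}[d]mx11_scalar det_scalar1 => d0.
by rewrite -/d [d]mx11_scalar -d0 raddf0.
Qed.

End InfiniteField.

Section Instability.
Variable F : numFieldType.

(** A polynomial that vanishes on a punctured curve vanishes at its limit. The exponent 2 is the
    weight that occurs for both one-parameter subgroups used below. *)
Lemma meval_line n (q : {mpoly F[n]}) (a b : 'I_n -> F) :
    (forall t : F, t != 0 -> q.@[fun i => a i + t ^+ 2 * b i] = 0) ->
  q.@[a] = 0.
Proof.
move=> q0; pose p := mmap polyC (fun i => (a i)%:P + 'X^2 * (b i)%:P) q.
have pE t : p.[t] = q.@[fun i => a i + t ^+ 2 * b i].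
  rewrite mevalE /p /mmap horner_sum; apply: eq_bigr => m _.
  rewrite hornerM hornerC /mmap1 horner_prod; congr (_ * _).
  by apply: eq_bigr => i _; rewrite horner_exp !hornerE.
have p0 : p = 0 by apply: poly_eq0_off0 => t /q0; rewrite pE.
have := pE 0; rewrite p0 horner0 => ->; apply: meval_eq => i.
by rewrite expr0n mul0r addr0.
Qed.

Lemma form_actE (g M : 'M[F]_6) : form_act g M = g *m M *m g^T.
Proof. by rewrite lfunE. Qed.

Lemma form_actM (g h : 'M[F]_6) : form_act (g *m h) = (form_act g \o form_act h)%VF.
Proof.
by apply/lfunP=> M; rewrite comp_lfunE !form_actE trmx_mul !mulmxA.
Qed.

Lemma form_act1 : form_act (1%:M : 'M[F]_6) = \1%VF.
Proof. by apply/lfunP=> M; rewrite id_lfunE form_actE trmx1 mul1mx mulmx1. Qed.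

Lemma tensor_actM m g h (phi : 'Hom('rV[F]_m, 'M[F]_6)) :
  tensor_act (g *m h) phi = tensor_act g (tensor_act h phi).
Proof. by rewrite /tensor_act form_actM comp_lfunA. Qed.

Lemma tensor_act1 m (phi : 'Hom('rV[F]_m, 'M[F]_6)) : tensor_act 1%:M phi = phi.
Proof. by rewrite /tensor_act form_act1 comp_lfun1l. Qed.

(* Letting t tend to 0 shows that phi0 lies in the closed orbit of phi, while phi0
   is fixed by the infinitely many matrices D t. *)
Lemma one_param_unstable m (phi phi0 phi2 : 'Hom('rV[F]_m, 'M[F]_6))
    (D : F -> 'M[F]_6) :
    phi = phi0 + phi2 ->
    (forall t, t != 0 -> \det (D t) = 1) ->
    (forall t, t != 0 -> tensor_act (D t) phi0 = phi0) ->
    (forall t, t != 0 -> tensor_act (D t) phi2 = t ^+ 2 *: phi2) ->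
    (forall s t, s != 0 -> t != 0 -> D s = D t -> s = t) ->
  ~ stable_tensor phi.
Proof.
move=> phiE detD Dphi0 Dphi2 Dinj [[Q orbitE] [s stabE]].
have [g detg phi0E] : SL_orbit phi phi0.
  apply/orbitE => q Qq; apply: (@meval_line _ q _ (coords phi2)) => t t_neq0.
  have /orbitE/(_ q Qq) : SL_orbit phi (phi0 + t ^+ 2 *: phi2).
    exists (D t); first exact: detD.
    by rewrite -{1}(Dphi0 t) // -Dphi2 // phiE /tensor_act comp_lfunDr.
  by move=> <-; apply: meval_eq => i; rewrite /coords linearD linearZ.
have g_unit : g \in unitmx by rewrite unitmxE detg unitr1.
(* As g carries [phi] to [phi0], conjugation by g turns the matrices D t, which fix [phi0], into
   stabilizers of [phi]. *)
pose f (k : nat) := invmx g *m D k.+1%:R *m g.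
have f_stab k : f k \in s.
  have k_neq0 : k.+1%:R != 0 :> F by rewrite pnatr_eq0.
  apply: stabE; split.
    by rewrite !det_mulmx detD // mulr1 -det_mulmx mulVmx // det1.
  by rewrite !tensor_actM -phi0E Dphi0 // phi0E -tensor_actM mulVmx // tensor_act1.
have f_inj : injective f.
  move=> i j /(congr1 (fun h => g *m h *m invmx g)).
  rewrite /f !mulmxA mulmxV // !mul1mx !mulmxK // => /Dinj.
  by rewrite !pnatr_eq0 => /(_ isT isT)/natr_inj_pos.
have : (size [seq f k | k <- iota 0 (size s).+1] <= size s)%N.
  apply: uniq_leq_size; first by rewrite map_inj_uniq ?iota_uniq.
  by move=> _ /mapP[k _ ->]; apply: f_stab.
by rewrite size_map size_iota ltnn.
Qed.

End Instability.

Section StabilityCriteria.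
Variable F : numFieldType.

Lemma complement_rows r s (L : 'M[F]_(r, r + s)) : row_free L ->
  exists C : 'M_(s, r + s), col_mx L C \in unitmx.
Proof.
move=> L_free; have rkL : \rank L = r by apply/eqP.
have [|C C_free C_le] := @rank_rows F _ _ (L^C)%MS s; first by rewrite mxrank_compl rkL addKn.
exists C; rewrite -row_free_unit -kermx_eq0; apply/rowV0P=> v /sub_kermxP.
rewrite -[v]hsubmxK mul_row_col => eq0.
have lv0 : lsubmx v *m L = 0.
  apply/eqP; rewrite -submx0 -(capmx_compl L) sub_capmx submxMl /=.
  have -> : lsubmx v *m L = - (rsubmx v *m C) by apply/eqP; rewrite -addr_eq0 eq0.
  by rewrite eqmx_opp; apply: submx_trans C_le; apply: submxMl.
have rv0 : rsubmx v *m C = 0 by rewrite lv0 add0r in eq0.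
have /eqP -> : lsubmx v == 0 by rewrite -(mulmx_free_eq0 _ L_free) lv0.
have /eqP -> : rsubmx v == 0 by rewrite -(mulmx_free_eq0 _ C_free) rv0.
by rewrite row_mx0.
Qed.

(** With p and p' the projectors onto the row space of L and onto a complement, x p + y p' has
    eigenvalues x and y of multiplicities r and s. Powers of t with x^r y^s = 1 then give
    one-parameter subgroups of SL. *)
Lemma complementary_projectors r s (L : 'M[F]_(r, r + s)) : row_free L ->
  exists p : 'M_(r + s), exists p' : 'M_(r + s),
    [/\ p + p' = 1%:M, p *m p' = 0, p' *m p = 0, exists a, p = a *m L &
        forall x y, \det (x *: p + y *: p') = x ^+ r * y ^+ s].
Proof.
move=> L_free; have [C gU] := complement_rows L_free.
set g := col_mx L C in gU.
pose e : 'M[F]_(r + s) := block_mx 1%:M 0 0 0.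
pose e' : 'M[F]_(r + s) := block_mx 0 0 0 1%:M.
exists (invmx g *m e *m g), (invmx g *m e' *m g).
have dE : e + e' = 1%:M by rewrite add_block_mx !addr0 !add0r -scalar_mx_block.
have conjM a b : invmx g *m a *m g *m (invmx g *m b *m g) = invmx g *m (a *m b) *m g.
  by rewrite !mulmxA mulmxK.
split.
- by rewrite -mulmxDl -mulmxDr dE mulmx1 mulVmx.
- by rewrite conjM mulmx_block !(mulmx0, mul0mx, mulmx1, addr0) block_mx0 mulmx0 mul0mx.
- by rewrite conjM mulmx_block !(mulmx0, mul0mx, mulmx1, addr0) block_mx0 mulmx0 mul0mx.
- exists (invmx g *m col_mx 1%:M 0).
  rewrite -!mulmxA; congr (_ *m _).
  rewrite /e /g mul_block_col mul_col_mx !mul1mx !mul0mx.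
  by rewrite !addr0.
have scE c (b : 'M_(r + s)) : c *: (invmx g *m b *m g) = invmx g *m (c *: b) *m g.
  by rewrite -scalemxAr -scalemxAl.
move=> x y; rewrite !scE -mulmxDl -mulmxDr !det_mulmx.
rewrite mulrAC -det_mulmx mulVmx // det1 mul1r !scale_block_mx add_block_mx.
by rewrite !scaler0 !addr0 !add0r !scalemx1 det_ublock !det_scalar.
Qed.

Lemma scale_pq_inj n (p p' : 'M[F]_n) (f : F -> F) :
    p + p' = 1%:M -> p *m p' = 0 -> p' *m p = 0 -> p' != 0 ->
  forall s t, f s *: p + s *: p' = f t *: p + t *: p' -> s = t.
Proof.
move=> pD pp' p'p p'_neq0 s t /(congr1 (fun m => p' *m m)).
have p'2 : p' *m p' = p' by rewrite -{3}[p']mulmx1 -pD mulmxDr p'p add0r.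
rewrite !mulmxDr -!scalemxAr p'p p'2 !scaler0 !add0r => /eqP.
by rewrite -subr_eq0 -scalerBl scaler_eq0 (negbTE p'_neq0) orbF subr_eq0 => /eqP.
Qed.

Variables (A : {vspace 'M[F]_6}).
Hypothesis stA : stable A.

(** The projector p onto the line of u kills every form on both sides, so t^-5 p + t p', of
    determinant 1, multiplies the whole tensor by t^2, and its limit at t = 0 is zero. *)
Lemma stable_common_kernel (u : 'rV_6) :
    (forall M, M \in A -> M^T = - M) -> (forall M, M \in A -> u *m M = 0) ->
  u = 0.
Proof.
move=> skA uA; apply/eqP/negPn/negP => u_neq0.
have u_free : @row_free F 1 (1 + 5) u by rewrite /row_free rank_rV u_neq0.
have [p [p' [pD pp' p'p [a pE] detD]]] := complementary_projectors u_free.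
have [phi [_ limphi]] := stA.
have phiA v : phi v \in A by have := memv_img phi (memvf v); rewrite limphi.
have pM0 v : p *m phi v = 0.
  by rewrite pE -mulmxA uA ?mulmx0 ?phiA.
have Mp0 v : phi v *m p^T = 0.
  by apply: trmx_inj; rewrite trmx_mul trmxK skA ?phiA // mulmxN pM0 oppr0 trmx0.
have p'M v : p' *m phi v = phi v by rewrite -[RHS]mul1mx -pD mulmxDl pM0 add0r.
have Mp' v : phi v *m p'^T = phi v.
  by rewrite -[RHS]mulmx1 -trmx1 -pD raddfD /= mulmxDr Mp0 add0r.
apply: (@one_param_unstable F _ phi 0 phi (fun t => t ^- 5 *: p + t *: p')).
- by rewrite add0r.
- by move=> t t_neq0; rewrite detD mulVf // expf_neq0.
- by move=> t _; rewrite /tensor_act comp_lfun0r.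
- move=> t t_neq0; apply/lfunP=> v; rewrite comp_lfunE form_actE scale_lfunE.
  rewrite mulmxDl -!scalemxAl pM0 p'M scaler0 add0r raddfD /= !linearZ /=.
  rewrite mulmxDr -!scalemxAr -!scalemxAl Mp0 Mp' !scaler0 add0r.
  by rewrite scalerA.
move=> s t s_neq0 t_neq0; apply: (@scale_pq_inj _ p p' (fun t => t ^- 5)) => //.
apply: contraTneq u_neq0 => p'0; rewrite negbK.
move: (mxrank1 F 6); rewrite -pD p'0 addr0 pE => rk.
have := mxrankM_maxr a u; rewrite rk => h.
by have := leq_trans h (rank_leq_row u).
Qed.

(** Isotropy kills the (p, p) part of every form. Under t^-1 p + t p' the mixed parts have weight 0
    and the (p', p') part has weight 2, so the tensor degenerates to its mixed parts. *)
Lemma stable_isotropic (L : 'M_(3, 6)) : row_free L ->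
  ~ (forall M, M \in A -> L *m M *m L^T = 0).
Proof.
move=> L_free LA.
have [p [p' [pD pp' p'p [a pE] detD]]] := @complementary_projectors 3 3 L L_free.
have [phi [_ limphi]] := stA.
have phiA v : phi v \in A by have := memv_img phi (memvf v); rewrite limphi.
have pMp v : p *m phi v *m p^T = 0.
  rewrite pE trmx_mul !mulmxA -2!(mulmxA a) LA ?phiA //.
  by rewrite mulmx0 mul0mx.
have p'2 : p' *m p' = p' by rewrite -{3}[p']mulmx1 -pD mulmxDr p'p add0r.
have p2 : p *m p = p by rewrite -{3}[p]mulmx1 -pD mulmxDr pp' addr0.
have phi0E v : (phi - tensor_act p' phi) v =
    p *m phi v *m p'^T + p' *m phi v *m p^T.
  rewrite add_lfunE opp_lfunE comp_lfunE form_actE.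
  rewrite -{1}[phi v]mul1mx -{1}[1%:M *m _]mulmx1 -{2}trmx1 -pD raddfD /=.
  rewrite !mulmxDr !mulmxDl pMp add0r.
  by rewrite addrA addrK addrC.
apply: (@one_param_unstable F _ phi (phi - tensor_act p' phi) (tensor_act p' phi)
    (fun t => t^-1 *: p + t *: p')).
- by rewrite subrK.
- by move=> t t_neq0; rewrite detD -exprMn mulVf // expr1n.
- move=> t t_neq0; apply/lfunP=> v; rewrite [in LHS]comp_lfunE phi0E form_actE.
  have Dp : (t^-1 *: p + t *: p') *m p = t^-1 *: p.
    by rewrite mulmxDl -!scalemxAl p2 p'p scaler0 addr0.
  have Dp' : (t^-1 *: p + t *: p') *m p' = t *: p'.
    by rewrite mulmxDl -!scalemxAl p'2 pp' scaler0 add0r.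
  rewrite mulmxDr mulmxDl !mulmxA Dp Dp' -!mulmxA -!trmx_mul Dp Dp'.
  rewrite !linearZ /= -!scalemxAl !scalerA.
  by rewrite mulVf // mulfV // !scale1r.
- move=> t t_neq0; rewrite -tensor_actM mulmxDl -!scalemxAl p'2 pp' scaler0 add0r.
  apply/lfunP=> v; rewrite scale_lfunE !comp_lfunE !form_actE.
  by rewrite linearZ /= -scalemxAr -!scalemxAl scalerA.
move=> s t s_neq0 t_neq0; apply: (@scale_pq_inj _ p p' (fun t => t^-1)) => //.
apply/eqP=> p'0; move: (mxrank1 F 6); rewrite -pD p'0 addr0 pE => rk.
have := mxrankM_maxr a L; rewrite rk => h.
by have := leq_trans h (rank_leq_row L).
Qed.

End StabilityCriteria.

(** * Kernels of forms of rank 4 *)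

Section KernelsOfRankFour.
Variables (F : numFieldType) (A : {vspace 'M[F]_6}).
Hypothesis skA : forall M, M \in A -> M^T = - M.
Hypothesis rkA : forall M, M \in A -> (\rank M <= 4)%N.
Hypothesis kerA : forall u : 'rV_6, (forall M, M \in A -> u *m M = 0) -> u = 0.
Hypothesis isoA : forall L : 'M_(3, 6),
  row_free L -> ~ (forall M, M \in A -> L *m M *m L^T = 0).

Lemma gram_row m n (K : 'M[F]_(m, 6)) (T : 'M_6) (L : 'M_(n, 6)) i j :
  (K *m T *m L^T) i j = (row i K *m T *m (row j L)^T) 0 0.
Proof. by rewrite -row_mul !mxE; apply: eq_bigr => k _; rewrite !mxE. Qed.

Lemma skew_kerT m (K : 'M_(m, 6)) M : M \in A -> K *m M = 0 -> M *m K^T = 0.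
Proof.
by move=> MA KM; apply: trmx_inj; rewrite trmx_mul trmxK skA // mulmxN KM oppr0 trmx0.
Qed.

Lemma kernel_isotropic m n (K : 'M_(m, 6)) (L : 'M_(n, 6)) M N :
    M \in A -> N \in A -> (forall T, T \in A -> (\rank T <= \rank M)%N) ->
  K *m M = 0 -> L *m M = 0 -> K *m N *m L^T = 0.
Proof.
move=> MA NA Mmax KM LM; apply/matrixP=> i j; rewrite gram_row.
have -> : row i K *m N *m (row j L)^T = 0; last by rewrite !mxE.
apply: (@ker_isotropic _ _ _ M).
- by move=> t; apply: Mmax; rewrite memvD // memvZ.
- by rewrite -row_mul KM row0.
- by apply: skew_kerT => //; rewrite -row_mul LM row0.
Qed.

Lemma exists_rank4 : exists2 M, M \in A & \rank M = 4%N.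
Proof.
pose P k := `[< exists2 M, M \in A & \rank M = k >].
have exP : exists k, P k by exists 0%N; apply/asboolP; exists 0; rewrite ?mem0v ?mxrank0.
have leP k : P k -> (k <= 4)%N by move=> /asboolP[M MA <-]; apply: rkA.
case: (ex_maxnP exP leP) => r /asboolP[M MA Mr] rmax.
exists M => //; rewrite Mr; apply/eqP; rewrite eqn_leq leP; last by apply/asboolP; exists M.
rewrite leqNgt; apply/negP => r_lt4.
have [|L L_free L_le] := @rank_rows F _ _ (kermx M) 3.
  by rewrite mxrank_ker Mr leq_subRL ?addn3 // ltnW // ltnW // ltnW.
have LM : L *m M = 0 by apply/sub_kermxP.
apply: (isoA L_free) => N NA; apply: (@kernel_isotropic _ _ _ _ M) => //.
by move=> T TA; rewrite Mr; apply: rmax; apply/asboolP; exists T.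
Qed.

(** If a form M of rank 4 kills u, some N does not; M + t N still has rank 4 for a suitable t != 0,
    and it does not kill u. *)
Lemma exists_rank4_notin_kernel (u : 'rV_6) : u != 0 ->
  exists2 M, M \in A & \rank M = 4%N /\ u *m M != 0.
Proof.
move=> u_neq0; have [M MA Mr] := exists_rank4.
have [uM|] := eqVneq (u *m M) 0; last by exists M.
have [N [NA uN]] : exists N, N \in A /\ u *m N != 0.
  apply/not_existsP=> uA; case/eqP: u_neq0; apply: kerA => N NA.
  by apply/eqP/negPn/negP => uN; apply: (uA N).
have [t t_neq0 rk_t] := rank_pencil_near0 M N.
have MtA : M + t *: N \in A by rewrite memvD // memvZ.
exists (M + t *: N) => //; split.
  by apply/eqP; rewrite eqn_leq rkA //= -{1}Mr.
by rewrite mulmxDr uM add0r -scalemxAr scaler_eq0 negb_or t_neq0.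
Qed.

Lemma rank4_kernel M : M \in A -> \rank M = 4%N ->
  exists K : 'M_(2, 6), [/\ row_free K, K *m M = 0 &
    forall x : 'rV_6, x *m M = 0 -> exists c : 'rV_2, x = c *m K].
Proof.
move=> MA Mr.
have [|K K_free K_le] := @rank_rows F _ _ (kermx M) 2; first by rewrite mxrank_ker Mr.
exists K; split=> //; first exact/sub_kermxP.
move=> x /sub_kermxP xM; apply/submxP; apply: submx_trans xM _.
by rewrite -mxrank_leqif_sup // mxrank_ker Mr (eqP K_free).
Qed.

Lemma isotropic_triple (x y z : 'rV_6) :
    (forall a b c : F, a *: x + b *: y + c *: z = 0 -> [/\ a = 0, b = 0 & c = 0]) ->
  ~ (forall N, N \in A ->
      [/\ x *m N *m y^T = 0, x *m N *m z^T = 0 & y *m N *m z^T = 0]).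
Proof.
move=> xyz_free xyz_iso.
pose L : 'M_(1 + (1 + 1), 6) := col_mx x (col_mx y z).
apply: (isoA (L := L)) => [|N NA].
  apply: (@inj_row_free F (1 + (1 + 1)) 6 L) => w; rewrite -[w]hsubmxK mul_row_col.
  rewrite -[rsubmx w]hsubmxK mul_row_col.
  rewrite [lsubmx w]mx11_scalar [lsubmx (rsubmx w)]mx11_scalar.
  rewrite [rsubmx (rsubmx w)]mx11_scalar !mul_scalar_mx addrA.
  by move=> /xyz_free[-> -> ->]; rewrite !raddf0 !row_mx0.
have self (v : 'rV_6) : v *m N *m v^T = 0.
  have : (v *m N *m v^T)^T = - (v *m N *m v^T).
    by rewrite !trmx_mul trmxK skA // !mulNmx mulmxN mulmxA.
  move/matrixP/(_ 0 0); rewrite [X in X = _]mxE [X in _ = X]mxE => /eqP.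
  rewrite -addr_eq0 -mulr2n mulrn_eq0 /= => /eqP v0.
  by apply/matrixP=> i j; rewrite !ord1 v0 mxE.
have swap (u v : 'rV_6) : u *m N *m v^T = 0 -> v *m N *m u^T = 0.
  move=> uv; apply: trmx_inj; rewrite !trmx_mul trmxK skA // mulNmx mulmxN mulmxA uv.
  by rewrite oppr0 trmx0.
have [xy xz yz] := xyz_iso N NA.
suff : (@mulmx _ (1 + (1 + 1)) 6 _ (@mulmx _ (1 + (1 + 1)) 6 6 L N) L^T = 0) by [].
rewrite /L !mul_col_mx !tr_col_mx !mul_mx_row !self xy xz yz !(swap _ _ xy) !(swap _ _ xz).
by rewrite !(swap _ _ yz) !row_mx0 !col_mx0.
Qed.

(* Planes meeting pairwise in lines share a line or lie in a common 3-space; here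
   the 3-space would be isotropic. *)
Lemma exists_disjoint_kernels :
  exists M N, [/\ M \in A, N \in A, \rank M = 4%N, \rank N = 4%N &
    forall x : 'rV_6, x *m M = 0 -> x *m N = 0 -> x = 0].
Proof.
apply: contrapT => no_pair.
have meet M N : M \in A -> N \in A -> \rank M = 4%N -> \rank N = 4%N ->
    exists2 x : 'rV_6, x != 0 & x *m M = 0 /\ x *m N = 0.
  move=> MA NA Mr Nr; apply: contrapT => no_x; apply: no_pair.
  exists M, N; split=> // x xM xN; apply/eqP/negPn/negP => x_neq0.
  by apply: no_x; exists x.
have [M0 M0A rM0] := exists_rank4.
have [K [K_free KM0 KP]] := rank4_kernel M0A rM0.
have Kv_neq0 (c : 'rV_2) : c != 0 -> c *m K != 0 by rewrite mulmx_free_eq0.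
pose u0 := delta_mx 0 0 *m K : 'rV_6.
have u0_neq0 : u0 != 0.
  apply: Kv_neq0; apply/eqP=> /matrixP/(_ 0 0); rewrite !mxE => /eqP.
  by rewrite oner_eq0.
have u0M0 : u0 *m M0 = 0 by rewrite -mulmxA KM0 mulmx0.
(* [u0] ensures that ker M0 is not contained in ker M1; below, M2 is chosen so that its kernel
   avoids the vector [a] common to ker M0 and ker M1. *)
have [M1 M1A [rM1 u0M1]] := exists_rank4_notin_kernel u0_neq0.
have [a a_neq0 [aM0 aM1]] := meet _ _ M0A M1A rM0 rM1.
have [M2 M2A [rM2 aM2]] := exists_rank4_notin_kernel a_neq0.
have [v v_neq0 [vM0 vM2]] := meet _ _ M0A M2A rM0 rM2.
have [b b_neq0 [bM1 bM2]] := meet _ _ M1A M2A rM1 rM2.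
(* [a] and [v] form a basis of ker M0, because M2 kills [v] but not [a]. If M1 killed [v] too, it
   would kill all of ker M0, including [u0]. *)
have vM1 : v *m M1 != 0.
  apply: contraNneq u0M1 => vM1.
  have [ca aE] := KP _ aM0; have [cv vE] := KP _ vM0.
  have cav_free : row_free (col_mx ca cv : 'M_(1 + 1, 2)).
    apply: inj_row_free => w; rewrite -[w]hsubmxK mul_row_col.
    move=> /(congr1 (fun y => y *m K)); rewrite mulmxDl -!mulmxA -aE -vE mul0mx.
    rewrite [lsubmx w]mx11_scalar [rsubmx w]mx11_scalar !mul_scalar_mx => eq0.
    have := congr1 (fun y => y *m M2) eq0.
    rewrite mulmxDl -!scalemxAl vM2 scaler0 addr0 mul0mx => /eqP.
    rewrite scaler_eq0 (negbTE aM2) orbF => /eqP l0.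
    move: eq0; rewrite l0 scale0r add0r => /eqP; rewrite scaler_eq0 (negbTE v_neq0) orbF.
    by move=> /eqP ->; rewrite !raddf0 row_mx0.
  have /submxP[w ->] : (u0 <= col_mx a v)%MS.
    rewrite aE vE -mul_col_mx /u0; apply: submxMr; apply: submx_full.
    by rewrite /row_full (eqP cav_free).
  by rewrite -mulmxA mul_col_mx aM1 vM1 col_mx0 mulmx0.
have max4 (M : 'M[F]_6) : \rank M = 4%N -> forall T, T \in A -> (\rank T <= \rank M)%N.
  by move=> ->; apply: rkA.
(* Any two of v, a, b lie in the kernel of one of M0, M1, M2. Independence follows by applying M1,
   which kills a and b only, and then M2, which kills b but not a. *)
apply: (@isotropic_triple v a b) => [x y z eq0|N NA].
  have := congr1 (fun r => r *m M1) eq0.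
  rewrite !mulmxDl -!scalemxAl aM1 bM1 !scaler0 !addr0 mul0mx => /eqP.
  rewrite scaler_eq0 (negbTE vM1) orbF => /eqP x0; move: eq0; rewrite x0 scale0r add0r => eq0.
  have := congr1 (fun r => r *m M2) eq0.
  rewrite !mulmxDl -!scalemxAl bM2 !scaler0 !addr0 mul0mx => /eqP.
  rewrite scaler_eq0 (negbTE aM2) orbF => /eqP y0; move: eq0; rewrite y0 scale0r add0r => /eqP.
  by rewrite scaler_eq0 (negbTE b_neq0) orbF => /eqP.
have iso (x y : 'rV_6) M : M \in A -> \rank M = 4%N -> x *m M = 0 -> y *m M = 0 ->
    x *m N *m y^T = 0 by move=> MA rM; apply: kernel_isotropic => //; apply: max4.
by split; [apply: (iso _ _ M0) | apply: (iso _ _ M2) | apply: (iso _ _ M1)].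
Qed.

End KernelsOfRankFour.

(** * Pfaffians *)

Section Pfaffian.
Variable F : numFieldType.

(* The coefficients of the linear combinations of the hypotheses in the next two proofs
   are sub-Pfaffians. *)
Lemma pf4_kernel (x0 x1 x2 x3 a01 a02 a03 a12 a13 a23 : F) :
    x1 * (- a01) + x2 * (- a02) + x3 * (- a03) = 0 ->
    x0 * a01 + x2 * (- a12) + x3 * (- a13) = 0 ->
    x0 * a02 + x1 * a12 + x3 * (- a23) = 0 ->
    x0 * a03 + x1 * a13 + x2 * a23 = 0 ->
  let pf := a01 * a23 - a02 * a13 + a03 * a12 in
  [/\ x0 * pf = 0, x1 * pf = 0, x2 * pf = 0 & x3 * pf = 0].
Proof.
move=> e0 e1 e2 e3 pf.
have -> : x0 * pf = (x0 * a01 + x2 * (- a12) + x3 * (- a13)) * a23 - (x0 * a02 + x1 * a12 + x3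
    * (- a23)) * a13 + (x0 * a03 + x1 * a13 + x2 * a23) * a12 by rewrite /pf; ring.
have -> : x1 * pf = - (x1 * (- a01) + x2 * (- a02) + x3 * (- a03)) * a23 + (x0 * a02 + x1 *
    a12 + x3 * (- a23)) * a03 - (x0 * a03 + x1 * a13 + x2 * a23) * a02 by rewrite /pf; ring.
have -> : x2 * pf = (x1 * (- a01) + x2 * (- a02) + x3 * (- a03)) * a13 - (x0 * a01 + x2 * (-
    a12) + x3 * (- a13)) * a03 + (x0 * a03 + x1 * a13 + x2 * a23) * a01 by rewrite /pf; ring.
have -> : x3 * pf = - (x1 * (- a01) + x2 * (- a02) + x3 * (- a03)) * a12 + (x0 * a01 + x2 * (-
    a12) + x3 * (- a13)) * a02 - (x0 * a02 + x1 * a12 + x3 * (- a23)) * a01 by rewrite /pf;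
    ring.
rewrite e0 e1 e2 e3 !(oppr0, mul0r, subr0, addr0).
by do !split.
Qed.

Lemma pf6_kernel (x0 x1 x2 x3 x4 x5 a01 a02 a03 a04 a05 a12 a13 a14 a15 a23 a24 a25 a34 a35
    a45 : F) :
    x1 * (- a01) + x2 * (- a02) + x3 * (- a03) + x4 * (- a04) + x5 * (- a05) = 0 ->
    x0 * a01 + x2 * (- a12) + x3 * (- a13) + x4 * (- a14) + x5 * (- a15) = 0 ->
    x0 * a02 + x1 * a12 + x3 * (- a23) + x4 * (- a24) + x5 * (- a25) = 0 ->
    x0 * a03 + x1 * a13 + x2 * a23 + x4 * (- a34) + x5 * (- a35) = 0 ->
    x0 * a04 + x1 * a14 + x2 * a24 + x3 * a34 + x5 * (- a45) = 0 ->
    x0 * a05 + x1 * a15 + x2 * a25 + x3 * a35 + x4 * a45 = 0 ->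
  let pf := a01 * (a23 * a45 - a24 * a35 + a25 * a34) - a02 * (a13 * a45 - a14 * a35 + a15 *
      a34) + a03 * (a12 * a45 - a14 * a25 + a15 * a24) - a04 * (a12 * a35 - a13 * a25 + a15 *
      a23) + a05 * (a12 * a34 - a13 * a24 + a14 * a23) in
  [/\ x0 * pf = 0, x1 * pf = 0, x2 * pf = 0, x3 * pf = 0 & x4 * pf = 0 /\ x5 * pf = 0].
Proof.
move=> e0 e1 e2 e3 e4 e5 pf.
have -> : x0 * pf = (x0 * a01 + x2 * (- a12) + x3 * (- a13) + x4 * (- a14) + x5 * (- a15)) *
    (a23 * a45 - a24 * a35 + a25 * a34) - (x0 * a02 + x1 * a12 + x3 * (- a23) + x4 * (- a24) +
    x5 * (- a25)) * (a13 * a45 - a14 * a35 + a15 * a34) + (x0 * a03 + x1 * a13 + x2 * a23 + x4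
    * (- a34) + x5 * (- a35)) * (a12 * a45 - a14 * a25 + a15 * a24) - (x0 * a04 + x1 * a14 +
    x2 * a24 + x3 * a34 + x5 * (- a45)) * (a12 * a35 - a13 * a25 + a15 * a23) + (x0 * a05 + x1
    * a15 + x2 * a25 + x3 * a35 + x4 * a45) * (a12 * a34 - a13 * a24 + a14 * a23) by rewrite
    /pf; ring.
have -> : x1 * pf = - (x1 * (- a01) + x2 * (- a02) + x3 * (- a03) + x4 * (- a04) + x5 * (-
    a05)) * (a23 * a45 - a24 * a35 + a25 * a34) + (x0 * a02 + x1 * a12 + x3 * (- a23) + x4 *
    (- a24) + x5 * (- a25)) * (a03 * a45 - a04 * a35 + a05 * a34) - (x0 * a03 + x1 * a13 + x2
    * a23 + x4 * (- a34) + x5 * (- a35)) * (a02 * a45 - a04 * a25 + a05 * a24) + (x0 * a04 +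
    x1 * a14 + x2 * a24 + x3 * a34 + x5 * (- a45)) * (a02 * a35 - a03 * a25 + a05 * a23) - (x0
    * a05 + x1 * a15 + x2 * a25 + x3 * a35 + x4 * a45) * (a02 * a34 - a03 * a24 + a04 * a23)
    by rewrite /pf; ring.
have -> : x2 * pf = (x1 * (- a01) + x2 * (- a02) + x3 * (- a03) + x4 * (- a04) + x5 * (- a05))
    * (a13 * a45 - a14 * a35 + a15 * a34) - (x0 * a01 + x2 * (- a12) + x3 * (- a13) + x4 * (-
    a14) + x5 * (- a15)) * (a03 * a45 - a04 * a35 + a05 * a34) + (x0 * a03 + x1 * a13 + x2 *
    a23 + x4 * (- a34) + x5 * (- a35)) * (a01 * a45 - a04 * a15 + a05 * a14) - (x0 * a04 + x1
    * a14 + x2 * a24 + x3 * a34 + x5 * (- a45)) * (a01 * a35 - a03 * a15 + a05 * a13) + (x0 *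
    a05 + x1 * a15 + x2 * a25 + x3 * a35 + x4 * a45) * (a01 * a34 - a03 * a14 + a04 * a13) by
    rewrite /pf; ring.
have -> : x3 * pf = - (x1 * (- a01) + x2 * (- a02) + x3 * (- a03) + x4 * (- a04) + x5 * (-
    a05)) * (a12 * a45 - a14 * a25 + a15 * a24) + (x0 * a01 + x2 * (- a12) + x3 * (- a13) + x4
    * (- a14) + x5 * (- a15)) * (a02 * a45 - a04 * a25 + a05 * a24) - (x0 * a02 + x1 * a12 +
    x3 * (- a23) + x4 * (- a24) + x5 * (- a25)) * (a01 * a45 - a04 * a15 + a05 * a14) + (x0 *
    a04 + x1 * a14 + x2 * a24 + x3 * a34 + x5 * (- a45)) * (a01 * a25 - a02 * a15 + a05 * a12)
    - (x0 * a05 + x1 * a15 + x2 * a25 + x3 * a35 + x4 * a45) * (a01 * a24 - a02 * a14 + a04 *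
    a12) by rewrite /pf; ring.
have -> : x4 * pf = (x1 * (- a01) + x2 * (- a02) + x3 * (- a03) + x4 * (- a04) + x5 * (- a05))
    * (a12 * a35 - a13 * a25 + a15 * a23) - (x0 * a01 + x2 * (- a12) + x3 * (- a13) + x4 * (-
    a14) + x5 * (- a15)) * (a02 * a35 - a03 * a25 + a05 * a23) + (x0 * a02 + x1 * a12 + x3 *
    (- a23) + x4 * (- a24) + x5 * (- a25)) * (a01 * a35 - a03 * a15 + a05 * a13) - (x0 * a03 +
    x1 * a13 + x2 * a23 + x4 * (- a34) + x5 * (- a35)) * (a01 * a25 - a02 * a15 + a05 * a12) +
    (x0 * a05 + x1 * a15 + x2 * a25 + x3 * a35 + x4 * a45) * (a01 * a23 - a02 * a13 + a03 *
    a12) by rewrite /pf; ring.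
have -> : x5 * pf = - (x1 * (- a01) + x2 * (- a02) + x3 * (- a03) + x4 * (- a04) + x5 * (-
    a05)) * (a12 * a34 - a13 * a24 + a14 * a23) + (x0 * a01 + x2 * (- a12) + x3 * (- a13) + x4
    * (- a14) + x5 * (- a15)) * (a02 * a34 - a03 * a24 + a04 * a23) - (x0 * a02 + x1 * a12 +
    x3 * (- a23) + x4 * (- a24) + x5 * (- a25)) * (a01 * a34 - a03 * a14 + a04 * a13) + (x0 *
    a03 + x1 * a13 + x2 * a23 + x4 * (- a34) + x5 * (- a35)) * (a01 * a24 - a02 * a14 + a04 *
    a12) - (x0 * a04 + x1 * a14 + x2 * a24 + x3 * a34 + x5 * (- a45)) * (a01 * a23 - a02 * a13
    + a03 * a12) by rewrite /pf; ring.
rewrite e0 e1 e2 e3 e4 e5 !(oppr0, mul0r, subr0, addr0).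
by do !split.
Qed.

Lemma sum_ord2 (f : 'I_2 -> F) : \sum_i f i = f 0 + f 1.
Proof. by rewrite !big_ord_recl big_ord0 addr0; congr (_ + f _); apply: val_inj. Qed.

Lemma mulmx2E m n (X : 'M[F]_(m, 2)) (Y : 'M_(2, n)) i j :
  (X *m Y) i j = X i 0 * Y 0 j + X i 1 * Y 1 j.
Proof. by rewrite mxE sum_ord2. Qed.

Lemma det2 (X : 'M[F]_2) : \det X = X 0 0 * X 1 1 - X 0 1 * X 1 0.
Proof.
rewrite (expand_det_row _ 0) sum_ord2 /cofactor !det_mx11 !mxE /=.
rewrite expr0 expr1 mul1r mulN1r mulrN; congr (_ * X _ _ - _ * X _ _); exact: val_inj.
Qed.

Lemma mx2P (X Y : 'M[F]_2) : X 0 0 = Y 0 0 -> X 0 1 = Y 0 1 -> X 1 0 = Y 1 0 ->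
  X 1 1 = Y 1 1 -> X = Y.
Proof.
have ord2 (i : 'I_2) : i = 0 \/ i = 1.
  by case: i => [[|[|i]] lt_i] //; [left | right]; apply: val_inj.
by move=> e00 e01 e10 e11; apply/matrixP=> i j; case: (ord2 i) => ->; case: (ord2 j) => ->.
Qed.

Lemma row2P (x y : 'rV[F]_2) : x 0 0 = y 0 0 -> x 0 1 = y 0 1 -> x = y.
Proof.
move=> e0 e1; apply/rowP; case=> [[|[|i]] lt_i] //.
  by rewrite (_ : Ordinal _ = 0) //; apply: val_inj.
by rewrite (_ : Ordinal _ = 1) //; apply: val_inj.
Qed.

Lemma skew_diag n (X : 'M[F]_n) i : X^T = - X -> X i i = 0.
Proof.
move=> /matrixP/(_ i i); rewrite !mxE => /eqP.
by rewrite -addr_eq0 -mulr2n mulrn_eq0 => /eqP.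
Qed.

Lemma skew2P (X : 'M[F]_2) : X^T = - X -> X 0 1 = 0 -> X = 0.
Proof.
move=> skX X01; have /matrixP/(_ 0 1) := skX; rewrite !mxE X01 oppr0 => X10.
by apply: mx2P; rewrite ?mxE // skew_diag.
Qed.

Lemma skew_gram m (K : 'M_(m, 6)) (T : 'M[F]_6) : T^T = - T ->
  (K *m T *m K^T)^T = - (K *m T *m K^T).
Proof. by move=> skT; rewrite !trmx_mul trmxK skT mulNmx mulmxN mulmxA. Qed.

Lemma gram_tr m n (K : 'M[F]_(m, 6)) (L : 'M_(n, 6)) T Z :
  T^T = - T -> K *m T *m L^T = Z -> L *m T *m K^T = - Z^T.
Proof.
move=> skT <-; apply: trmx_inj.
by rewrite raddfN /= trmxK !trmx_mul trmxK skT mulNmx mulmxN mulmxA.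
Qed.

(* Pfaffian of the matrix with blocks [[aJ, X, U], [-X^T, lJ, V], [-U^T, -V^T, cJ]]
   where J = [[0, 1], [-1, 0]]. *)
Definition pf6 (a l c : F) (X U V : 'M[F]_2) : F :=
  a * (l * c - V 0 0 * V 1 1 + V 0 1 * V 1 0)
  - X 0 0 * (X 1 1 * c - U 1 0 * V 1 1 + U 1 1 * V 1 0)
  + X 0 1 * (X 1 0 * c - U 1 0 * V 0 1 + U 1 1 * V 0 0)
  - U 0 0 * (X 1 0 * V 1 1 - X 1 1 * V 0 1 + U 1 1 * l)
  + U 0 1 * (X 1 0 * V 1 0 - X 1 1 * V 0 0 + U 1 0 * l).

(** The Gram matrix of a singular T has a nonzero left kernel vector, and by [pf6_kernel] the
    Pfaffian annihilates each of its entries. *)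
Lemma pf6_gram (T : 'M[F]_6) (K L C : 'M[F]_(2, 6)) : T^T = - T -> T \notin unitmx ->
  pf6 ((K *m T *m K^T) 0 1) ((L *m T *m L^T) 0 1) ((C *m T *m C^T) 0 1)
    (K *m T *m L^T) (K *m T *m C^T) (L *m T *m C^T) = 0.
Proof.
move=> skT T_sing.
pose g : 'M[F]_(2 + (2 + 2), 6) := col_mx K (col_mx L C).
have [x x_neq0 xG] : exists2 x : 'rV_(2 + (2 + 2)), x != 0 & x *m (g *m T *m g^T) = 0.
  apply/det0P/eqP; have -> : \det (g *m T *m g^T) = \det (g : 'M_6) * \det T * \det (g^T :
      'M_6).
    by rewrite -!det_mulmx.
  move: T_sing; rewrite unitmxE unitfE negbK => /eqP ->.
  by rewrite mulr0 mul0r.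
move: x_neq0 xG; rewrite -[x]hsubmxK -[rsubmx x]hsubmxK.
set p := lsubmx x; set q := lsubmx (rsubmx x); set r := rsubmx (rsubmx x).
move=> x_neq0; rewrite !mulmxA !mul_row_col !tr_col_mx !mul_mx_row -row_mx0 -(row_mx0 _ 1 2 2).
move=> /eq_row_mx[eK /eq_row_mx[eL eC]].
move: eK eL eC; rewrite !mulmxDl -!(mulmxA p) -!(mulmxA q) -!(mulmxA r).
set a := K *m T *m K^T; set l := L *m T *m L^T; set c := C *m T *m C^T.
set X := K *m T *m L^T; set U := K *m T *m C^T; set V := L *m T *m C^T.
have -> : L *m T *m K^T = - X^T by apply: gram_tr.
have -> : C *m T *m K^T = - U^T by apply: gram_tr.
have -> : C *m T *m L^T = - V^T by apply: gram_tr.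
have ska : a^T = - a by apply: skew_gram.
have skl : l^T = - l by apply: skew_gram.
have skc : c^T = - c by apply: skew_gram.
have eqs (s : 'M[F]_2) : s^T = - s -> [/\ s 0 0 = 0, s 1 1 = 0 & s 1 0 = - s 0 1].
  by move=> sks; rewrite !skew_diag //; split=> //; have /matrixP/(_ 0 1) := sks; rewrite !mxE.
have [a0 a1 a10] := eqs _ ska; have [l0 l1 l10] := eqs _ skl; have [c0 c1 c10] := eqs _ skc.
clearbody a l c X U V p q r => eK eL eC.
have E (v : 'rV[F]_2) : v = 0 -> v 0 0 = 0 /\ v 0 1 = 0 by move=> ->; rewrite !mxE.
have [] := E _ eK; have [] := E _ eL; have [] := E _ eC.
rewrite !mxE !sum_ord2 !mxE a0 a1 a10 l0 l1 l10 c0 c1 c10 => e4 e5 e2 e3 e0 e1.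
have [||||||k0 k1 k2 k3 [k4 k5]] := @pf6_kernel (p 0 0) (p 0 1) (q 0 0) (q 0 1) (r 0 0) (r 0 1)
  (a 0 1) (X 0 0) (X 0 1) (U 0 0) (U 0 1) (X 1 0) (X 1 1) (U 1 0) (U 1 1)
  (l 0 1) (V 0 0) (V 0 1) (V 1 0) (V 1 1) (c 0 1).
- by rewrite -[RHS]e0; ring.
- by rewrite -[RHS]e1; ring.
- by rewrite -[RHS]e2; ring.
- by rewrite -[RHS]e3; ring.
- by rewrite -[RHS]e4; ring.
- by rewrite -[RHS]e5; ring.
apply/eqP; apply: contraNT x_neq0 => pf_neq0.
have z y : y * pf6 (a 0 1) (l 0 1) (c 0 1) X U V = 0 -> y = 0.
  by move/eqP; rewrite mulf_eq0 (negbTE pf_neq0) orbF => /eqP.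
have -> : p = 0 by apply: row2P; rewrite mxE; apply: z; [exact: k0 | exact: k1].
have -> : q = 0 by apply: row2P; rewrite mxE; apply: z; [exact: k2 | exact: k3].
have -> : r = 0 by apply: row2P; rewrite mxE; apply: z; [exact: k4 | exact: k5].
by rewrite !row_mx0.
Qed.

(** The difference of the two sides is the Pfaffian of the 4 x 4 Gram matrix on the rows of K and L,
    which is singular since T has rank at most 2. *)
Lemma pf4_gram (T : 'M[F]_6) (K L : 'M[F]_(2, 6)) : T^T = - T -> (\rank T <= 2)%N ->
  (K *m T *m K^T) 0 1 * (L *m T *m L^T) 0 1 = \det (K *m T *m L^T)%R.
Proof.
move=> skT T_rk.
pose g : 'M[F]_(2 + 2, 6) := col_mx K L.
have [x x_neq0 xG] : exists2 x : 'rV_(2 + 2), x != 0 & x *m (g *m T *m g^T) = 0.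
  apply/det0P/eqP; have : (g *m T *m g^T) \notin unitmx.
    apply/negP=> /mxrank_unit rk4; have : (4 <= \rank T)%N.
      rewrite -[X in (X <= _)%N]rk4.
      by apply: (leq_trans (mxrankM_maxl _ _)); apply: mxrankM_maxr.
    by move=> h; have := leq_trans h T_rk.
  by rewrite unitmxE unitfE negbK => /eqP.
move: x_neq0 xG; rewrite -[x]hsubmxK.
set p := lsubmx x; set q := rsubmx x.
move=> x_neq0; rewrite !mulmxA !mul_row_col !tr_col_mx !mul_mx_row -row_mx0.
move=> /eq_row_mx[eK eL].
move: eK eL; rewrite !mulmxDl -!(mulmxA p) -!(mulmxA q).
set a := K *m T *m K^T; set l := L *m T *m L^T; set X := K *m T *m L^T.
have -> : L *m T *m K^T = - X^T by apply: gram_tr.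
have ska : a^T = - a by apply: skew_gram.
have skl : l^T = - l by apply: skew_gram.
have eqs (s : 'M[F]_2) : s^T = - s -> [/\ s 0 0 = 0, s 1 1 = 0 & s 1 0 = - s 0 1].
  by move=> sks; rewrite !skew_diag //; split=> //; have /matrixP/(_ 0 1) := sks; rewrite !mxE.
have [a0 a1 a10] := eqs _ ska; have [l0 l1 l10] := eqs _ skl.
clearbody a l X p q => eK eL.
have E (v : 'rV[F]_2) : v = 0 -> v 0 0 = 0 /\ v 0 1 = 0 by move=> ->; rewrite !mxE.
have [] := E _ eK; have [] := E _ eL.
rewrite !mxE !sum_ord2 !mxE a0 a1 a10 l0 l1 l10 => e2 e3 e0 e1.
have [||||k0 k1 k2 k3] := @pf4_kernel (p 0 0) (p 0 1) (q 0 0) (q 0 1)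
  (a 0 1) (X 0 0) (X 0 1) (X 1 0) (X 1 1) (l 0 1).
- by rewrite -[RHS]e0; ring.
- by rewrite -[RHS]e1; ring.
- by rewrite -[RHS]e2; ring.
- by rewrite -[RHS]e3; ring.
rewrite det2; apply/eqP; apply: contraNT x_neq0; rewrite -subr_eq0 => pf_neq0.
have pfE : a 0 1 * l 0 1 - X 0 0 * X 1 1 + X 0 1 * X 1 0 != 0.
  by apply: contraNneq pf_neq0 => pf0; rewrite -[X in _ == X]pf0; apply/eqP; ring.
have z y : y * (a 0 1 * l 0 1 - X 0 0 * X 1 1 + X 0 1 * X 1 0) = 0 -> y = 0.
  by move/eqP; rewrite mulf_eq0 (negbTE pfE) orbF => /eqP.
have -> : p = 0 by apply: row2P; rewrite mxE; apply: z; [exact: k0 | exact: k1].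
have -> : q = 0 by apply: row2P; rewrite mxE; apply: z; [exact: k2 | exact: k3].
by rewrite !row_mx0.
Qed.

End Pfaffian.

(** * Adapted coordinates *)

Section AdaptedFrames.
Variable F : numFieldType.
Implicit Types (T : 'M[F]_6) (K L C : 'M[F]_(2, 6)) (X U V : 'M[F]_2).

(* The rows of K, L and C are vectors of W, so K *m T *m L^T is the matrix of the
   values of the form T on K x L. *)
Record shape T K L C X U V : Prop := Shape {
  shapeKK : K *m T *m K^T = 0;
  shapeLL : L *m T *m L^T = 0;
  shapeCC : C *m T *m C^T = 0;
  shapeKL : K *m T *m L^T = X;
  shapeKC : K *m T *m C^T = U;
  shapeLC : L *m T *m C^T = V }.

Lemma gram_combl m (D : 'M[F]_(m, 6)) T C K L a b :
  (C + a *m K + b *m L) *m T *m D^T =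
  C *m T *m D^T + a *m (K *m T *m D^T) + b *m (L *m T *m D^T).
Proof. by rewrite !mulmxDl !mulmxA. Qed.

Lemma gram_combr m (D : 'M[F]_(m, 6)) T C K L a b :
  D *m T *m (C + a *m K + b *m L)^T =
  D *m T *m C^T + (D *m T *m K^T) *m a^T + (D *m T *m L^T) *m b^T.
Proof. by rewrite !raddfD /= !trmx_mul !mulmxA. Qed.

Variable A : {vspace 'M[F]_6}.
Hypothesis skA : forall M, M \in A -> M^T = - M.
Hypothesis rkA : forall M, M \in A -> (\rank M <= 4)%N.
Hypothesis kerA : forall u : 'rV_6, (forall M, M \in A -> u *m M = 0) -> u = 0.
Hypothesis isoA : forall L : 'M_(3, 6),
  row_free L -> ~ (forall M, M \in A -> L *m M *m L^T = 0).

(** K and L start as bases of two disjoint kernels ker M and ker N, and C completes them to a basis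
    of W. As ker N is isotropic for M and M kills only ker M, M pairs L perfectly with C; likewise N
    pairs K perfectly with C. A base change of L and of K gives the identity blocks. *)
Lemma exists_pair_frame : exists K L C M N,
  [/\ M \in A, N \in A, shape M K L C 0 0 1%:M & shape N K L C 0 1%:M 0].
Proof.
have [M [N [MA NA rM rN MN0]]] := exists_disjoint_kernels skA rkA kerA isoA.
have max4 (T : 'M[F]_6) : \rank T = 4%N -> forall S, S \in A -> (\rank S <= \rank T)%N.
  by move=> ->; apply: rkA.
have [K [K_free KM _]] := rank4_kernel MA rM.
have [L [L_free LN _]] := rank4_kernel NA rN.
have LML : L *m M *m L^T = 0 by apply: (kernel_isotropic skA NA MA) => //; apply: max4.
have KNK : K *m N *m K^T = 0 by apply: (kernel_isotropic skA MA NA) => //; apply: max4.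
have MK := skew_kerT skA MA KM.
have NL := skew_kerT skA NA LN.
have KL_free : @row_free F 4 (4 + 2) (col_mx K L : 'M_(2 + 2, _)).
  apply: (@inj_row_free F (2 + 2) 6) => w; rewrite -[w]hsubmxK mul_row_col => eq0.
  have lw0 : lsubmx w *m K = 0.
    apply: MN0; first by rewrite -mulmxA KM mulmx0.
    have /eqP : lsubmx w *m K + rsubmx w *m L = 0 by [].
    rewrite addr_eq0 => /eqP ->.
    by rewrite mulNmx -mulmxA LN mulmx0 oppr0.
  have rw0 : rsubmx w *m L = 0 by rewrite lw0 add0r in eq0.
  have /eqP -> : lsubmx w == 0 by rewrite -(mulmx_free_eq0 _ K_free) lw0.
  have /eqP -> : rsubmx w == 0 by rewrite -(mulmx_free_eq0 _ L_free) rw0.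
  by rewrite row_mx0.
have [C gU] := complement_rows KL_free.
have full0 (y : 'rV_6) : y *m K^T = 0 -> y *m L^T = 0 -> y *m C^T = 0 -> y = 0.
  move=> yK yL yC; apply: (can_inj (mulmxK (_ : (col_mx (col_mx K L) C)^T \in unitmx))).
    by rewrite unitmx_tr.
  rewrite mul0mx !tr_col_mx.
  have -> : @mulmx _ 1 6 (4 + 2) y (row_mx (row_mx K^T L^T) C^T) = 0; last by [].
  rewrite mul_mx_row yC.
  have -> : @mulmx _ 1 6 (2 + 2) y (row_mx K^T L^T) = 0 by rewrite mul_mx_row yK yL row_mx0.
  by rewrite row_mx0.
have aU : L *m M *m C^T \in unitmx.
  rewrite -row_free_unit; apply: inj_row_free => w.
  rewrite !mulmxA => wa; apply/eqP; rewrite -(mulmx_free_eq0 _ L_free); apply/eqP.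
  apply: MN0; last by rewrite -mulmxA LN mulmx0.
  apply: full0 => //; first by rewrite -mulmxA MK mulmx0.
  by rewrite -!mulmxA (mulmxA L) LML mulmx0.
have bU : K *m N *m C^T \in unitmx.
  rewrite -row_free_unit; apply: inj_row_free => w.
  rewrite !mulmxA => wa; apply/eqP; rewrite -(mulmx_free_eq0 _ K_free); apply/eqP.
  apply: MN0; first by rewrite -mulmxA KM mulmx0.
  apply: full0 => //; last by rewrite -mulmxA NL mulmx0.
  by rewrite -!mulmxA (mulmxA K) KNK mulmx0.
pose L1 := invmx (L *m M *m C^T) *m L; pose K1 := invmx (K *m N *m C^T) *m K.
have L1N : L1 *m N = 0 by rewrite -mulmxA LN mulmx0.
have K1M : K1 *m M = 0 by rewrite -mulmxA KM mulmx0.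
have NL1 := skew_kerT skA NA L1N.
have MK1 := skew_kerT skA MA K1M.
have L1MC : L1 *m M *m C^T = 1%:M by rewrite -!mulmxA mulVmx // !mulmxA.
have K1NC : K1 *m N *m C^T = 1%:M by rewrite -!mulmxA mulVmx // !mulmxA.
have L1ML1 : L1 *m M *m L1^T = 0.
  by rewrite /L1 trmx_mul !mulmxA -2!(mulmxA (invmx _)) LML mulmx0 mul0mx.
have K1NK1 : K1 *m N *m K1^T = 0.
  by rewrite /K1 trmx_mul !mulmxA -2!(mulmxA (invmx _)) KNK mulmx0 mul0mx.
have CML1 := gram_tr (skA MA) L1MC; have CNK1 := gram_tr (skA NA) K1NC.
have half_skew (m : 'M[F]_2) : m^T = - m -> m + (- 2^-1 *: m) - (- 2^-1 *: m)^T = 0.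
  move=> /matrixP mT; apply/matrixP=> i j; have := mT i j; rewrite !mxE => ->.
  by field.
(* The shift of C acts on both arguments of a form, and each contributes minus one half of the skew
   matrix to be cancelled. *)
pose be := - 2^-1 *: (C *m M *m C^T); pose al := - 2^-1 *: (C *m N *m C^T).
pose C1 := C + al *m K1 + be *m L1.
have skC (T : 'M[F]_6) : T \in A -> (C *m T *m C^T)^T = - (C *m T *m C^T).
  by move=> TA; rewrite !trmx_mul trmxK skA // mulNmx mulmxN mulmxA.
have K1ML1 : K1 *m M *m L1^T = 0 by rewrite K1M mul0mx.
have K1MC : K1 *m M *m C^T = 0 by rewrite K1M mul0mx.
have K1MK1 : K1 *m M *m K1^T = 0 by rewrite K1M mul0mx.
have L1NL1 : L1 *m N *m L1^T = 0 by rewrite L1N mul0mx.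
have L1NC : L1 *m N *m C^T = 0 by rewrite L1N mul0mx.
have L1NK1 : L1 *m N *m K1^T = 0 by rewrite L1N mul0mx.
have CMK1 := gram_tr (skA MA) K1MC; have CNL1 := gram_tr (skA NA) L1NC.
have L1MK1 := gram_tr (skA MA) K1ML1; have K1NL1 := gram_tr (skA NA) L1NK1.
exists K1, L1, C1, M, N; split=> //; split=> //.
- rewrite gram_combl !gram_combr K1MK1 K1ML1 K1MC L1MK1 L1ML1 L1MC CMK1 CML1.
  rewrite !(trmx0, trmx1, oppr0, mulmx0, mul0mx, add0r, addr0, mulmx1, mulNmx, mul1mx).
  by rewrite addrAC half_skew // skC.
- by rewrite gram_combr K1MK1 K1ML1 K1MC !(mul0mx, addr0).
- by rewrite gram_combr L1MK1 L1ML1 L1MC !(trmx0, oppr0, mul0mx, addr0).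
- rewrite gram_combl !gram_combr L1NL1 L1NK1 L1NC K1NL1 K1NK1 K1NC CNL1 CNK1.
  rewrite !(trmx0, trmx1, oppr0, mulmx0, mul0mx, add0r, addr0, mulmx1, mulNmx, mul1mx).
  by rewrite addrAC half_skew // skC.
- by rewrite K1NL1 trmx0 oppr0.
- by rewrite gram_combr K1NK1 K1NL1 K1NC !(trmx0, oppr0, mul0mx, addr0).
- by rewrite gram_combr L1NL1 L1NK1 L1NC !(mul0mx, addr0).
Qed.

End AdaptedFrames.

(** * Pfaffian constraints on the blocks of a form *)

Section PairFrames.
Variables (F : numClosedFieldType) (A : {vspace 'M[F]_6}).
Hypothesis skA : forall M, M \in A -> M^T = - M.
Hypothesis rkA : forall M, M \in A -> (\rank M <= 4)%N.
Implicit Types (T M N : 'M[F]_6) (K L C : 'M[F]_(2, 6)) (X U V : 'M[F]_2).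

Lemma pf6_eq0 T K L C : T \in A ->
  pf6 ((K *m T *m K^T) 0 1) ((L *m T *m L^T) 0 1) ((C *m T *m C^T) 0 1)
    (K *m T *m L^T) (K *m T *m C^T) (L *m T *m C^T) = 0.
Proof.
move=> TA; apply: pf6_gram; first exact: skA.
by apply/negP=> /mxrank_unit T6; have := rkA TA; rewrite T6.
Qed.

Lemma gram_lin m n (K : 'M[F]_(m, 6)) (L : 'M_(n, 6)) T M N (x y : F) :
  K *m (T + x *: M + y *: N) *m L^T =
  K *m T *m L^T + x *: (K *m M *m L^T) + y *: (K *m N *m L^T).
Proof. by rewrite !mulmxDr !mulmxDl -!scalemxAr -!scalemxAl. Qed.

Lemma quadratic_eq0 (a b c d e f : F) :
    (forall x y, a * x ^+ 2 + b * x * y + c * y ^+ 2 + d * x + e * y + f = 0) ->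
  [/\ a = 0, b = 0, c = 0, d = 0 & e = 0].
Proof.
move=> q.
have even (u v : F) : u + v + f = 0 -> u - v + f = 0 -> f = 0 -> u = 0 /\ v = 0.
  move=> q1 q2 f0; move: q1 q2; rewrite f0 !addr0 => /eqP; rewrite addr_eq0 => /eqP ->.
  rewrite -opprD -mulr2n => /eqP; rewrite oppr_eq0 mulrn_eq0 => /eqP ->.
  by rewrite oppr0.
have f0 : f = 0 by rewrite -(q 0 0); ring.
have [||//|a0 d0] := even a d; [by rewrite -(q 1 0); ring | by rewrite -(q (-1) 0); ring |].
have [||//|c0 e0] := even c e; [by rewrite -(q 0 1); ring | by rewrite -(q 0 (-1)); ring |].
by split=> //; rewrite -(q 1 1) a0 c0 d0 e0 f0; ring.
Qed.

(* Read off from the coefficients of the Pfaffian of T + x M + y N in x and y. *)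
Lemma pair_frame_blocks K L C M N T :
    M \in A -> N \in A -> shape M K L C 0 0 1%:M -> shape N K L C 0 1%:M 0 -> T \in A ->
  let X := K *m T *m L^T in let U := K *m T *m C^T in let V := L *m T *m C^T in
  [/\ K *m T *m K^T = 0, L *m T *m L^T = 0, X 1 0 = X 0 1,
      X 1 1 * U 0 1 - X 0 1 * U 1 1 + X 0 1 * U 0 0 - X 0 0 * U 1 0 = 0 &
      X 1 1 * V 0 1 - X 0 1 * V 1 1 + X 0 1 * V 0 0 - X 0 0 * V 1 0 = 0].
Proof.
move=> MA NA [MKK MLL MCC MKL MKC MLC] [NKK NLL NCC NKL NKC NLC] TA X U V.
have skKK : (K *m T *m K^T)^T = - (K *m T *m K^T) by apply: skew_gram; apply: skA.
have skLL : (L *m T *m L^T)^T = - (L *m T *m L^T) by apply: skew_gram; apply: skA.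
have f x y : pf6 ((K *m T *m K^T) 0 1) ((L *m T *m L^T) 0 1) ((C *m T *m C^T) 0 1)
    X (U + y%:M) (V + x%:M) = 0.
  have /pf6_eq0-/(_ K L C) : T + x *: M + y *: N \in A by rewrite !memvD // memvZ.
  rewrite !gram_lin MKK MLL MCC MKL MKC MLC NKK NLL NCC NKL NKC NLC.
  by rewrite !scaler0 !addr0 !scalemx1.
have one0 x : (x%:M : 'M[F]_2) 0 0 = x by rewrite mxE mulr1n.
have one1 x : (x%:M : 'M[F]_2) 1 1 = x by rewrite mxE mulr1n.
have one01 x : (x%:M : 'M[F]_2) 0 1 = 0 by rewrite mxE mulr0n.
have one10 x : (x%:M : 'M[F]_2) 1 0 = 0 by rewrite mxE mulr0n.
move: f skKK skLL; rewrite /pf6.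
move: (K *m T *m K^T) (L *m T *m L^T) ((C *m T *m C^T) 0 1) => a l c f skK skL.
have addE (Z Z' : 'M[F]_2) i j : (Z + Z') i j = Z i j + Z' i j by rewrite mxE.
have [] := @quadratic_eq0 (- a 0 1) (X 0 1 - X 1 0) (- l 0 1)
  (X 0 0 * U 1 0 + X 0 1 * U 1 1 - X 1 0 * U 0 0 - X 1 1 * U 0 1 - a 0 1 * (V 0 0 + V 1 1))
  (X 1 1 * V 0 1 + X 0 1 * V 0 0 - X 1 0 * V 1 1 - X 0 0 * V 1 0 - l 0 1 * (U 0 0 + U 1 1))
  (pf6 (a 0 1) (l 0 1) c X U V).
  move=> x y; rewrite -[RHS](f x y) /pf6 !addE !one0 !one1 !one01 !one10 !addr0.
  by clear; ring.
move=> /eqP + /eqP + /eqP; rewrite !oppr_eq0 subr_eq0 => /eqP a0 /eqP X01 /eqP l0.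
(* With the diagonal blocks zero and X symmetric, the coefficients of x and y say that adj(X) U and
   adj(X) V are symmetric. *)
rewrite a0 l0 X01 => d0 e0.
split; [exact: skew2P | exact: skew2P | by [] | |].
- by apply/eqP; rewrite -oppr_eq0 -[X in _ == X]d0; apply/eqP; ring.
- by rewrite -[RHS]e0; ring.
Qed.

End PairFrames.

(** * From an invertible block to a frame *)

Section Frames.
Variables (F : numClosedFieldType).
Implicit Types (T M N : 'M[F]_6) (K L C : 'M[F]_(2, 6)) (X U V : 'M[F]_2).

(* A contains (/\^2 F^3) (x) I, for the decomposition W = F^3 (x) F^2 in which the
   rows of K, L and C are the bases of the three copies of F^2. *)
Definition frame (A : {vspace 'M[F]_6}) K L C : Prop :=
  [/\ exists2 M, M \in A & shape M K L C 1%:M 0 0,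
      exists2 M, M \in A & shape M K L C 0 1%:M 0 &
      exists2 M, M \in A & shape M K L C 0 0 1%:M].

Lemma shape_mul (a b c : 'M_2) T K L C X U V : shape T K L C X U V ->
  shape T (a *m K) (b *m L) (c *m C) (a *m X *m b^T) (a *m U *m c^T) (b *m V *m c^T).
Proof.
have E (x y : 'M[F]_2) (P Q : 'M[F]_(2, 6)) Z : P *m T *m Q^T = Z ->
    x *m P *m T *m (y *m Q)^T = x *m Z *m y^T by move=> <-; rewrite trmx_mul !mulmxA.
case=> KK LL CC KL KC LC.
by split; rewrite ?(E _ _ _ _ _ KK) ?(E _ _ _ _ _ LL) ?(E _ _ _ _ _ CC)
  ?(E _ _ _ _ _ KL) ?(E _ _ _ _ _ KC) ?(E _ _ _ _ _ LC) ?mulmx0 ?mul0mx.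
Qed.

Lemma sym2_factor X : X 1 0 = X 0 1 -> \det X != 0 ->
  exists2 h : 'M_2, h \in unitmx & X = h *m h^T.
Proof.
move=> Xsym detX.
suff [h Xh] : exists h : 'M_2, X = h *m h^T.
  exists h => //; rewrite unitmxE unitfE; apply: contraNneq detX => h0.
  by rewrite Xh det_mulmx h0 mul0r.
have mk (a b c d : F) : a * a + b * b = X 0 0 -> a * c + b * d = X 0 1 ->
    c * c + d * d = X 1 1 -> exists h : 'M_2, X = h *m h^T.
  move=> e00 e01 e11.
  pose h : 'M[F]_2 := \matrix_(i, j) if i == 0 then if j == 0 then a else b
                                    else if j == 0 then c else d.
  exists h; apply: mx2P; rewrite mulmx2E !mxE //=.
  by rewrite Xsym -e01 [c * a]mulrC [d * b]mulrC.
rewrite det2 Xsym in detX.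
have [X00|X00] := eqVneq (X 0 0) 0.
  have X01 : X 0 1 != 0.
    by apply: contraNneq detX => X01; rewrite X00 X01 !mul0r subr0.
  have i2 : 'i * 'i = -1 :> F by rewrite -expr2 sqrCi.
  pose y := X 0 1; pose r := X 1 1.
  (* The first row (1, i) is isotropic, as X 0 0 = 0 requires. The second row (c, d) solves c + i d
     = y and c - i d = r / y, so c^2 + d^2 = r. *)
  apply: (mk 1 'i ((y + r / y) / 2%:R) (- 'i * ((y - r / y) / 2%:R))).
  - by rewrite mulr1 i2 subrr X00.
  - transitivity ((y + r / y) / 2%:R - ('i * 'i) * ((y - r / y) / 2%:R)); first by ring.
    by rewrite i2 /y /r; field.
  - transitivity (((y + r / y) / 2%:R) ^+ 2 + ('i * 'i) * ((y - r / y) / 2%:R) ^+ 2).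
      by ring.
    by rewrite i2 /y /r; field.
pose s := sqrtC (X 0 0); have s2 : s * s = X 0 0 by rewrite -expr2 sqrtCK.
have s_neq0 : s != 0 by rewrite sqrtC_eq0.
pose w := sqrtC (X 1 1 - (X 0 1 / s) ^+ 2).
have w2 : w * w = X 1 1 - (X 0 1 / s) ^+ 2 by rewrite -expr2 sqrtCK.
apply: (mk s 0 (X 0 1 / s) w); rewrite ?mul0r ?addr0 //.
  by rewrite mulrC divfK.
by rewrite w2 -expr2 addrC subrK.
Qed.

Variable A : {vspace 'M[F]_6}.
Hypothesis skA : forall M, M \in A -> M^T = - M.
Hypothesis rkA : forall M, M \in A -> (\rank M <= 4)%N.

(** P supplies the third form of the frame. Its block is normalized by a base change common to K and
    L; C undergoes the contragredient change, which preserves the identity blocks of M and N. *)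
Lemma exists_frame_of_det K L C M N P :
    M \in A -> N \in A -> P \in A ->
    shape M K L C 0 0 1%:M -> shape N K L C 0 1%:M 0 ->
    \det (K *m P *m L^T) != 0 ->
  exists K L C, frame A K L C.
Proof.
move=> MA NA PA shM shN detX.
have [_ _ Xsym _ _] := pair_frame_blocks skA rkA MA NA shM shN PA.
have [h hU Xh] := sym2_factor Xsym detX.
pose K1 := invmx h *m K; pose L1 := invmx h *m L; pose C1 := h^T *m C.
have {}shM : shape M K1 L1 C1 0 0 1%:M.
  have := shape_mul (invmx h) (invmx h) h^T shM.
  by rewrite !(mulmx0, mul0mx) mulmx1 trmxK mulVmx.
have {}shN : shape N K1 L1 C1 0 1%:M 0.
  have := shape_mul (invmx h) (invmx h) h^T shN.
  by rewrite !(mulmx0, mul0mx) mulmx1 trmxK mulVmx.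
have K1PL1 : K1 *m P *m L1^T = 1%:M.
  rewrite /K1 /L1 trmx_mul !mulmxA -2!(mulmxA (invmx h)) Xh mulKmx //.
  by rewrite -trmx_mul mulVmx // trmx1.
pose U := K1 *m P *m C1^T; pose V := L1 *m P *m C1^T.
have [KPK LPL _] := pair_frame_blocks skA rkA MA NA shM shN PA.
(* For X = 1 the symmetry of adj(X) Z is the symmetry of Z. *)
have symP (Z I : 'M[F]_2) : I = 1%:M ->
    I 1 1 * Z 0 1 - I 0 1 * Z 1 1 + I 0 1 * Z 0 0 - I 0 0 * Z 1 0 = 0 -> Z^T = Z.
  move=> -> e; have Zsym : Z 0 1 = Z 1 0.
    by apply/eqP; rewrite -subr_eq0 -[X in _ == X]e !mxE /=; apply/eqP; ring.
  by apply: mx2P; rewrite mxE.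
move=> /(symP _ _ K1PL1) UT /(symP _ _ K1PL1) VT.
have skM := skA MA; have skN := skA NA; have skP := skA PA.
case: shM => MKK MLL MCC MKL MKC MLC; case: shN => NKK NLL NCC NKL NKC NLC.
have MLK := gram_tr skM MKL; have MCK := gram_tr skM MKC; have MCL := gram_tr skM MLC.
have NLK := gram_tr skN NKL; have NCK := gram_tr skN NKC; have NCL := gram_tr skN NLC.
have PLK := gram_tr skP K1PL1.
(* This shift clears the blocks of P involving C, and the symmetry of U and V keeps C isotropic for
   M and N. The remaining CC block of P is then, up to sign, its Pfaffian. *)
pose C2 := C1 + V *m K1 + (- U) *m L1.
pose simp := (trmx0, trmx1, oppr0, mulmx0, mul0mx, add0r, addr0, mulmx1, mul1mx,
  mulNmx, mulmxN, opprK).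
have PKC : K1 *m P *m C2^T = 0.
  by rewrite gram_combr KPK K1PL1 -/U raddfN /= UT !simp subrr.
have PLC : L1 *m P *m C2^T = 0.
  by rewrite gram_combr LPL PLK -/V VT !simp subrr.
exists K1, L1, C2; split.
- exists P => //; split=> //; apply: skew2P; first exact: skew_gram.
  have := pf6_eq0 skA rkA K1 L1 C2 PA; rewrite KPK LPL K1PL1 PKC PLC /pf6.
  move: (C2 *m P *m C2^T) => c; rewrite !mxE /=.
  rewrite !(mulr1n, mulr0n, mul0r, mulr0, mul1r, add0r, addr0, subr0, sub0r).
  by move=> /eqP; rewrite oppr_eq0 => /eqP.
- exists N => //; split=> //.
  + rewrite gram_combl !gram_combr NKK NLL NCC NKL NKC NLC NLK NCK NCL !raddfN /= VT UT.
    by rewrite !simp addrC subrr.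
  + by rewrite gram_combr NKK NKL NKC !simp.
  + by rewrite gram_combr NLL NLK NLC !simp.
- exists M => //; split=> //.
  + rewrite gram_combl !gram_combr MKK MLL MCC MKL MKC MLC MLK MCK MCL !raddfN /= VT UT.
    by rewrite !simp subrr.
  + by rewrite gram_combr MKK MKL MKC !simp.
  + by rewrite gram_combr MLL MLK MLC !simp.
Qed.

End Frames.

Section ExistsFrame.
Variables (F : numClosedFieldType) (A : {vspace 'M[F]_6}).
Hypothesis skA : forall M, M \in A -> M^T = - M.
Hypothesis rkA : forall M, M \in A -> (\rank M <= 4)%N.
Hypothesis kerA : forall u : 'rV_6, (forall M, M \in A -> u *m M = 0) -> u = 0.
Hypothesis isoA : forall L : 'M_(3, 6),
  row_free L -> ~ (forall M, M \in A -> L *m M *m L^T = 0).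
Implicit Types (T M N : 'M[F]_6) (K L C : 'M[F]_(2, 6)) (X U V : 'M[F]_2).

Lemma pair_frame_free K L C M N (p q r : 'rV_2) :
    M \in A -> N \in A -> shape M K L C 0 0 1%:M -> shape N K L C 0 1%:M 0 ->
  p *m K + q *m L + r *m C = 0 -> [/\ p = 0, q = 0 & r = 0].
Proof.
move=> MA NA [MKK MLL MCC MKL MKC MLC] [NKK NLL NCC NKL NKC NLC] eq0.
have NCK := gram_tr (skA NA) NKC; have NLK := gram_tr (skA NA) NKL.
have E T (D : 'M[F]_(2, 6)) : p *m (K *m T *m D^T) + q *m (L *m T *m D^T) +
    r *m (C *m T *m D^T) = 0.
  by rewrite !mulmxA -!mulmxDl eq0 !mul0mx.
have := E N C; rewrite NKC NLC NCC !mulmx0 !addr0 mulmx1 => p0.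
have := E M C; rewrite MKC MLC MCC !mulmx0 add0r addr0 mulmx1 => q0.
have := E N K; rewrite NKK NLK NCK trmx0 trmx1 oppr0 !mulmx0 !add0r mulmxN mulmx1 => /eqP.
by rewrite oppr_eq0 => /eqP r0.
Qed.

(** With w = (t, -s) the last hypothesis reads w X w^T = 0. A singular symmetric X is a multiple of
    the square of a linear form, so w X = 0, which is the conclusion. *)
Lemma det0_all_isotropic X (s t : F) : X 1 0 = X 0 1 -> \det X = 0 ->
    s ^+ 2 * X 1 1 + t ^+ 2 * X 0 0 - 2%:R * s * t * X 0 1 = 0 ->
  t * X 0 0 = s * X 0 1 /\ t * X 0 1 = s * X 1 1.
Proof.
move=> Xsym; rewrite det2 Xsym => detX polar.
pose al := t * X 0 0 - s * X 0 1; pose be := t * X 0 1 - s * X 1 1.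
have e1 : t * al = s * be.
  by apply/eqP; rewrite -subr_eq0 -[X in _ == X]polar; apply/eqP; rewrite /al /be; ring.
have e2 : al * X 1 1 = be * X 0 1.
  by apply/eqP; rewrite -subr_eq0 -[X in _ == X](mulr0 t) -detX; apply/eqP; rewrite /al /be; ring.
have e3 : al * X 0 1 = be * X 0 0.
  apply/eqP; rewrite -subr_eq0 -[X in _ == X](mulr0 s) -detX; apply/eqP; rewrite /al /be; ring.
have al0 : al ^+ 2 = 0.
  transitivity (X 0 0 * (t * al) - s * (al * X 0 1)); first by rewrite /al; ring.
  by rewrite e1 e3; ring.
have be0 : be ^+ 2 = 0.
  transitivity (t * (be * X 0 1) - s * be * X 1 1); first by rewrite /be; ring.
  by rewrite -e2 -e1; ring.
move/eqP: al0; move/eqP: be0; rewrite !expf_eq0 /= !subr_eq0.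
by move=> /eqP -> /eqP ->.
Qed.

(** If all blocks X are singular, they form a linear space of symmetric matrices of rank at most 1,
    so all are multiples of v^T v for one v = (s, t). With w = (t, -s), the vectors w K, w L and v C
    span an isotropic 3-space. *)
Lemma exists_frame : exists K L C, frame A K L C.
Proof.
have [K [L [C [M [N [MA NA shM shN]]]]]] := exists_pair_frame skA rkA kerA isoA.
have blocks T (TA : T \in A) := pair_frame_blocks skA rkA MA NA shM shN TA.
have free := @pair_frame_free K L C M N _ _ _ MA NA shM shN.
have [[P PA detP]|det0] := pselect (exists2 P, P \in A & \det (K *m P *m L^T) != 0).
  exact: (exists_frame_of_det skA rkA MA NA PA shM shN detP).
exfalso.
have {}det0 T : T \in A -> \det (K *m T *m L^T) = 0.
  by move=> TA; apply/eqP/negPn/negP => detT; apply: det0; exists T.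
have gramE (x y : 'rV[F]_2) (D E : 'M[F]_(2, 6)) T :
    (x *m D) *m T *m (y *m E)^T = x *m (D *m T *m E^T) *m y^T.
  by rewrite trmx_mul !mulmxA.
have scalar0 (z : 'M[F]_1) : z 0 0 = 0 -> z = 0.
  by move=> z0; apply/matrixP=> i j; rewrite !ord1 z0 mxE.
have [[T0 T0A X0_neq0]|X0] := pselect (exists2 T, T \in A & K *m T *m L^T != 0); last first.
  (* Here all X vanish, and K together with one row of L is isotropic. *)
  pose e i : 'rV[F]_2 := delta_mx 0 i.
  apply: (isotropic_triple skA isoA (x := e 0 *m K) (y := e 1 *m K) (z := e 0 *m L)).
    move=> a b c; rewrite !scalemxAl -mulmxDl => eq0.
    have [|ab c0 _] := free (a *: e 0 + b *: e 1) (c *: e 0) 0.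
      by rewrite mul0mx addr0.
    move: ab c0 => /rowP ab /rowP/(_ 0); have := ab 0; have := ab 1.
    by rewrite !mxE /= !(mulr1, mulr0, addr0, add0r) => -> -> ->.
  move=> T TA; have [KK _ _ _ _] := blocks T TA.
  have X00 : K *m T *m L^T = 0.
    by apply/eqP/negPn/negP => X_neq0; apply: X0; exists T.
  by rewrite !gramE KK X00 !(mulmx0, mul0mx).
pose X0 := K *m T0 *m L^T.
have [_ _ X0sym _ _] := blocks _ T0A; rewrite -/X0 in X0sym X0_neq0.
have detX0 := det0 _ T0A; rewrite -/X0 det2 X0sym in detX0.
have [s [t [st_neq0 s2 st t2]]] : exists s t : F, [/\ (s != 0) || (t != 0), X0 0 0 = s ^+ 2,
    X0 0 1 = s * t & X0 1 1 = t ^+ 2].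
  have [X00|X00] := eqVneq (X0 0 0) 0.
    have X01 : X0 0 1 = 0.
      move: detX0; rewrite X00 mul0r sub0r => /eqP.
      by rewrite oppr_eq0 mulf_eq0 orbb => /eqP.
    exists 0, (sqrtC (X0 1 1)); rewrite eqxx /= mul0r expr0n sqrtCK; split=> //.
    rewrite sqrtC_eq0; apply: contraNneq X0_neq0 => X11.
    by apply/eqP; apply: mx2P; rewrite ?X0sym ?X00 ?X01 ?X11 mxE.
  have s_neq0 : sqrtC (X0 0 0) != 0 by rewrite sqrtC_eq0.
  exists (sqrtC (X0 0 0)), (X0 0 1 / sqrtC (X0 0 0)); rewrite s_neq0 sqrtCK; split=> //.
    by rewrite mulrC divfK.
  rewrite expr_div_n sqrtCK; apply: (mulfI X00); rewrite [RHS]mulrCA divff // mulr1.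
  by apply/eqP; rewrite -subr_eq0 -detX0; apply/eqP; ring.
have perp T (TA : T \in A) : t * (K *m T *m L^T) 0 0 = s * (K *m T *m L^T) 0 1 /\
    t * (K *m T *m L^T) 0 1 = s * (K *m T *m L^T) 1 1.
  have [_ _ Xsym _ _] := blocks _ TA.
  apply: det0_all_isotropic => //; first exact: det0.
  have /det0 : T0 + T \in A by rewrite memvD.
  have := det0 _ TA; rewrite mulmxDr mulmxDl -/X0 !det2 ![(_ + _ : 'M_2) _ _]mxE X0sym Xsym.
  rewrite s2 st t2; move: (K *m T *m L^T) => X d1 d2.
  have -> : s ^+ 2 * X 1 1 + t ^+ 2 * X 0 0 - 2%:R * s * t * X 0 1 =
    ((s ^+ 2 + X 0 0) * (t ^+ 2 + X 1 1) - (s * t + X 0 1) * (s * t + X 0 1)) -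
    (X 0 0 * X 1 1 - X 0 1 * X 0 1) by ring.
  by rewrite d1 d2 subrr.
(* [q Z] is w Z v^T. For X = c v^T v one has adj(X) = c w^T w, so if c != 0 the symmetry of adj(X) Z
   makes w Z a multiple of w, which is orthogonal to v. *)
pose q (Z : 'M[F]_2) := t * s * Z 0 0 + t ^+ 2 * Z 0 1 - s ^+ 2 * Z 1 0 - s * t * Z 1 1.
have q0_of (X Z : 'M[F]_2) : X 1 0 = X 0 1 -> t * X 0 0 = s * X 0 1 -> t * X 0 1 = s * X 1 1 ->
    \det X = 0 -> X != 0 ->
    X 1 1 * Z 0 1 - X 0 1 * Z 1 1 + X 0 1 * Z 0 0 - X 0 0 * Z 1 0 = 0 -> q Z = 0.
  move=> Xsym p1 p2 dX X_neq0 adj; apply/eqP; apply: contraNT X_neq0 => q_neq0.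
  have h (x y : F) : x * q Z = y * 0 -> x = 0.
    by move/eqP; rewrite mulr0 mulf_eq0 (negbTE q_neq0) orbF => /eqP.
  have X00 : X 0 0 = 0.
    apply: (h _ (s ^+ 2)); rewrite -adj /q.
    transitivity (s * (t * X 0 0) * Z 0 0 + t * (t * X 0 0) * Z 0 1 - s ^+ 2 * X 0 0 * Z 1 0
      - s * (t * X 0 0) * Z 1 1); first by ring.
    rewrite p1 (_ : t * (s * X 0 1) = s * (t * X 0 1)); last by ring.
    by rewrite p2; ring.
  have X11 : X 1 1 = 0.
    apply: (h _ (t ^+ 2)); rewrite -adj /q.
    transitivity (t * (s * X 1 1) * Z 0 0 + t ^+ 2 * X 1 1 * Z 0 1 - s * (s * X 1 1) * Z 1 0
      - t * (s * X 1 1) * Z 1 1); first by ring.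
    rewrite -p2 (_ : s * (t * X 0 1) = t * (s * X 0 1)); last by ring.
    by rewrite -p1; ring.
  have X01 : X 0 1 = 0.
    move: dX; rewrite det2 X00 Xsym mul0r sub0r => /eqP.
    by rewrite oppr_eq0 mulf_eq0 orbb => /eqP.
  by apply/eqP; apply: mx2P; rewrite ?Xsym ?X00 ?X01 ?X11 mxE.
have qD (Z Z' : 'M[F]_2) : q (Z + Z') = q Z + q Z' by rewrite /q !mxE; ring.
(* The symmetry of adj(X) Z is void when X = 0; such a T is written as (T0 + T) - T0, and [q] is
   additive. *)
have q0 T (D : 'M[F]_(2, 6)) : T \in A -> (forall T', T' \in A -> K *m T' *m L^T != 0 ->
    q (D *m T' *m C^T) = 0) -> q (D *m T *m C^T) = 0.
  move=> TA qD0; have [X00|] := eqVneq (K *m T *m L^T) 0; last exact: qD0.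
  have := qD0 (T0 + T); rewrite memvD // mulmxDr mulmxDl X00 addr0 => /(_ isT X0_neq0).
  by rewrite mulmxDr mulmxDl qD qD0 // add0r.
pose w : 'rV[F]_2 := \row_j if j == 0 then t else - s.
pose v : 'rV[F]_2 := \row_j if j == 0 then s else t.
have scale0 (a : F) (x : 'rV[F]_2) : x != 0 -> a *: x = 0 -> a = 0.
  by move=> x_neq0 /eqP; rewrite scaler_eq0 (negbTE x_neq0) orbF => /eqP.
have w_neq0 : w != 0.
  apply: contraTneq st_neq0 => /rowP w0; have := w0 0; have := w0 1; rewrite !mxE /=.
  by move=> /eqP; rewrite oppr_eq0 negb_or !negbK => -> ->; rewrite eqxx.
have v_neq0 : v != 0.
  apply: contraTneq st_neq0 => /rowP v0; have := v0 0; have := v0 1; rewrite !mxE /=.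
  by move=> -> ->; rewrite eqxx.
apply: (isotropic_triple skA isoA (x := w *m K) (y := w *m L) (z := v *m C)).
  by move=> a b c; rewrite !scalemxAl => /free[/scale0-> // /scale0-> // /scale0->].
have bil (x y : 'rV[F]_2) (Z : 'M[F]_2) : (x *m Z *m y^T) 0 0 =
    (x 0 0 * Z 0 0 + x 0 1 * Z 1 0) * y 0 0 + (x 0 0 * Z 0 1 + x 0 1 * Z 1 1) * y 0 1.
  by rewrite !mulmx2E ![y^T _ _]mxE.
have [w0 w1] : w 0 0 = t /\ w 0 1 = - s by rewrite !mxE.
have [v0 v1] : v 0 0 = s /\ v 0 1 = t by rewrite !mxE.
move=> T TA; rewrite !gramE; split; apply: scalar0; rewrite bil w0 w1 ?v0 ?v1.
- have [p1 p2] := perp _ TA; have [_ _ Xsym _ _] := blocks _ TA.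
  move: Xsym p1 p2; move: (K *m T *m L^T) => X Xsym p1 p2.
  transitivity (t * (t * X 0 0 - s * X 0 1) - s * (t * X 0 1 - s * X 1 1)).
    by rewrite Xsym; ring.
  by rewrite p1 p2 !subrr !mulr0 subrr.
- have <- : q (K *m T *m C^T) = 0.
    apply: q0 => // T' T'A X_neq0; have [_ _ Xsym adj _] := blocks _ T'A.
    by have [p1 p2] := perp _ T'A; apply: (q0_of (K *m T' *m L^T)) => //; apply: det0.
  by rewrite /q; ring.
- have <- : q (L *m T *m C^T) = 0.
    apply: q0 => // T' T'A X_neq0; have [_ _ Xsym _ adj] := blocks _ T'A.
    by have [p1 p2] := perp _ T'A; apply: (q0_of (K *m T' *m L^T)) => //; apply: det0.
  by rewrite /q; ring.
Qed.

End ExistsFrame.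

(** Each x stands for the matrix with columns f x and g x. Fix a nonzero x0 = e (la, mu). Polarizing
    the minors against x0 shows that mu f - la g is always a multiple of e. Either it vanishes on
    all of A, which is a common relation between the columns, or some x1 = e (la1, mu1) has an
    independent row; polarizing against x1 as well forces both columns of every member to be
    multiples of e. *)
Lemma rank1_dichotomy (F : fieldType) (I : Type) (V : zmodType) (A : V -> Prop)
    (f g : V -> I -> F) :
    (forall x y, A x -> A y -> A (x + y)) ->
    (forall x y i, f (x + y) i = f x i + f y i) ->
    (forall x y i, g (x + y) i = g x i + g y i) ->
    (forall x i j, A x -> f x i * g x j = f x j * g x i) ->
  (exists p q, (p != 0) || (q != 0) /\
     forall x i, A x -> p * f x i + q * g x i = 0) \/
  (exists e : I -> F, (exists k, e k != 0) /\
     forall x, A x -> exists c c', forall i, f x i = c * e i /\ g x i = c' * e i).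
Proof.
move=> AD fD gD minor.
have polar x y i j : A x -> A y ->
    f x i * g y j + f y i * g x j = f x j * g y i + f y j * g x i.
  move=> Ax Ay; have := minor _ i j (AD _ _ Ax Ay); rewrite !fD !gD => e.
  have -> : f x i * g y j + f y i * g x j =
    (f x i + f y i) * (g x j + g y j) - f x i * g x j - f y i * g y j by ring.
  by rewrite e (minor x) // (minor y) //; ring.
have [[x0 [k0 [Ax0 nz0]]]|all0] :=
    pselect (exists x k, A x /\ ((f x k != 0) || (g x k != 0))); last first.
  left; exists 1, 0; rewrite oner_eq0; split=> // x i Ax; rewrite mul1r mul0r addr0.
  by apply/eqP/negPn/negP => fx; apply: all0; exists x, i; rewrite fx.
have [e [k [ek [la [mu [lm e0]]]]]] : exists e : I -> F, exists k, e k != 0 /\ exists la mu,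
    (la != 0) || (mu != 0) /\ forall i, f x0 i = la * e i /\ g x0 i = mu * e i.
  have [f0|f0] := eqVneq (f x0 k0) 0.
    rewrite f0 eqxx /= in nz0; exists (g x0), k0; split=> //; exists 0, 1.
    rewrite oner_eq0 orbT; split=> // i; rewrite mul0r mul1r; split=> //.
    have := minor x0 i k0 Ax0; rewrite f0 mul0r => /eqP.
    by rewrite mulf_eq0 (negbTE nz0) orbF => /eqP.
  exists (f x0), k0; split=> //; exists 1, (g x0 k0 / f x0 k0).
  rewrite oner_eq0; split=> // i; rewrite mul1r; split=> //.
  by apply: (mulfI f0); rewrite (minor x0) //; field.
pose h x i := mu * f x i - la * g x i.
have h_par x i j : A x -> e j * h x i = e i * h x j.
  move=> Ax; have := polar x x0 i j Ax Ax0.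
  rewrite !(proj1 (e0 _)) !(proj2 (e0 _)) => eq1; apply/eqP; rewrite -subr_eq0; apply/eqP.
  have -> : e j * h x i - e i * h x j = (f x i * (mu * e j) + la * e i * g x j) -
     (f x j * (mu * e i) + la * e j * g x i) by rewrite /h; ring.
  by rewrite eq1 subrr.
have [[x1 [k1 [Ax1 h1]]]|h0] := pselect (exists x k, A x /\ h x k != 0); last first.
  left; exists mu, (- la); rewrite oppr_eq0 orbC; split=> // x i Ax.
  by rewrite mulNr; apply/eqP/negPn/negP => hx; apply: h0; exists x, i.
right; exists e; split; first by exists k.
have hE x i : A x -> h x i = h x k / e k * e i.
  by move=> Ax; apply: (mulfI ek); rewrite (h_par x i k) //; field.
have h1k : h x1 k != 0.
  by apply: contraNneq h1 => h1k; rewrite hE // h1k !mul0r.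
(* x1 has rank one, so its rows f and g are proportional to h x1, hence to e *)
have fg1 : exists la1 mu1, mu * la1 - la * mu1 != 0 /\
    forall i, f x1 i = la1 * e i /\ g x1 i = mu1 * e i.
  exists (f x1 k / e k), (g x1 k / e k).
  have -> : mu * (f x1 k / e k) - la * (g x1 k / e k) = h x1 k / e k by rewrite /h; field.
  split=> [|i]; first by rewrite mulf_neq0 // invr_eq0.
  have hf : h x1 k * f x1 i = h x1 i * f x1 k.
    rewrite /h; have := minor x1 i k Ax1 => m.
    have -> : (mu * f x1 k - la * g x1 k) * f x1 i =
      mu * f x1 k * f x1 i - la * (f x1 i * g x1 k) by ring.
    by rewrite m; ring.
  have hg : h x1 k * g x1 i = h x1 i * g x1 k.
    rewrite /h; have := minor x1 i k Ax1 => m.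
    have -> : (mu * f x1 i - la * g x1 i) * g x1 k =
      mu * (f x1 i * g x1 k) - la * g x1 i * g x1 k by ring.
    by rewrite m; ring.
  rewrite (hE x1 i Ax1) in hf hg; split; apply: (mulfI h1k).
    by rewrite hf; field.
  by rewrite hg; field.
have [la1 [mu1 [D e1]]] := fg1 => x Ax.
pose c := h x k / e k.
pose h' i := mu1 * f x i - la1 * g x i.
have h'_par i j : e j * h' i = e i * h' j.
  have := polar x x1 i j Ax Ax1.
  rewrite !(proj1 (e1 _)) !(proj2 (e1 _)) => eq1; apply/eqP; rewrite -subr_eq0; apply/eqP.
  have -> : e j * h' i - e i * h' j = (f x i * (mu1 * e j) + la1 * e i * g x j) -
     (f x j * (mu1 * e i) + la1 * e j * g x i) by rewrite /h'; ring.
  by rewrite eq1 subrr.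
have h'E i : h' i = h' k / e k * e i.
  by apply: (mulfI ek); rewrite (h'_par i k) //; field.
(* f x and g x are recovered by Cramer's rule from mu f - la g = c e and mu1 f - la1 g = c' e. *)
pose c' := h' k / e k; pose dd := mu * la1 - la * mu1.
exists ((la1 * c - la * c') / dd), ((mu1 * c - mu * c') / dd) => i.
have hi : mu * f x i - la * g x i = c * e i := hE x i Ax.
have h'i : mu1 * f x i - la1 * g x i = c' * e i := h'E i.
split; apply: (mulfI D).
  transitivity (la1 * (mu * f x i - la * g x i) - la * (mu1 * f x i - la1 * g x i)).
    by ring.
  by rewrite hi h'i /dd; field.
transitivity (mu1 * (mu * f x i - la * g x i) - mu * (mu1 * f x i - la1 * g x i)).
  by ring.
by rewrite hi h'i /dd; field.
Qed.

(** * The blocks of a form relative to a frame *)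

Section FrameBlocks.
Variables (F : numClosedFieldType) (A : {vspace 'M[F]_6}).
Hypothesis skA : forall M, M \in A -> M^T = - M.
Hypothesis rkA : forall M, M \in A -> (\rank M <= 4)%N.
Implicit Types (T M N : 'M[F]_6) (K L C : 'M[F]_(2, 6)) (X U V : 'M[F]_2).

(** For symmetric 2 x 2 matrices the last three equations say that X, U, V commute pairwise. They
    are also the minors of the 3 x 2 matrix with rows (Z 0 0 - Z 1 1, Z 0 1), the traceless parts of
    the blocks. *)
Record commuting_syms X U V : Prop := CommutingSyms {
  symX : X 1 0 = X 0 1;
  symU : U 1 0 = U 0 1;
  symV : V 1 0 = V 0 1;
  commXU : (X 0 0 - X 1 1) * U 0 1 = (U 0 0 - U 1 1) * X 0 1;
  commXV : (X 0 0 - X 1 1) * V 0 1 = (V 0 0 - V 1 1) * X 0 1;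
  commUV : (U 0 0 - U 1 1) * V 0 1 = (V 0 0 - V 1 1) * U 0 1 }.

(** The frame form [M1] shifts X by scalars. Comparing the symmetry of adj(X) U at X and at X + 1
    gives the symmetry of U, and similarly for V. The Pfaffian as a polynomial in the shift z gives
    the vanishing of the CC block (from z^2) and the relation between U and V (from z). *)
Lemma frame_blocks K L C T : frame A K L C -> T \in A ->
  shape T K L C (K *m T *m L^T) (K *m T *m C^T) (L *m T *m C^T) /\
  commuting_syms (K *m T *m L^T) (K *m T *m C^T) (L *m T *m C^T).
Proof.
move=> [[M1 M1A sh1] [M2 M2A sh2] [M3 M3A sh3]] TA.
have blocks := pair_frame_blocks skA rkA M3A M2A sh3 sh2.
have [MKK MLL MCC MKL MKC MLC] := sh1.
have gram1 z (D E : 'M[F]_(2, 6)) :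
    D *m (T + z *: M1) *m E^T = D *m T *m E^T + z *: (D *m M1 *m E^T).
  by rewrite mulmxDr mulmxDl -scalemxAr -scalemxAl.
have TzA z : T + z *: M1 \in A by rewrite memvD // memvZ.
have [KK LL Xsym adjU adjV] := blocks _ TA.
have [_ _ _ adjU1 adjV1] := blocks _ (TzA 1).
have pf z := pf6_eq0 skA rkA K L C (TzA z).
have skCC : (C *m T *m C^T)^T = - (C *m T *m C^T) by apply: skew_gram; apply: skA.
move: adjU1 adjV1 Xsym adjU adjV.
have {}pf z : pf6 0 0 ((C *m T *m C^T) 0 1) (K *m T *m L^T + z%:M)
    (K *m T *m C^T) (L *m T *m C^T) = 0.
  have := pf z; rewrite !gram1 KK LL MKK MLL MCC MKL MKC MLC !scaler0 !addr0 scalemx1.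
  by rewrite !mxE.
rewrite !gram1 MKL MKC MLC !scaler0 !addr0 scale1r.
suff : forall X U V (c : 'M[F]_2), c^T = - c -> (forall z, pf6 0 0 (c 0 1) (X + z%:M) U V = 0) ->
    (X + 1%:M) 1 1 * U 0 1 - (X + 1%:M) 0 1 * U 1 1 + (X + 1%:M) 0 1 * U 0 0
      - (X + 1%:M) 0 0 * U 1 0 = 0 ->
    (X + 1%:M) 1 1 * V 0 1 - (X + 1%:M) 0 1 * V 1 1 + (X + 1%:M) 0 1 * V 0 0
      - (X + 1%:M) 0 0 * V 1 0 = 0 ->
    X 1 0 = X 0 1 ->
    X 1 1 * U 0 1 - X 0 1 * U 1 1 + X 0 1 * U 0 0 - X 0 0 * U 1 0 = 0 ->
    X 1 1 * V 0 1 - X 0 1 * V 1 1 + X 0 1 * V 0 0 - X 0 0 * V 1 0 = 0 ->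
    c = 0 /\ commuting_syms X U V.
  move=> H e1 e2 e3 e4 e5; have [CC cs] := H _ _ _ _ skCC pf e1 e2 e3 e4 e5.
  by split.
clear => X U V c skc pf; rewrite !mxE /= => adjU1 adjV1 Xsym adjU adjV.
have symZ (Z : 'M[F]_2) : (X 1 1 + 1) * Z 0 1 - (X 0 1 + 0) * Z 1 1 + (X 0 1 + 0) * Z 0 0
      - (X 0 0 + 1) * Z 1 0 = 0 ->
    X 1 1 * Z 0 1 - X 0 1 * Z 1 1 + X 0 1 * Z 0 0 - X 0 0 * Z 1 0 = 0 -> Z 1 0 = Z 0 1.
  rewrite !addr0 => e1 e2; apply/eqP; rewrite eq_sym -subr_eq0 -[X in _ == X](subrr 0).
  by rewrite -[X in _ == X - _]e1 -[X in _ == _ - X]e2; apply/eqP; ring.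
have Usym := symZ _ adjU1 adjU; have Vsym := symZ _ adjV1 adjV.
have comm (Z : 'M[F]_2) : Z 1 0 = Z 0 1 ->
    X 1 1 * Z 0 1 - X 0 1 * Z 1 1 + X 0 1 * Z 0 0 - X 0 0 * Z 1 0 = 0 ->
    (X 0 0 - X 1 1) * Z 0 1 = (Z 0 0 - Z 1 1) * X 0 1.
  move=> Zsym e; apply/eqP; rewrite eq_sym -subr_eq0 -[X in _ == X]e Zsym; apply/eqP; ring.
have [] := @quadratic_eq0 F (- c 0 1) 0 0
  (U 1 0 * V 1 1 - U 1 1 * V 1 0 + U 0 0 * V 0 1 - U 0 1 * V 0 0
    - c 0 1 * (X 0 0 + X 1 1)) 0 (pf6 0 0 (c 0 1) X U V).
  by move=> x y; rewrite -[RHS](pf x) /pf6 !mxE /=; ring.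
move=> /eqP; rewrite oppr_eq0 => /eqP c0 _ _; rewrite c0 Usym Vsym => UV _.
split; first exact: skew2P.
split=> //; [exact: comm | exact: comm |].
by apply/eqP; rewrite -subr_eq0 -[X in _ == X]UV; apply/eqP; ring.
Qed.

End FrameBlocks.

(** * The two normal forms of A *)

Section NormalFrames.
Variables (F : numClosedFieldType) (A : {vspace 'M[F]_6}).
Hypothesis skA : forall M, M \in A -> M^T = - M.
Hypothesis rkA : forall M, M \in A -> (\rank M <= 4)%N.
Hypothesis isoA : forall L : 'M_(3, 6),
  row_free L -> ~ (forall M, M \in A -> L *m M *m L^T = 0).
Implicit Types (T M N : 'M[F]_6) (K L C : 'M[F]_(2, 6)) (X U V : 'M[F]_2).

Lemma frame_free K L C (p q r : 'rV_2) : frame A K L C ->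
  p *m K + q *m L + r *m C = 0 -> [/\ p = 0, q = 0 & r = 0].
Proof.
by move=> [_ [M2 M2A sh2] [M3 M3A sh3]]; apply: (pair_frame_free skA M3A M2A).
Qed.

Lemma frame_isotropic K L C (v : 'rV_2) : frame A K L C -> v != 0 ->
  ~ (forall T, T \in A -> [/\ v *m (K *m T *m L^T) *m v^T = 0,
       v *m (K *m T *m C^T) *m v^T = 0 & v *m (L *m T *m C^T) *m v^T = 0]).
Proof.
move=> fr v_neq0 iso.
have scale0 (a : F) (x : 'rV[F]_2) : x != 0 -> a *: x = 0 -> a = 0.
  by move=> x_neq0 /eqP; rewrite scaler_eq0 (negbTE x_neq0) orbF => /eqP.
apply: (isotropic_triple skA isoA (x := v *m K) (y := v *m L) (z := v *m C)).
  by move=> a b c; rewrite !scalemxAl => /(frame_free fr)[/scale0-> // /scale0-> // /scale0->].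
by move=> T /iso[]; rewrite !mulmxA !trmx_mul !mulmxA => -> -> ->.
Qed.

Definition mk_row2 (a b : F) : 'rV[F]_2 := \row_j if j == 0 then a else b.

Lemma bilinear2E (x y : 'rV[F]_2) (Z : 'M[F]_2) : (x *m Z *m y^T) 0 0 =
  (x 0 0 * Z 0 0 + x 0 1 * Z 1 0) * y 0 0 + (x 0 0 * Z 0 1 + x 0 1 * Z 1 1) * y 0 1.
Proof. by rewrite !mulmx2E ![y^T _ _]mxE. Qed.

Lemma frame_mul_orthogonal (h : 'M_2) K L C : h *m h^T = 1%:M -> frame A K L C ->
  frame A (h *m K) (h *m L) (h *m C).
Proof.
move=> hh [[M1 M1A sh1] [M2 M2A sh2] [M3 M3A sh3]]; split.
- by exists M1 => //; have := shape_mul h h h sh1; rewrite !(mulmx0, mul0mx) mulmx1 hh.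
- by exists M2 => //; have := shape_mul h h h sh2; rewrite !(mulmx0, mul0mx) mulmx1 hh.
- by exists M3 => //; have := shape_mul h h h sh3; rewrite !(mulmx0, mul0mx) mulmx1 hh.
Qed.

(* The traceless parts of the blocks are multiples of D = [[q/2, -p], [-p, -q/2]].
   Either D is a multiple of v^T v with v isotropic, or an orthogonal matrix h
   diagonalizes D. *)
Lemma diagonal_frame K L C (p q : F) : frame A K L C -> (p != 0) || (q != 0) ->
    (forall T, T \in A -> forall Z, Z \in [:: K *m T *m L^T; K *m T *m C^T; L *m T *m C^T] ->
      p * (Z 0 0 - Z 1 1) + q * Z 0 1 = 0) ->
  exists h : 'M[F]_2, frame A (h *m K) (h *m L) (h *m C) /\
    forall T, T \in A -> forall Z, Z \in [:: K *m T *m L^T; K *m T *m C^T; L *m T *m C^T] ->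
      (h *m Z *m h^T) 0 1 = 0.
Proof.
move=> fr pq_neq0 perp.
have sym T Z (TA : T \in A) : Z \in [:: K *m T *m L^T; K *m T *m C^T; L *m T *m C^T] ->
    Z 1 0 = Z 0 1.
  have [_ [s1 s2 s3 _ _ _]] := frame_blocks skA rkA fr TA.
  by rewrite !inE => /or3P[] /eqP ->.
have i2 : 'i * 'i = -1 :> F by rewrite -expr2 sqrCi.
(* [dl] is - \det D. If it vanishes, e = q / (2 p) is a square root of -1 and (1, e) is the
   isotropic vector. *)
pose dl := q ^+ 2 / 4%:R + p ^+ 2.
have dl_neq0 : dl != 0.
  apply/negP=> /eqP dl0.
  have [e [e2 pqe p_neq0]] : exists e, [/\ e ^+ 2 = -1, q = 2%:R * e * p & p != 0].
    have p_neq0 : p != 0.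
      apply: contraTneq pq_neq0 => p0; rewrite p0 eqxx /=.
      move/eqP: dl0; rewrite /dl p0 expr0n addr0 mulf_eq0 invr_eq0 pnatr_eq0 orbF expf_eq0 /=.
      by rewrite negbK.
    exists (q / (2%:R * p)); split=> //; last by field.
    have : (q / (2%:R * p)) ^+ 2 + 1 = dl / p ^+ 2 by rewrite /dl; field.
    by rewrite dl0 mul0r => /eqP; rewrite addr_eq0 => /eqP.
  have isoZ T Z : T \in A -> Z \in [:: K *m T *m L^T; K *m T *m C^T; L *m T *m C^T] ->
      mk_row2 1 e *m Z *m (mk_row2 1 e)^T = 0.
    move=> TA Zin; apply/matrixP=> i j; rewrite !ord1 bilinear2E (sym _ _ TA Zin) !mxE /=.
    apply: (mulfI p_neq0); rewrite mulr0 -(perp _ TA _ Zin) pqe.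
    transitivity (p * (Z 0 0 + e ^+ 2 * Z 1 1) + 2%:R * e * p * Z 0 1); first by ring.
    by rewrite e2; ring.
  apply: (frame_isotropic fr (v := mk_row2 1 e)).
    by apply/eqP=> /rowP/(_ 0); rewrite !mxE /= => /eqP; rewrite oner_eq0.
  by move=> T TA; split; apply: isoZ TA _; rewrite !inE eqxx ?orbT.
(* (p, q/2 - rho) is an eigenvector of D for the eigenvalue rho, with sum of squares 2 rho (rho -
   q/2). The sign of rho is chosen so that it is not isotropic and can be normalized to a row of
   [h]. *)
have [rho [rho2 rho_neq]] : exists rho : F, rho ^+ 2 = dl /\ 2%:R * rho * (rho - q / 2%:R) != 0.
  have r_neq0 : sqrtC dl != 0 by rewrite sqrtC_eq0.
  have [rE|r_neq] := eqVneq (sqrtC dl) (q / 2%:R).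
    exists (- sqrtC dl); rewrite sqrrN sqrtCK; split=> //.
    have -> : 2%:R * - sqrtC dl * (- sqrtC dl - q / 2%:R) = 4%:R * sqrtC dl ^+ 2.
      by rewrite -rE; ring.
    by rewrite sqrtCK mulf_eq0 negb_or pnatr_eq0.
  exists (sqrtC dl); rewrite sqrtCK; split=> //.
  by rewrite !mulf_eq0 pnatr_eq0 (negbTE r_neq0) /= subr_eq0.
pose a := p; pose b := q / 2%:R - rho.
have n_eq : a ^+ 2 + b ^+ 2 = 2%:R * rho * (rho - q / 2%:R).
  have -> : a ^+ 2 + b ^+ 2 = dl - q * rho + rho ^+ 2 by rewrite /a /b /dl; field.
  by rewrite -rho2; field.
have ab_perp : a ^+ 2 - b ^+ 2 = - b * q.
  have -> : a ^+ 2 - b ^+ 2 = dl - rho ^+ 2 - q ^+ 2 / 2%:R + q * rho.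
    by rewrite /a /b /dl; field.
  by rewrite rho2 /b; field.
pose n := sqrtC (a ^+ 2 + b ^+ 2).
have n2 : n ^+ 2 = a ^+ 2 + b ^+ 2 by rewrite sqrtCK.
have n_neq0 : n != 0 by rewrite sqrtC_eq0 n_eq.
pose h : 'M[F]_2 := \matrix_(i, j) if i == 0 then if j == 0 then a / n else b / n
                                    else if j == 0 then - b / n else a / n.
have nn : (a / n) ^+ 2 + (b / n) ^+ 2 = 1.
  have -> : (a / n) ^+ 2 + (b / n) ^+ 2 = (a ^+ 2 + b ^+ 2) / n ^+ 2 by field.
  by rewrite n2 divff // -n2 expf_neq0.
have hh : h *m h^T = 1%:M.
  by apply: mx2P; rewrite mulmx2E !mxE /= ?mulr1n ?mulr0n -?nn; ring.
exists h; split; first exact: frame_mul_orthogonal.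
move=> T TA Z Zin; rewrite !mulmx2E ![h^T _ _]mxE ![h _ _]mxE /= (sym _ _ TA Zin).
transitivity (((a ^+ 2 - b ^+ 2) * Z 0 1 - a * b * (Z 0 0 - Z 1 1)) / n ^+ 2); first by field.
rewrite ab_perp (_ : _ - _ = - b * (p * (Z 0 0 - Z 1 1) + q * Z 0 1)); last first.
  by rewrite /a; ring.
by rewrite (perp _ TA _ Zin) mulr0 mul0r.
Qed.

Lemma frame_perm132 K L C : frame A K L C -> frame A K C L.
Proof.
move=> [[M1 M1A [KK1 LL1 CC1 KL1 KC1 LC1]] [M2 M2A [KK2 LL2 CC2 KL2 KC2 LC2]]
  [M3 M3A [KK3 LL3 CC3 KL3 KC3 LC3]]].
split; [exists M2 | exists M1 | exists (- M3)]; rewrite ?memvN //; split=> //;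
  rewrite ?mulmxN ?mulNmx ?KK3 ?LL3 ?CC3 ?KL3 ?KC3 ?oppr0 //.
- by rewrite (gram_tr (skA M2A) LC2) trmx0 oppr0.
- by rewrite (gram_tr (skA M1A) LC1) trmx0 oppr0.
- by rewrite (gram_tr (skA M3A) LC3) trmx1 opprK.
Qed.

Lemma frame_perm231 K L C : frame A K L C -> frame A L C K.
Proof.
move=> [[M1 M1A [KK1 LL1 CC1 KL1 KC1 LC1]] [M2 M2A [KK2 LL2 CC2 KL2 KC2 LC2]]
  [M3 M3A [KK3 LL3 CC3 KL3 KC3 LC3]]].
split; [exists M3 | exists (- M1) | exists (- M2)]; rewrite ?memvN //; split=> //;
  rewrite ?mulmxN ?mulNmx ?KK1 ?LL1 ?CC1 ?KK2 ?LL2 ?CC2 ?LC1 ?LC2 ?oppr0 //.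
- by rewrite (gram_tr (skA M3A) KL3) trmx0 oppr0.
- by rewrite (gram_tr (skA M3A) KC3) trmx0 oppr0.
- by rewrite (gram_tr (skA M1A) KL1) trmx1 opprK.
- by rewrite (gram_tr (skA M1A) KC1) trmx0 !oppr0.
- by rewrite (gram_tr (skA M2A) KL2) trmx0 !oppr0.
- by rewrite (gram_tr (skA M2A) KC2) trmx1 opprK.
Qed.

(** The shift of C takes scalar blocks (x, y, z) to (x, y - a x, z - b x). So M2 and M3 keep their
    shapes, and M1 + a M2 + b M3 takes the place of M1. *)
Lemma frame_pivot K L C (a b : F) : frame A K L C ->
  frame A K L (C + b%:M *m K + (- a)%:M *m L).
Proof.
move=> [[M1 M1A sh1] [M2 M2A sh2] [M3 M3A sh3]].
set C' := C + _ + _.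
have pivot T x y z : T \in A -> shape T K L C x%:M y%:M z%:M ->
    shape T K L C' x%:M (y - a * x)%:M (z - b * x)%:M.
  move=> TA [KK LL CC KL KC LC].
  have LK := gram_tr (skA TA) KL; have CK := gram_tr (skA TA) KC.
  have CL := gram_tr (skA TA) LC.
  split=> //.
  - rewrite gram_combl !gram_combr KK LL CC KL KC LC LK CK CL !tr_scalar_mx.
    rewrite !mul0mx !addr0 !add0r !mulmxDr !(mulNmx, mulmxN) -!scalar_mxM.
    by apply: mx2P; rewrite !mxE /= ?mulr1n ?mulr0n; ring.
  - rewrite gram_combr KK KL KC !tr_scalar_mx mul0mx addr0 -scalar_mxM -raddfD /=.
    by congr (_%:M); ring.
  - rewrite gram_combr LL LK LC !tr_scalar_mx mul0mx addr0 mulNmx -scalar_mxM.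
    by rewrite -raddfB /=; congr (_%:M); ring.
have lin T T' S x x' (D E : 'M[F]_(2, 6)) Z Z' Y : D *m T *m E^T = Z -> D *m T' *m E^T = Z' ->
    D *m S *m E^T = Y ->
    D *m (T + x *: T' + x' *: S) *m E^T = Z + x *: Z' + x' *: Y.
  by move=> <- <- <-; rewrite !mulmxDr !mulmxDl -!scalemxAr -!scalemxAl.
have [|KK1 LL1 CC1 KL1 KC1 LC1] := @pivot M1 1 0 0 M1A; first by rewrite !raddf0.
have [|KK2 LL2 CC2 KL2 KC2 LC2] := @pivot M2 0 1 0 M2A; first by rewrite !raddf0.
have [|KK3 LL3 CC3 KL3 KC3 LC3] := @pivot M3 0 0 1 M3A; first by rewrite !raddf0.
split.
- exists (M1 + a *: M2 + b *: M3); first by rewrite !memvD ?memvZ.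
  split; rewrite ?(lin _ _ _ _ _ _ _ _ _ _ KK1 KK2 KK3) ?(lin _ _ _ _ _ _ _ _ _ _ LL1 LL2 LL3)
    ?(lin _ _ _ _ _ _ _ _ _ _ CC1 CC2 CC3) ?(lin _ _ _ _ _ _ _ _ _ _ KL1 KL2 KL3)
    ?(lin _ _ _ _ _ _ _ _ _ _ KC1 KC2 KC3) ?(lin _ _ _ _ _ _ _ _ _ _ LC1 LC2 LC3);
  by apply: mx2P; rewrite !mxE /= ?mulr1n ?mulr0n; ring.
- exists M2 => //; split=> //; rewrite ?KL2 ?KC2 ?LC2 ?mulr0 ?subr0 ?raddf0 //.
- exists M3 => //; split=> //; rewrite ?KL3 ?KC3 ?LC3 ?mulr0 ?subr0 ?raddf0 //.
Qed.

(* The two kinds of linear spaces of matrices of rank at most 1, for the 3 x 2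
   matrices of traceless parts of the blocks. *)
Lemma exists_normal_frame : (exists K L C, frame A K L C) ->
  exists K L C, frame A K L C /\
    ((forall T, T \in A -> [/\ (K *m T *m L^T) 0 1 = 0, (K *m T *m C^T) 0 1 = 0 &
        (L *m T *m C^T) 0 1 = 0]) \/
     (forall T, T \in A -> exists u v, K *m T *m C^T = u%:M /\ L *m T *m C^T = v%:M)).
Proof.
move=> [K [L [C fr]]].
(* The three blocks index the rows of the 3 x 2 matrix of traceless parts. *)
pose blk T (o : option bool) : 'M[F]_2 :=
  if o is Some b then if b then K *m T *m L^T else K *m T *m C^T else L *m T *m C^T.
have blkD T T' o : blk (T + T') o = blk T o + blk T' o.
  by case: o => [[]|]; rewrite /blk mulmxDr mulmxDl.
have [|||T i j TA|[p [q [pq_neq0 perp]]]|[e [[k ek] eE]]] :=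
    @rank1_dichotomy F (option bool) 'M[F]_6 (fun T => T \in A)
      (fun T o => blk T o 0 0 - blk T o 1 1) (fun T o => blk T o 0 1).
- by move=> T T'; apply: memvD.
- by move=> T T' o; rewrite blkD !mxE; ring.
- by move=> T T' o; rewrite blkD !mxE.
- have [_ [_ _ _ XU XV UV]] := frame_blocks skA rkA fr TA.
  by case: i j => [[]|] [[]|] //=; rewrite mulrC [RHS]mulrC ?XU ?XV ?UV mulrC.
- have [|h [fr' diag]] := diagonal_frame fr pq_neq0.
    move=> T TA Z; rewrite !inE => /or3P[] /eqP ->.
    + exact: (perp T (Some true)).
    + exact: (perp T (Some false)).
    + exact: (perp T None).
  exists (h *m K), (h *m L), (h *m C); split=> //; left => T TA.
  have hE (D E : 'M[F]_(2, 6)) : h *m D *m T *m (h *m E)^T = h *m (D *m T *m E^T) *m h^T.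
    by rewrite trmx_mul !mulmxA.
  by rewrite !hE; split; apply: (diag T TA); rewrite !inE eqxx ?orbT.
have scalarP (Z : 'M[F]_2) : Z 1 0 = Z 0 1 -> Z 0 0 - Z 1 1 = 0 -> Z 0 1 = 0 -> Z = (Z 0 0)%:M.
  move=> Zsym /eqP; rewrite subr_eq0 => /eqP Z11 Z01.
  by apply: mx2P; rewrite ?Zsym ?Z01 ?mxE //= ?mulr1n ?mulr0n // -Z11 mulr1n.
have pivot (K1 L1 C1 : 'M[F]_(2, 6)) (a b : F) : frame A K1 L1 C1 ->
    (forall T, T \in A ->
      [/\ (K1 *m T *m C1^T) 0 0 - (K1 *m T *m C1^T) 1 1 =
            a * ((K1 *m T *m L1^T) 0 0 - (K1 *m T *m L1^T) 1 1),
          (K1 *m T *m C1^T) 0 1 = a * (K1 *m T *m L1^T) 0 1,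
          (L1 *m T *m C1^T) 0 0 - (L1 *m T *m C1^T) 1 1 =
            b * ((K1 *m T *m L1^T) 0 0 - (K1 *m T *m L1^T) 1 1) &
          (L1 *m T *m C1^T) 0 1 = b * (K1 *m T *m L1^T) 0 1]) ->
    exists K L C, frame A K L C /\
     (forall T, T \in A -> exists u v, K *m T *m C^T = u%:M /\ L *m T *m C^T = v%:M).
  move=> frp prop; have frp' := frame_pivot a b frp.
  exists K1, L1, (C1 + b%:M *m K1 + (- a)%:M *m L1); split=> // T TA.
  have [d1 o1 d2 o2] := prop T TA.
  have [[KK LL _ _ _ _] [Xsym Usym Vsym _ _ _]] := frame_blocks skA rkA frp TA.
  have LK := gram_tr (skA TA) (erefl (K1 *m T *m L1^T)).
  have UE : K1 *m T *m (C1 + b%:M *m K1 + (- a)%:M *m L1)^T =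
      K1 *m T *m C1^T - a *: (K1 *m T *m L1^T).
    by rewrite gram_combr KK mul0mx addr0 tr_scalar_mx mul_mx_scalar scaleNr.
  have VE : L1 *m T *m (C1 + b%:M *m K1 + (- a)%:M *m L1)^T =
      L1 *m T *m C1^T - b *: (K1 *m T *m L1^T).
    rewrite gram_combr LL mul0mx addr0 LK tr_scalar_mx mul_mx_scalar scalerN.
    by congr (_ - b *: _); apply: mx2P; rewrite mxE ?Xsym.
  rewrite UE VE; move: Xsym Usym Vsym d1 o1 d2 o2.
  move: (K1 *m T *m L1^T) (K1 *m T *m C1^T) (L1 *m T *m C1^T) => X U V Xsym Usym Vsym d1 o1 d2 o2.
  have comb (Z : 'M[F]_2) c : Z 1 0 = Z 0 1 -> Z 0 0 - Z 1 1 = c * (X 0 0 - X 1 1) ->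
      Z 0 1 = c * X 0 1 -> Z - c *: X = ((Z - c *: X) 0 0)%:M.
    move=> Zsym d o; apply: scalarP; rewrite !mxE ?Zsym ?Xsym //; last by rewrite o subrr.
    transitivity (Z 0 0 - Z 1 1 - c * (X 0 0 - X 1 1)); first by ring.
    by rewrite d subrr.
  by exists ((U - a *: X) 0 0), ((V - b *: X) 0 0); split; apply: comb.
suff [K' [L' [C' [fr' sc]]]] : exists K L C, frame A K L C /\
    (forall T, T \in A -> exists u v, K *m T *m C^T = u%:M /\ L *m T *m C^T = v%:M).
  by exists K', L', C'; split=> //; right.
(* A nonzero entry of the common column e serves as pivot; a permutation of the frame moves it to
   the KL block when necessary. *)
have [eX|eX] := eqVneq (e (Some true)) 0; last first.
  apply: (pivot K L C (e (Some false) / e (Some true)) (e None / e (Some true))) => // T TA.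
  have [c [c' cE]] := eE T TA.
  have [/= -> ->] := cE (Some true); have [/= -> ->] := cE (Some false).
  by have [/= -> ->] := cE None; split; field.
have [eU|eU] := eqVneq (e (Some false)) 0; last first.
  apply: (pivot K C L 0 (- e None / e (Some false))); first exact: frame_perm132.
  move=> T TA; have [c [c' cE]] := eE T TA.
  rewrite (gram_tr (skA TA) (erefl (L *m T *m C^T))) ![(- _ : 'M_2) _ _]mxE ![(_^T) _ _]mxE.
  have [_ [_ _ Vsym _ _ _]] := frame_blocks skA rkA fr TA; rewrite Vsym.
  have [/= -> ->] := cE (Some true); have [/= -> ->] := cE (Some false).
  by rewrite eX -opprD; have [/= -> ->] := cE None; split; field.
have eV : e None != 0 by case: k ek => [[]|] //; rewrite ?eX ?eU eqxx.
apply: (pivot L C K 0 0); first exact: frame_perm231.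
move=> T TA; have [c [c' cE]] := eE T TA.
rewrite (gram_tr (skA TA) (erefl (K *m T *m L^T))) (gram_tr (skA TA) (erefl (K *m T *m C^T))).
rewrite ![(- _ : 'M_2) _ _]mxE ![(_^T) _ _]mxE -!opprD.
have [_ [Xsym Usym _ _ _ _]] := frame_blocks skA rkA fr TA; rewrite Xsym Usym.
have [/= -> ->] := cE (Some true); have [/= -> ->] := cE (Some false).
by rewrite eX eU; split; ring.
Qed.

End NormalFrames.

(** * Open sets of subspaces *)

Section LinearForms.
Variables (F : fieldType) (E : vectType F).
Implicit Types (B : {vspace E}).

Lemma basis_comb k B (X : k.-tuple E) x : basis_of B X -> x \in B ->
  exists c : 'rV[F]_k, x = \sum_i c 0 i *: tnth X i.
Proof.
move=> X_basis xB; exists (\row_i coord X i x).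
rewrite {1}(coord_basis X_basis xB); apply: eq_bigr => i _.
by rewrite mxE (tnth_nth 0).
Qed.

Lemma basis_comb0 k B (X : k.-tuple E) (c : 'rV[F]_k) : basis_of B X ->
  \sum_i c 0 i *: tnth X i = 0 -> c = 0.
Proof.
move=> /basis_free/freeP X_free c0; apply/rowP=> i; rewrite mxE.
by apply: X_free; rewrite -[RHS]c0; apply: eq_bigr => j _; rewrite (tnth_nth 0).
Qed.

Definition form_mx k m (f : 'I_m -> {linear E -> F | *%R}) (X : k.-tuple E) : 'M[F]_(k, m) :=
  \matrix_(i, j) f j (tnth X i).

Lemma form_mx_comb k m (f : 'I_m -> {linear E -> F | *%R}) (X : k.-tuple E) (c : 'rV[F]_k) j :
  f j (\sum_i c 0 i *: tnth X i) = (c *m form_mx f X) 0 j.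
Proof. by rewrite linear_sum mxE; apply: eq_bigr => i _; rewrite linearZ mxE. Qed.

Lemma form_mx_free k m B (f : 'I_m -> {linear E -> F | *%R}) (X : k.-tuple E) :
    basis_of B X -> (forall x, x \in B -> (forall j, f j x = 0) -> x = 0) ->
  row_free (form_mx f X).
Proof.
move=> X_basis f_inj; apply: inj_row_free => c cf0; apply: (basis_comb0 X_basis).
apply: f_inj => [|j]; last by rewrite form_mx_comb cf0 mxE.
by rewrite memv_suml // => i _; rewrite memvZ // (basis_mem X_basis) // mem_tnth.
Qed.

Lemma dim_le_forms m B (f : 'I_m -> {linear E -> F | *%R}) :
  (forall x, x \in B -> (forall j, f j x = 0) -> x = 0) -> (\dim B <= m)%N.
Proof.
move=> f_inj; have := form_mx_free (vbasisP B) f_inj.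
by rewrite /row_free => /eqP <-; apply: rank_leq_col.
Qed.

Lemma interpolate_forms m B (f : 'I_m -> {linear E -> F | *%R}) (c : 'rV[F]_m) :
    \dim B = m -> (forall x, x \in B -> (forall j, f j x = 0) -> x = 0) ->
  exists2 x, x \in B & forall j, f j x = c 0 j.
Proof.
move=> dimB f_inj; pose X : m.-tuple E := tcast dimB (vbasis B).
have X_basis : basis_of B X by rewrite /X val_tcast; apply: vbasisP.
have fU : form_mx f X \in unitmx.
  by rewrite -row_free_unit; apply: form_mx_free X_basis f_inj.
pose d := c *m invmx (form_mx f X).
exists (\sum_i d 0 i *: tnth X i) => [|j]; last by rewrite form_mx_comb mulmxKV.
by rewrite memv_suml // => i _; rewrite memvZ // (basis_mem X_basis) // mem_tnth.
Qed.

Lemma forms_common_zero m B (f : 'I_m -> {linear E -> F | *%R}) :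
  (m < \dim B)%N -> exists x, [/\ x \in B, x != 0 & forall j, f j x = 0].
Proof.
move=> lt_m; apply: contrapT => no_x; move: lt_m; rewrite ltnNge => /negP; apply.
apply: (@dim_le_forms _ _ f) => x xB fx0; apply/eqP/negPn/negP => x_neq0.
by apply: no_x; exists x.
Qed.

(** Each column of the matrix is a combination, with coefficients f j (b a), of columns of
    coordinates. Multilinearity in the columns gives a sum over all maps s, injective or not, which
    is how the coordinates of [plucker] are indexed. *)
Lemma det_form_plucker k (f : 'I_k -> {linear E -> F | *%R}) :
  exists2 q : {mpoly F[#|{: {ffun 'I_k -> 'I_(\dim {:E})}}|]},
    q \is 1.-homog & forall X : k.-tuple E, q.@[plucker X] = \det (form_mx f X).
Proof.
pose b (a : 'I_(\dim {:E})) := (vbasis {:E})`_a.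
pose w (s : {ffun 'I_k -> 'I_(\dim {:E})}) := \prod_j f j (b (s j)).
exists (\sum_(s < #|{: {ffun 'I_k -> 'I_(\dim {:E})}}|) w (enum_val s) *: 'X_s).
  by apply: rpred_sum => s _; apply: dhomogZ; rewrite dhomogX /= mdeg1.
move=> X; rewrite raddf_sum /=.
under eq_bigr => s _ do rewrite mevalZ mevalXU.
rewrite /plucker (reindex_onto enum_rank enum_val) /=; last by move=> s _; rewrite enum_valK.
under eq_bigl => s do rewrite enum_rankK eqxx.
under eq_bigr => s _ do rewrite enum_rankK.
rewrite -[RHS]det_tr [RHS]/determinant.
have fE i j : f j (tnth X i) = \sum_a coords (tnth X i) a * f j (b a).
  rewrite {1}(coord_vbasis (memvf (tnth X i))) linear_sum; apply: eq_bigr => a _.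
  by rewrite linearZ.
under [RHS]eq_bigr => s _ do under eq_bigr => i _ do rewrite !mxE fE.
under [RHS]eq_bigr => s _ do rewrite bigA_distr_bigA /= mulr_sumr.
rewrite exchange_big /=; apply: eq_bigr => s _.
rewrite -det_tr /determinant mulr_sumr; apply: eq_bigr => sg _.
rewrite mulrCA; congr (_ * _); rewrite /w mulrC -big_split /=.
by apply: eq_bigr => i _; rewrite !mxE.
Qed.

Lemma plucker_change_basis k (X Y : k.-tuple E) (P : 'M[F]_k) :
    (forall i, tnth Y i = \sum_j P i j *: tnth X j) ->
  forall s, plucker Y s = \det P * plucker X s.
Proof.
move=> YE s; rewrite /plucker -det_mulmx; congr (\det _).
apply/matrixP=> i j; rewrite !mxE YE /coords linear_sum /=.
by apply: eq_bigr => l _; rewrite linearZ !mxE.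
Qed.

Lemma meval_homog n d (q : {mpoly F[n]}) (c : F) (v : 'I_n -> F) : q \is d.-homog ->
  q.@[fun i => c * v i] = c ^+ d * q.@[v].
Proof.
move=> /dhomogP q_homog; rewrite !mevalE mulr_sumr; apply: eq_big_seq => m m_in.
rewrite mulrCA; congr (_ * _); rewrite -(q_homog m m_in) /= mdegE -prodrXr -big_split /=.
by apply: eq_bigr => i _; rewrite exprMn.
Qed.

Lemma general_of_homog k (A : {vspace E}) (P : {vspace E} -> Prop) d
    (q : {mpoly F[#|{: {ffun 'I_k -> 'I_(\dim {:E})}}|]}) (B0 : {vspace E}) (X0 : k.-tuple E) :
    q \is d.-homog ->
    (B0 <= A)%VS -> basis_of B0 X0 -> q.@[plucker X0] != 0 ->
    (forall B (X : k.-tuple E), (B <= A)%VS -> basis_of B X -> q.@[plucker X] != 0 -> P B) ->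
  for_general_subspace k A P.
Proof.
move=> q_homog B0A X0_basis q0 qP.
(* By homogeneity the values of q at two bases of B differ by a power of a determinant, so one basis
   decides for all. *)
exists (fun B => exists2 X : k.-tuple E, basis_of B X & q.@[plucker X] != 0); split.
- exists (fun p => p = q); split=> [_ ->|B X BA dimB X_basis]; first by exists d.
  split=> [[Y Y_basis qY]|[p -> qX]]; last by exists X.
  exists q => //; apply: contraNneq qY => qX.
  have Ycomb i : exists c : 'rV[F]_k, tnth Y i = \sum_j c 0 j *: tnth X j.
    by apply: (basis_comb X_basis); apply: basis_mem (mem_tnth i Y).
  have [c cE] := choice Ycomb.
  have YE i : tnth Y i = \sum_j (\matrix_(i, j) c i 0 j) i j *: tnth X j.
    by rewrite cE; apply: eq_bigr => j _; rewrite mxE.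
  by rewrite (meval_eq _ (plucker_change_basis YE)) (meval_homog _ _ q_homog) qX mulr0.
- exists B0; split=> //; last by exists X0.
  by rewrite -(span_basis X0_basis) (eqnP (basis_free X0_basis)) size_tuple.
by move=> B BA dimB [X X_basis qX]; apply: qP BA X_basis qX.
Qed.

End LinearForms.

(** * The plane pi_g *)

Section GramEntries.
Variable F : fieldType.

Definition gram_entry (D E : 'M[F]_(2, 6)) (i j : 'I_2) (T : 'M[F]_6) : F :=
  (D *m T *m E^T) i j.

Fact gram_entry_is_linear D E i j : linear_for *%R (gram_entry D E i j).
Proof.
by move=> a S T; rewrite /gram_entry mulmxDr mulmxDl -scalemxAr -scalemxAl !mxE.
Qed.

HB.instance Definition _ D E i j :=
  GRing.isLinear.Build F 'M[F]_6 F *%R (gram_entry D E i j) (gram_entry_is_linear D E i j).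

End GramEntries.

Section FrameGeometry.
Variables (F : numClosedFieldType).
Implicit Types (A B : {vspace 'M[F]_6}) (T M N : 'M[F]_6) (K L C : 'M[F]_(2, 6)).

Definition skew_space A := forall M, M \in A -> M^T = - M.

Definition frame_mx K L C : 'M[F]_(2 + (2 + 2), 6) := col_mx K (col_mx L C).

Lemma frame_mx_unit A K L C : skew_space A -> frame A K L C ->
  (frame_mx K L C : 'M_6) \in unitmx.
Proof.
move=> skA fr; rewrite -row_free_unit.
apply: (@inj_row_free F (2 + (2 + 2)) 6 (frame_mx K L C)) => w.
rewrite -[w]hsubmxK -[rsubmx w]hsubmxK /frame_mx !mul_row_col addrA.
by move=> /(frame_free skA fr)[-> -> ->]; rewrite !row_mx0.
Qed.

Lemma frame_kernel m A K L C (Z : 'M_(m, 6)) : skew_space A -> frame A K L C ->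
  Z *m K^T = 0 -> Z *m L^T = 0 -> Z *m C^T = 0 -> Z = 0.
Proof.
move=> skA fr ZK ZL ZC.
have gU : (frame_mx K L C)^T \in unitmx by rewrite unitmx_tr (frame_mx_unit skA fr).
apply: (can_inj (mulmxK gU)).
rewrite mul0mx /frame_mx !tr_col_mx.
have -> : @mulmx _ m 6 (2 + (2 + 2)) Z (row_mx K^T (row_mx L^T C^T)) = 0; last by [].
by rewrite !mul_mx_row ZK ZL ZC !row_mx0.
Qed.

Lemma frame_shape0 A K L C T : skew_space A -> frame A K L C -> T^T = - T ->
  shape T K L C 0 0 0 -> T = 0.
Proof.
move=> skA fr skT [KK LL CC KL KC LC].
have LK := gram_tr skT KL; have CK := gram_tr skT KC; have CL := gram_tr skT LC.
rewrite trmx0 oppr0 in LK CK CL.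
have KT : K *m T = 0 by apply: (frame_kernel skA fr).
have LT : L *m T = 0 by apply: (frame_kernel skA fr).
have CT : C *m T = 0 by apply: (frame_kernel skA fr).
by apply: (frame_kernel skA fr); apply: trmx_inj;
  rewrite trmx_mul trmxK skT mulmxN ?KT ?LT ?CT oppr0 trmx0.
Qed.

Lemma frame_shape_inj A K L C S T X U V : skew_space A -> frame A K L C ->
  S^T = - S -> T^T = - T -> shape S K L C X U V -> shape T K L C X U V -> S = T.
Proof.
move=> skA fr skS skT [KK LL CC KL KC LC] [KK' LL' CC' KL' KC' LC'].
apply/eqP; rewrite -subr_eq0; apply/eqP; apply: (frame_shape0 skA fr).
  by rewrite raddfB /= skS skT opprB opprK addrC.
by split; rewrite mulmxBr mulmxBl ?KK ?LL ?CC ?KL ?KC ?LC ?KK' ?LL' ?CC' ?KL' ?KC' ?LC' subrr.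
Qed.

Lemma shape_scalar00 T K L C x u v : shape T K L C x%:M u%:M v%:M ->
  [/\ (K *m T *m L^T) 0 0 = x, (K *m T *m C^T) 0 0 = u & (L *m T *m C^T) 0 0 = v].
Proof. by case=> _ _ _ -> -> ->; rewrite !mxE /= !mulr1n. Qed.

Lemma frame_basis A K L C : frame A K L C ->
  exists M1 M2 M3, [/\ [/\ M1 \in A, M2 \in A & M3 \in A],
    [/\ shape M1 K L C 1%:M 0 0, shape M2 K L C 0 1%:M 0 & shape M3 K L C 0 0 1%:M] &
    free [:: M1; M2; M3]].
Proof.
move=> [[M1 M1A sh1] [M2 M2A sh2] [M3 M3A sh3]]; exists M1, M2, M3; split=> //.
apply/(@freeP _ _ 3 [tuple M1; M2; M3]) => k; rewrite !big_ord_recl big_ord0 /= addr0 => eq0.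
have e D E i j : k 0 * gram_entry D E i j M1 + (k (lift ord0 ord0) * gram_entry D E i j M2 +
    k (lift ord0 (lift ord0 ord0)) * gram_entry D E i j M3) = 0.
  have := congr1 (gram_entry D E i j) eq0; rewrite !linearD !linearZ /= => ->.
  by rewrite linear0.
move: sh1 sh2 sh3; rewrite -!(raddf0 (@scalar_mx F 2)).
move=> /shape_scalar00[x1 u1 v1] /shape_scalar00[x2 u2 v2] /shape_scalar00[x3 u3 v3].
have := e K L 0 0; have := e K C 0 0; have := e L C 0 0; rewrite /gram_entry.
rewrite x1 x2 x3 u1 u2 u3 v1 v2 v3 !(mulr1, mulr0, addr0, add0r) => k2 k1 k0.
case=> [[|[|[|i]]] lt_i] //.
- by rewrite (_ : Ordinal _ = 0) //; apply: val_inj.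
- by rewrite -k1; congr k; apply: val_inj.
- by rewrite -k2; congr k; apply: val_inj.
Qed.

Lemma frame_dim_ge A K L C : frame A K L C -> (3 <= \dim A)%N.
Proof.
move=> /frame_basis[M1 [M2 [M3 [[M1A M2A M3A] _ M_free]]]].
apply: (@leq_trans (\dim <<[:: M1; M2; M3]>>)); first by rewrite (eqnP M_free).
apply: dimvS.
by apply/span_subvP => M; rewrite !inE => /or3P[] /eqP ->.
Qed.

Lemma frame_span A K L C : frame A K L C -> \dim A = 3%N ->
  exists M1 M2 M3, [/\ A = <<[:: M1; M2; M3]>>%VS, shape M1 K L C 1%:M 0 0,
    shape M2 K L C 0 1%:M 0 & shape M3 K L C 0 0 1%:M].
Proof.
move=> /frame_basis[M1 [M2 [M3 [[M1A M2A M3A] [sh1 sh2 sh3] M_free]]]] dimA.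
exists M1, M2, M3; split=> //; apply/esym/eqP; rewrite eqEdim dimA (eqnP M_free) leqnn andbT.
by apply/span_subvP => M; rewrite !inE => /or3P[] /eqP ->.
Qed.

Lemma frame_equiv A B K L C K' L' C' : skew_space A -> skew_space B ->
    \dim A = 3%N -> \dim B = 3%N -> frame A K L C -> frame B K' L' C' ->
  exists2 h : 'M_6, h \in unitmx & (form_act h @: A)%VS = B.
Proof.
move=> skA skB dimA dimB frA frB.
have gU := frame_mx_unit skA frA; have gU' := frame_mx_unit skB frB.
have [h hU gh] : exists2 h : 'M_6, h \in unitmx &
    frame_mx K' L' C' *m h = frame_mx K L C :> 'M_(2 + (2 + 2), 6).
  exists (invmx (frame_mx K' L' C' : 'M_6) *m (frame_mx K L C : 'M_6)).
    by rewrite unitmx_mul unitmx_inv gU' gU.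
  exact: (mulKVmx gU').
exists h => //.
have [eK eL eC] : [/\ K' *m h = K, L' *m h = L & C' *m h = C].
  by move: gh; rewrite /frame_mx !mul_col_mx => /eq_col_mx[-> /eq_col_mx[-> ->]].
have [M1 [M2 [M3 [AE sh1 sh2 sh3]]]] := frame_span frA dimA.
have [N1 [N2 [N3 [BE sh1' sh2' sh3']]]] := frame_span frB dimB.
have hE M N X U V : M \in A -> N \in B -> shape M K L C X U V -> shape N K' L' C' X U V ->
    form_act h M = N.
  move=> MA NB [KK LL CC KL KC LC] shN.
  have skh : (form_act h M)^T = - form_act h M.
    by rewrite form_actE !trmx_mul trmxK skA // mulNmx mulmxN mulmxA.
  have E (D E : 'M[F]_(2, 6)) : D *m form_act h M *m E^T = (D *m h) *m M *m (E *m h)^T.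
    by rewrite form_actE trmx_mul !mulmxA.
  have shh : shape (form_act h M) K' L' C' X U V by split; rewrite E ?eK ?eL ?eC.
  exact: (frame_shape_inj skB frB skh (skB _ NB) shh shN).
have memA M : M \in [:: M1; M2; M3] -> M \in A by rewrite AE; apply: memv_span.
have memB M : M \in [:: N1; N2; N3] -> M \in B by rewrite BE; apply: memv_span.
rewrite AE limg_span BE /=.
by rewrite (hE _ _ _ _ _ _ _ sh1 sh1') ?(hE _ _ _ _ _ _ _ sh2 sh2') ?(hE _ _ _ _ _ _ _ sh3 sh3')
  ?memA ?memB ?inE ?eqxx ?orbT.
Qed.

(** Linear spaces do not see the scaling of h, and \det (c h) = c^6 \det h. *)
Lemma SL_equiv_unit A B (h : 'M[F]_6) : h \in unitmx -> (form_act h @: A)%VS = B ->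
  SL_equiv A B.
Proof.
rewrite unitmxE unitfE => deth hA.
pose c := 6.-root (\det h)^-1.
have c6 : c ^+ 6 = (\det h)^-1 by rewrite rootCK.
have c_neq0 : c != 0 by apply: contraNneq deth => c0; rewrite -invr_eq0 -c6 c0 expr0n.
exists (c *: h); first by rewrite detZ c6 mulVf.
have chE M : form_act (c *: h) M = c ^+ 2 *: form_act h M.
  by rewrite !form_actE linearZ /= -!scalemxAl -scalemxAr scalerA.
rewrite -hA; apply/eqP; rewrite eqEsubv; apply/andP; split; apply/subvP=> _ /memv_imgP[M MA ->].
  by rewrite chE memvZ // memv_img.
have -> : form_act h M = form_act (c *: h) (c ^- 2 *: M).
  by rewrite chE linearZ scalerA divff ?scale1r // expf_neq0.
by rewrite memv_img // memvZ.
Qed.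

Definition std_basis : 6.-tuple 'rV[F]_6 := [tuple delta_mx 0 i | i < 6].

Lemma std_basisE (i : 'I_6) : std_basis`_i = delta_mx 0 i.
Proof. by rewrite -tnth_nth tnth_mktuple. Qed.

Lemma std_basis_basis : basis_of fullv std_basis.
Proof.
rewrite basisEfree subvf size_tuple dimvf /dim /= leqnn andbT.
apply/(@freeP _ _ 6 std_basis) => k k0 i; have /rowP/(_ i) := k0.
rewrite summxE [X in _ = X]mxE (bigD1 i) // big1 => [ki|j ij].
  by rewrite -ki [RHS]addr0 std_basisE !mxE !eqxx mulr1.
by rewrite std_basisE !mxE eqxx eq_sym (negbTE ij) mulr0.
Qed.

Lemma gram_wedge m n (D : 'M[F]_(m, 6)) (E : 'M_(n, 6)) u v i j :
  (D *m wedge u v *m E^T) i j =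
  (D *m u^T) i 0 * (E *m v^T) j 0 - (D *m v^T) i 0 * (E *m u^T) j 0.
Proof.
have dotE (x y : 'rV[F]_6) : (D *m (x^T *m y) *m E^T) i j = (D *m x^T) i 0 * (E *m y^T) j 0.
  rewrite !mulmxA -(mulmxA _ y) mxE big_ord1; congr (_ * _).
  by have -> : y *m E^T = (E *m y^T)^T; [rewrite trmx_mul trmxK | rewrite mxE].
by rewrite /wedge mulmxBr mulmxBl [LHS]mxE dotE [(- _ : 'M_(m, n)) _ _]mxE dotE.
Qed.

Lemma pi_g_frame : exists K L C, frame (pi_g std_basis) K L C.
Proof.
pose ep i : 'rV[F]_6 := delta_mx 0 i.
pose rows (x y : 'rV[F]_6) : 'M[F]_(2, 6) := \matrix_i if i == 0 then x else y.
(* With this pairing and sign, each generator has a single nonzero block, equal to [H]; a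
   factorization H = h h^T then turns it into the identity. *)
pose K := rows (ep 0) (- ep 4); pose L := rows (ep 1) (ep 3); pose C := rows (ep 2) (ep 5).
have dotE i j : (ep i *m (ep j)^T) 0 0 = (i == j)%:R.
  by rewrite trmx_delta mul_delta_mx_cond; case: eqP => _; rewrite ?mulr1n ?mulr0n mxE.
have rowsE (x y z : 'rV[F]_6) i : (rows x y *m z^T) i 0 =
    if i == 0 then (x *m z^T) 0 0 else (y *m z^T) 0 0.
  by rewrite mxE; case: ifP => i0; rewrite [RHS]mxE; apply: eq_bigr => k _; rewrite !mxE i0.
have K_E i k : (K *m (ep k)^T) i 0 = if i == 0 then (0 == k)%:R else - (4 == k)%:R.
  by rewrite rowsE mulNmx [(- _ : 'M_1) _ _]mxE !dotE.
have L_E i k : (L *m (ep k)^T) i 0 = if i == 0 then (1 == k)%:R else (3 == k)%:R.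
  by rewrite rowsE !dotE.
have C_E i k : (C *m (ep k)^T) i 0 = if i == 0 then (2 == k)%:R else (5 == k)%:R.
  by rewrite rowsE !dotE.
pose H : 'M[F]_2 := \matrix_(i, j) (i != j)%:R.
have Hsym : H 1 0 = H 0 1 by rewrite !mxE.
have [|h hU HE] := sym2_factor Hsym; first by rewrite det2 !mxE mul0r mul1r sub0r oppr_eq0 oner_eq0.
have eqb : [/\ std_basis`_0 = ep 0, std_basis`_1 = ep 1 & std_basis`_2 = ep 2] /\
    [/\ std_basis`_3 = ep 3, std_basis`_4 = ep 4 & std_basis`_5 = ep 5].
  split; split; rewrite /ep -std_basisE //.
have [[e0 e1 e2] [e3 e4 e5]] := eqb.
pose G1 := wedge (ep 0) (ep 3) + wedge (ep 1) (ep 4).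
pose G2 := wedge (ep 0) (ep 5) + wedge (ep 2) (ep 4).
pose G3 := wedge (ep 1) (ep 5) - wedge (ep 2) (ep 3).
have [G1pi G2pi G3pi] : [/\ G1 \in pi_g std_basis, G2 \in pi_g std_basis & G3 \in pi_g std_basis].
  rewrite /pi_g e0 e1 e2 e3 e4 e5 -/G1 -/G2 -/G3.
  by split; apply: memv_span; rewrite !inE eqxx ?orbT.
have gramD (D E : 'M[F]_(2, 6)) u v u' v' i j : (D *m (wedge u v + wedge u' v') *m E^T) i j =
    (D *m wedge u v *m E^T) i j + (D *m wedge u' v' *m E^T) i j.
  by rewrite mulmxDr mulmxDl mxE.
have gramB (D E : 'M[F]_(2, 6)) u v u' v' i j : (D *m (wedge u v - wedge u' v') *m E^T) i j =
    (D *m wedge u v *m E^T) i j - (D *m wedge u' v' *m E^T) i j.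
  by rewrite mulmxBr mulmxBl !mxE.
pose simp := (mulr0, mul0r, mulr1, mul1r, mulrN, mulNr, addr0, add0r,
  subr0, sub0r, oppr0, opprK, subrr).
clearbody K L C.
have shG1 : shape G1 K L C H 0 0.
  by split; apply: mx2P; rewrite /G1 gramD !gram_wedge ?K_E ?L_E ?C_E /= !simp ?mxE.
have shG2 : shape G2 K L C 0 H 0.
  by split; apply: mx2P; rewrite /G2 gramD !gram_wedge ?K_E ?L_E ?C_E /= !simp ?mxE.
have shG3 : shape G3 K L C 0 0 H.
  by split; apply: mx2P; rewrite /G3 gramB !gram_wedge ?K_E ?L_E ?C_E /= !simp ?mxE.
have hHh : invmx h *m H *m (invmx h)^T = 1%:M.
  by rewrite HE mulKmx // -trmx_mul mulVmx // trmx1.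
exists (invmx h *m K), (invmx h *m L), (invmx h *m C); split.
- by exists G1 => //; have := shape_mul (invmx h) (invmx h) (invmx h) shG1;
    rewrite !(mulmx0, mul0mx) hHh.
- by exists G2 => //; have := shape_mul (invmx h) (invmx h) (invmx h) shG2;
    rewrite !(mulmx0, mul0mx) hHh.
- by exists G3 => //; have := shape_mul (invmx h) (invmx h) (invmx h) shG3;
    rewrite !(mulmx0, mul0mx) hHh.
Qed.

End FrameGeometry.

(** * Forms of rank at most 2 *)

Section RankTwo.
Variables (F : numClosedFieldType).
Implicit Types (A B : {vspace 'M[F]_6}) (T M N : 'M[F]_6) (K L C : 'M[F]_(2, 6)).

Lemma skew_span (s : seq 'M[F]_6) : (forall M, M \in s -> M^T = - M) -> skew_space <<s>>%VS.
Proof.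
move=> sks M Ms; rewrite (@coord_span _ _ _ (in_tuple s) _ Ms) raddf_sum -sumrN.
apply: eq_bigr => i _.
have /sks sksi : (in_tuple s)`_i \in s by apply: mem_nth.
move: (coord _ _ _) (nth _ _ _) sksi => c X skX; apply: etrans (linearZ _ _) _ => /=.
by rewrite skX scalerN.
Qed.

Lemma wedge_tr (u v : 'rV[F]_6) : (wedge u v)^T = - wedge u v.
Proof. by rewrite /wedge raddfB /= !trmx_mul !trmxK opprB. Qed.

Lemma pi_g_skew (e : 6.-tuple 'rV[F]_6) : skew_space (pi_g e).
Proof.
have skD (S T : 'M[F]_6) : S^T = - S -> T^T = - T -> (S + T)^T = - (S + T).
  by move=> skS skT; rewrite raddfD /= skS skT opprD.
have skN (S : 'M[F]_6) : S^T = - S -> (- S)^T = - (- S) by move=> skS; rewrite raddfN /= skS.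
apply: skew_span => M; rewrite !inE => /or3P[] /eqP ->; apply: skD; rewrite ?skN ?wedge_tr //.
Qed.

Lemma frame_SL_equiv B K L C : skew_space B -> \dim B = 3%N -> frame B K L C ->
  SL_equiv B (pi_g (std_basis F)).
Proof.
move=> skB dimB fr; have [K' [L' [C' fr']]] := pi_g_frame F.
have dim_pi : \dim (pi_g (std_basis F)) = 3%N.
  by apply/eqP; rewrite eqn_leq dim_span (frame_dim_ge fr').
have [h hU hB] := frame_equiv skB (@pi_g_skew _) dimB dim_pi fr fr'.
exact: SL_equiv_unit hU hB.
Qed.

Lemma skew_rank_ge2 T : T^T = - T -> T != 0 -> (2 <= \rank T)%N.
Proof.
move=> skT T_neq0.
have [i [j Tij]] : exists i j, T i j != 0.
  apply: contrapT => T0; case/eqP: T_neq0; apply/matrixP=> i j; rewrite mxE.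
  by apply/eqP/negPn/negP => Tij; apply: T0; exists i, j.
pose D : 'M[F]_(2, 6) := \matrix_(k, l) (l == if k == 0 then i else j)%:R.
have DE (a b : 'I_2) : (D *m T *m D^T) a b = T (if a == 0 then i else j) (if b == 0 then i else j).
  rewrite mxE (bigD1 (if b == 0 then i else j)) //= big1 => [|l lb]; last first.
    by rewrite [D^T _ _]mxE [D _ _]mxE (negbTE lb) mulr0.
  rewrite addr0 [D^T _ _]mxE [D _ _]mxE eqxx mulr1.
  rewrite mxE (bigD1 (if a == 0 then i else j)) //= big1 => [|l la]; last first.
    by rewrite [D _ _]mxE (negbTE la) mul0r.
  by rewrite addr0 [D _ _]mxE eqxx mul1r.
have Tji : T j i = - T i j by have /matrixP/(_ i j) := skT; rewrite !mxE.
have : D *m T *m D^T \in unitmx.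
  rewrite unitmxE unitfE det2 !DE /= Tji (skew_diag i skT) mul0r sub0r mulrN opprK.
  by rewrite mulf_neq0.
move=> /mxrank_unit rk2; rewrite -[X in (X <= _)%N]rk2.
by apply: (leq_trans (mxrankM_maxl _ _)); apply: mxrankM_maxr.
Qed.

Lemma rank_le2 T (x y z w : 'rV[F]_6) :
    (forall a b c d : F, a *: x + b *: y + c *: z + d *: w = 0 ->
      [/\ a = 0, b = 0, c = 0 & d = 0]) ->
    x *m T = 0 -> y *m T = 0 -> z *m T = 0 -> w *m T = 0 ->
  (\rank T <= 2)%N.
Proof.
move=> xyzw_free xT yT zT wT.
pose Z : 'M[F]_(1 + (1 + (1 + 1)), 6) := col_mx x (col_mx y (col_mx z w)).
have Z_free : row_free Z.
  apply: inj_row_free => v; rewrite -[v]hsubmxK mul_row_col.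
  rewrite -[rsubmx v]hsubmxK mul_row_col -[rsubmx (rsubmx v)]hsubmxK mul_row_col.
  rewrite [lsubmx v]mx11_scalar [lsubmx (rsubmx v)]mx11_scalar.
  rewrite [lsubmx (rsubmx (rsubmx v))]mx11_scalar [rsubmx (rsubmx (rsubmx v))]mx11_scalar.
  rewrite !mul_scalar_mx !addrA => /xyzw_free[-> -> -> ->].
  by rewrite !raddf0 !row_mx0.
have ZT : Z *m T = 0 by rewrite /Z !mul_col_mx xT yT zT wT !col_mx0.
by have := mulmx0_rank_max ZT; rewrite (eqP Z_free) !addSn !ltnS.
Qed.

(** This is the three-term Plücker relation for decomposable forms. *)
Lemma rank2_pf4 T (x y z w : 'rV[F]_6) : T^T = - T -> (\rank T <= 2)%N ->
  (x *m T *m y^T) 0 0 * (z *m T *m w^T) 0 0 =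
  (x *m T *m z^T) 0 0 * (y *m T *m w^T) 0 0 - (x *m T *m w^T) 0 0 * (y *m T *m z^T) 0 0.
Proof.
move=> skT rkT; pose rows (u v : 'rV[F]_6) : 'M[F]_(2, 6) := \matrix_i if i == 0 then u else v.
have row0 u v : row 0 (rows u v) = u by rewrite rowK.
have row1 u v : row 1 (rows u v) = v by rewrite rowK.
have := pf4_gram (rows x y) (rows z w) skT rkT; rewrite det2.
rewrite !(gram_row (rows _ _)) !row0 !row1 => ->.
by [].
Qed.

End RankTwo.

(** * Planes without forms of rank 2 *)

Section FramePlanes.
Variables (F : numClosedFieldType) (A : {vspace 'M[F]_6}).
Hypothesis skA : skew_space A.
Hypothesis rkA : forall M, M \in A -> (\rank M <= 4)%N.
Implicit Types (B : {vspace 'M[F]_6}) (T M N : 'M[F]_6) (X U V : 'M[F]_2).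
Variables K L C : 'M[F]_(2, 6).
Hypothesis fr : frame A K L C.

Definition std2 (i : 'I_2) : 'rV[F]_2 := delta_mx 0 i.

Lemma std2_free a b : a *: std2 0 + b *: std2 1 = 0 -> a = 0 /\ b = 0.
Proof.
move=> /rowP ab; have := ab 0; have := ab 1.
by rewrite !mxE /= !(mulr0, mulr1, addr0, add0r) => -> ->.
Qed.

Lemma det3 (s : 'M[F]_3) : \det s =
  s 0 0 * (s 1 1 * s 2 2 - s 1 2 * s 2 1) - s 0 1 * (s 1 0 * s 2 2 - s 1 2 * s 2 0)
  + s 0 2 * (s 1 0 * s 2 1 - s 1 1 * s 2 0).
Proof.
pose g (a b : nat) := s (inord a) (inord b).
have sE i j : s i j = g i j by rewrite /g !inord_val.
rewrite (expand_det_row _ 0) !big_ord_recl big_ord0 addr0 /cofactor !det2 !mxE !sE /=.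
rewrite /bump /= !(addn0, addn1, expr0, expr1, exprS); ring.
Qed.

Lemma ord3P (P : 'I_3 -> Prop) : P 0 -> P 1 -> P 2 -> forall j, P j.
Proof.
move=> P0 P1 P2 [[|[|[|j]]] lt_j] //.
- by rewrite (_ : Ordinal _ = 0) //; apply: val_inj.
- by rewrite (_ : Ordinal _ = 1) //; apply: val_inj.
- by rewrite (_ : Ordinal _ = 2) //; apply: val_inj.
Qed.

Definition forms3 (a b c : {linear 'M[F]_6 -> F | *%R}) (j : 'I_3) :=
  if j == 0 then a else if j == 1 then b else c.

Definition triple3 M1 M2 M3 : 3.-tuple 'M[F]_6 := [tuple M1; M2; M3].

Lemma form_mx_triple3 (f : 'I_3 -> {linear 'M[F]_6 -> F | *%R}) M1 M2 M3 :
  form_mx f (triple3 M1 M2 M3) =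
  \matrix_(i, j) f j (if i == 0 then M1 else if i == 1 then M2 else M3).
Proof. by apply/matrixP; apply: ord3P => j; rewrite !mxE. Qed.

Lemma span3 M1 M2 M3 T : T \in <<[:: M1; M2; M3]>>%VS ->
  exists a b c, T = a *: M1 + b *: M2 + c *: M3.
Proof.
move=> Tin; rewrite (@coord_span _ _ _ (triple3 M1 M2 M3) _ Tin) !big_ord_recl big_ord0 addr0 addrA.
by do 3!eexists.
Qed.

Lemma frame_dim_gt3 :
  (forall L : 'M_(3, 6), row_free L -> ~ (forall M, M \in A -> L *m M *m L^T = 0)) ->
  (3 < \dim A)%N.
Proof.
move=> isoA; rewrite ltn_neqAle (frame_dim_ge fr) andbT; apply/negP=> /eqP dimA.
have [M1 [M2 [M3 [AE sh1 sh2 sh3]]]] := frame_span fr (esym dimA).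
have v_neq0 : mk_row2 1 'i != 0 :> 'rV[F]_2.
  by apply/eqP=> /rowP/(_ 0); rewrite !mxE /= => /eqP; rewrite oner_eq0.
apply: (frame_isotropic skA isoA fr v_neq0) => T; rewrite AE => /span3[a [b [c ->]]].
case: sh1 => _ _ _ KL1 KC1 LC1; case: sh2 => _ _ _ KL2 KC2 LC2; case: sh3 => _ _ _ KL3 KC3 LC3.
have lin D E Z1 Z2 Z3 : D *m M1 *m E^T = Z1 -> D *m M2 *m E^T = Z2 -> D *m M3 *m E^T = Z3 ->
    D *m (a *: M1 + b *: M2 + c *: M3) *m E^T = a *: Z1 + b *: Z2 + c *: Z3 :> 'M[F]_2.
  by move=> <- <- <-; rewrite !mulmxDr !mulmxDl -!scalemxAr -!scalemxAl.
rewrite (lin _ _ _ _ _ KL1 KL2 KL3) (lin _ _ _ _ _ KC1 KC2 KC3) (lin _ _ _ _ _ LC1 LC2 LC3).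
rewrite !scaler0 !addr0 !add0r !scalemx1.
have vv x : mk_row2 1 'i *m x%:M *m (mk_row2 1 'i)^T = 0 :> 'M[F]_1.
  rewrite mul_mx_scalar -scalemxAl; apply/matrixP=> i j; rewrite !ord1 mxE mulmx2E !mxE /=.
  by rewrite mulr1 -expr2 sqrCi subrr mulr0.
by rewrite !vv.
Qed.

Section DiagonalCase.

Hypothesis diagA : forall T, T \in A ->
  [/\ (K *m T *m L^T) 0 1 = 0, (K *m T *m C^T) 0 1 = 0 & (L *m T *m C^T) 0 1 = 0].

Definition dg (a b : F) : 'M[F]_2 :=
  \matrix_(i, j) if i == j then (if i == 0 then a else b) else 0.

(** [dform 0] and [dform 1] are the coordinates of the components in /\^2 U and /\^2 U'. *)
Definition dform (i : 'I_2) : 'I_3 -> {linear 'M[F]_6 -> F | *%R} :=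
  forms3 (gram_entry K L i i) (gram_entry K C i i) (gram_entry L C i i).

Lemma diag_shape T : T \in A -> shape T K L C (dg (dform 0 0 T) (dform 1 0 T))
  (dg (dform 0 1 T) (dform 1 1 T)) (dg (dform 0 2 T) (dform 1 2 T)).
Proof.
move=> TA; have [[KK LL CC _ _ _] [Xs Us Vs _ _ _]] := frame_blocks skA rkA fr TA.
have [X0 U0 V0] := diagA TA.
by split=> //; apply: mx2P; rewrite [RHS]mxE //= ?Xs ?Us ?Vs.
Qed.

Lemma diag_eq0 T : T \in A -> (forall i j, dform i j T = 0) -> T = 0.
Proof.
move=> TA f0; have := diag_shape TA; rewrite !f0.
have -> : dg 0 0 = 0 by apply/matrixP=> i j; rewrite !mxE; case: ifP => // _; case: ifP.
by apply: (frame_shape0 skA fr); apply: skA.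
Qed.

Lemma diag_dim_le6 : (\dim A <= 6)%N.
Proof.
apply: (@dim_le_forms _ _ (3 + 3) A (fun j => match split j with
  inl k => dform 0 k | inr k => dform 1 k end)) => T TA f0.
apply: (diag_eq0 TA) => i j; have [-> | ->] : i = 0 \/ i = 1.
  by case: i => [[|[|i]] lt_i] //; [left | right]; apply: val_inj.
- by have := f0 (unsplit (inl j)); rewrite unsplitK.
- by have := f0 (unsplit (inr j)); rewrite unsplitK.
Qed.

(** The Plücker relation writes every product of a coordinate in /\^2 U with one in /\^2 U' through
    values of T on U x U' mixed pairs of frame vectors, and these vanish. *)
Lemma diag_rank2 T : T \in A -> (\rank T <= 2)%N ->
  exists i, forall j, dform i j T = 0.
Proof.
move=> TA rkT; have skT := skA TA.
have prod0 j k : dform 0 j T * dform 1 k T = 0.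
  have cross D E : D \in [:: K; L; C] -> E \in [:: K; L; C] ->
      (row 0 D *m T *m (row 1 E)^T) 0 0 = 0.
    have [X0 U0 V0] := diagA TA.
    have [[KK LL CC _ _ _] [Xs Us Vs _ _ _]] := frame_blocks skA rkA fr TA.
    rewrite !inE => /or3P[] /eqP -> /or3P[] /eqP ->; rewrite -gram_row //.
    - by rewrite KK mxE.
    - by rewrite (gram_tr skT (erefl (K *m T *m L^T))) mxE [_^T _ _]mxE Xs X0 oppr0.
    - by rewrite LL mxE.
    - by rewrite (gram_tr skT (erefl (K *m T *m C^T))) mxE [_^T _ _]mxE Us U0 oppr0.
    - by rewrite (gram_tr skT (erefl (L *m T *m C^T))) mxE [_^T _ _]mxE Vs V0 oppr0.
    - by rewrite CC mxE.
  have pq D E D' E' : D \in [:: K; L; C] -> E \in [:: K; L; C] -> D' \in [:: K; L; C] ->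
      E' \in [:: K; L; C] -> gram_entry D E 0 0 T * gram_entry D' E' 1 1 T = 0.
    move=> Din Ein D'in E'in; rewrite /gram_entry (gram_row D T E 0 0).
    rewrite (gram_row D' T E' 1 1) rank2_pf4 //.
    by rewrite !cross // !mul0r subrr.
  move: j k; apply: ord3P; apply: ord3P; apply: pq; by rewrite !inE eqxx ?orbT.
have [f0|[j fj]] : (forall j, dform 0 j T = 0) \/ exists j, dform 0 j T != 0.
  have [f0|f0] := pselect (exists j, dform 0 j T != 0); first by right.
  by left=> j; apply/eqP/negPn/negP => fj; apply: f0; exists j.
- by exists 0.
exists 1 => k; apply/eqP; have /eqP := prod0 j k.
by rewrite mulf_eq0 (negbTE fj).
Qed.

Lemma rank2_shape T (e : 'M[F]_2) (d d' : 'rV[F]_2) (x u v : F) : T \in A -> T != 0 ->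
    e^T = e -> d' *m e = 0 -> (forall a b, a *: d + b *: d' = 0 -> a = 0 /\ b = 0) ->
    shape T K L C (x *: e) (u *: e) (v *: e) ->
  in_Gr2 T.
Proof.
move=> TA T_neq0 eT d'e dd'_free shT; have skT := skA TA; split=> //.
have nz : [|| x != 0, u != 0 | v != 0].
  apply: contraNT T_neq0; rewrite !negb_or !negbK => /and3P[/eqP x0 /eqP u0 /eqP v0].
  by apply/eqP/(frame_shape0 skA fr skT); move: shT; rewrite x0 u0 v0 !scale0r.
apply/eqP; rewrite eqn_leq skew_rank_ge2 // andbT.
have ker (y : 'rV[F]_6) : y *m T *m K^T = 0 -> y *m T *m L^T = 0 -> y *m T *m C^T = 0 ->
    y *m T = 0 by exact: (frame_kernel skA fr).
case: shT => KK LL CC KL KC LC.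
have LK := gram_tr skT KL; have CK := gram_tr skT KC; have CL := gram_tr skT LC.
rewrite linearZ /= eT in LK; rewrite linearZ /= eT in CK; rewrite linearZ /= eT in CL.
have gramE (y : 'rV[F]_2) (D E : 'M[F]_(2, 6)) : y *m D *m T *m E^T = y *m (D *m T *m E^T).
  by rewrite !mulmxA.
(* T is the tensor product of e, killed by d', with the 3 x 3 skew matrix of entries x, u, v, whose
   kernel is spanned by (v, -u, x). This vector tensored with d is the fourth kernel vector. *)
pose z := v *: d *m K - u *: d *m L + x *: d *m C.
apply: (@rank_le2 _ _ (d' *m K) (d' *m L) (d' *m C) z).
- move=> a b c t; rewrite /z -!scalemxAl => eq0.
  have [] := frame_free skA fr (p := (t * v) *: d + a *: d') (q := (- (t * u)) *: d + b *: d')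
    (r := (t * x) *: d + c *: d').
    rewrite -[RHS]eq0 !mulmxDl -!scalemxAl.
    move: (d *m K) (d *m L) (d *m C) (d' *m K) (d' *m L) (d' *m C) => a1 a2 a3 a4 a5 a6.
    by apply/rowP=> k; rewrite !mxE; ring.
  move=> /dd'_free[tv ->] /dd'_free[/eqP tu ->] /dd'_free[tx ->].
  split=> //; move: tu; rewrite oppr_eq0 => /eqP tu.
  by case/or3P: nz => nz; apply: (mulIf nz); rewrite mul0r.
- by apply: ker; rewrite gramE ?KK ?KL ?KC ?mulmx0 // -scalemxAr d'e scaler0.
- by apply: ker; rewrite gramE ?LK ?LL ?LC ?mulmx0 // ?mulmxN -scalemxAr d'e scaler0 ?oppr0.
- by apply: ker; rewrite gramE ?CK ?CL ?CC ?mulmx0 // ?mulmxN -scalemxAr d'e scaler0 ?oppr0.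
have zE (D : 'M[F]_(2, 6)) : z *m T *m D^T =
    v *: d *m (K *m T *m D^T) - u *: d *m (L *m T *m D^T) + x *: d *m (C *m T *m D^T).
  by rewrite /z !mulmxDl !mulNmx !mulmxA.
by apply: ker; rewrite zE ?KK ?KL ?KC ?LK ?LL ?LC ?CK ?CL ?CC !mulmx0 ?mulmxN
  -!scalemxAl -!scalemxAr; move: (d *m e) => a; apply/rowP=> k; rewrite !mxE; ring.
Qed.

Lemma diag_in_Gr2 T i : T \in A -> T != 0 -> (forall j, dform i j T = 0) -> in_Gr2 T.
Proof.
move=> TA T_neq0; have std01 a b : a *: std2 1 + b *: std2 0 = 0 -> a = 0 /\ b = 0.
  by rewrite addrC => /std2_free[].
have [-> | ->] : i = 0 \/ i = 1.
- by case: i => [[|[|i]] lt_i] //; [left | right]; apply: val_inj.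
- move=> f0; have dgE j : dg (dform 0 j T) (dform 1 j T) = dform 1 j T *: delta_mx 1 1.
    by rewrite f0; apply: mx2P; rewrite !mxE /= ?mulr1 ?mulr0.
  have := diag_shape TA; rewrite !dgE; apply: (@rank2_shape _ _ (std2 1) (std2 0)) => //.
    by rewrite trmx_delta.
  by rewrite mul_delta_mx_0.
- move=> f0; have dgE j : dg (dform 0 j T) (dform 1 j T) = dform 0 j T *: delta_mx 0 0.
    by rewrite f0; apply: mx2P; rewrite !mxE /= ?mulr1 ?mulr0.
  have := diag_shape TA; rewrite !dgE; apply: (@rank2_shape _ _ (std2 0) (std2 1)) => //.
  - by rewrite trmx_delta.
  - by rewrite mul_delta_mx_0.
  - exact: std2_free.
Qed.

End DiagonalCase.

End FramePlanes.

(** * Planes in /\^2 U + /\^2 U' *)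

Section DiagonalPlanes.
Variables (F : numClosedFieldType) (A : {vspace 'M[F]_6}).
Hypothesis skA : skew_space A.
Hypothesis rkA : forall M, M \in A -> (\rank M <= 4)%N.
Implicit Types (B : {vspace 'M[F]_6}) (T M N : 'M[F]_6) (X U V : 'M[F]_2).
Variables K L C : 'M[F]_(2, 6).
Hypothesis fr : frame A K L C.
Hypothesis diagA : forall T, T \in A ->
  [/\ (K *m T *m L^T) 0 1 = 0, (K *m T *m C^T) 0 1 = 0 & (L *m T *m C^T) 0 1 = 0].

Let f := dform K L C.

(** The open condition is that both projections of B, to /\^2 U and to /\^2 U', are isomorphisms. On
    the plane of the frame both matrices are the identity. *)
Lemma diag_general_misses : for_general_subspace 3 A (fun B => misses_Gr2 B).
Proof.
have [q0 q0_homog q0E] := det_form_plucker (f 0).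
have [q1 q1_homog q1E] := det_form_plucker (f 1).
have [M1 [M2 [M3 [[M1A M2A M3A] [sh1 sh2 sh3] M_free]]]] := frame_basis fr.
apply: (@general_of_homog _ _ _ _ _ _ (q0 * q1) <<[:: M1; M2; M3]>>%VS (triple3 M1 M2 M3)
  (dhomogM q0_homog q1_homog)).
- by apply/span_subvP => M; rewrite !inE => /or3P[] /eqP ->.
- by rewrite /basis_of eqxx.
- case: sh1 => _ _ _ KL1 KC1 LC1; case: sh2 => _ _ _ KL2 KC2 LC2; case: sh3 => _ _ _ KL3 KC3 LC3.
  have fE i : form_mx (f i) (triple3 M1 M2 M3) = 1%:M.
    rewrite form_mx_triple3; apply/matrixP; apply: ord3P; apply: ord3P; rewrite !mxE /=;
    rewrite /gram_entry ?KL1 ?KC1 ?LC1 ?KL2 ?KC2 ?LC2 ?KL3 ?KC3 ?LC3 mxE ?eqxx //.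
  by rewrite mevalM q0E q1E !fE det1 mulr1 oner_neq0.
move=> B X BA X_basis; rewrite mevalM q0E q1E mulf_eq0 negb_or => /andP[d0 d1].
move=> T TB T_neq0 [_ T2].
have [i fi0] : exists i, forall j, f i j T = 0.
  by apply: (diag_rank2 skA rkA fr diagA); rewrite ?T2 // (subvP BA).
have di : \det (form_mx (f i) X) != 0.
  by case: i fi0 => [[|[|i]] lt_i] // _; [move: d0 | move: d1]; congr (_ != _);
    congr (\det (form_mx (f _) X)); apply: val_inj.
have [c TE] := basis_comb X_basis TB.
case/eqP: T_neq0; rewrite TE; apply: big1 => j _.
suff -> : c = 0 by rewrite mxE scale0r.
have fU : form_mx (f i) X \in unitmx by rewrite unitmxE unitfE.
apply: (can_inj (mulmxK fU)); rewrite mul0mx; apply/rowP=> k.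
by rewrite -form_mx_comb -TE fi0 mxE.
Qed.

Lemma diag_comb T x0 x1 u0 u1 v0 v1 a0 a1 b0 b1 c0 c1 a0' a1' b0' b1' c0' c1' :
  T \in A -> shape T K L C (dg x0 x1) (dg u0 u1) (dg v0 v1) ->
  (dg a0 a1 *m K + dg b0 b1 *m L + dg c0 c1 *m C) *m T *m
    (dg a0' a1' *m K + dg b0' b1' *m L + dg c0' c1' *m C)^T =
  dg (x0 * (a0 * b0' - b0 * a0') + u0 * (a0 * c0' - c0 * a0') + v0 * (b0 * c0' - c0 * b0'))
     (x1 * (a1 * b1' - b1 * a1') + u1 * (a1 * c1' - c1 * a1') + v1 * (b1 * c1' - c1 * b1')).
Proof.
move=> TA [KK LL CC KL KC LC].
have dgT a b : (dg a b)^T = dg a b :> 'M[F]_2 by apply: mx2P; rewrite !mxE.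
have LK := gram_tr (skA TA) KL; have CK := gram_tr (skA TA) KC; have CL := gram_tr (skA TA) LC.
rewrite dgT in LK; rewrite dgT in CK; rewrite dgT in CL.
have dgM a b c d : dg a b *m dg c d = dg (a * c) (b * d) :> 'M[F]_2.
  by apply: mx2P; rewrite mulmx2E !mxE /= !(mul0r, mulr0, addr0, add0r).
have dgN a b : - dg a b = dg (- a) (- b) :> 'M[F]_2 by apply: mx2P; rewrite !mxE /= ?oppr0.
have dgD a b c d : dg a b + dg c d = dg (a + c) (b + d) :> 'M[F]_2.
  by apply: mx2P; rewrite !mxE /= ?addr0.
have expand (D : 'M[F]_(2, 6)) : (dg a0 a1 *m K + dg b0 b1 *m L + dg c0 c1 *m C) *m T *m D^T =
    dg a0 a1 *m (K *m T *m D^T) + dg b0 b1 *m (L *m T *m D^T) + dg c0 c1 *m (C *m T *m D^T).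
  by rewrite !mulmxDl !mulmxA.
have trD (P Q S : 'M[F]_(2, 6)) : (P + Q + S)^T = P^T + Q^T + S^T by rewrite !raddfD.
rewrite trD !trmx_mul !dgT.
rewrite !mulmxDr !mulmxA !expand KK LL CC KL KC LC LK CK CL !mulmx0 !dgN !dgM.
rewrite !(add0r, addr0) !dgD !dgM !dgD; congr dg; ring.
Qed.

Lemma diag_plane_frame B : (B <= A)%VS -> \dim B = 3%N -> misses_Gr2 B ->
  exists K L C, frame B K L C.
Proof.
move=> /subvP BA dimB missB.
have f_inj i T : T \in B -> (forall j, f i j T = 0) -> T = 0.
  move=> TB f0; apply/eqP/negPn/negP => T_neq0; apply: (missB T TB T_neq0).
  exact: (diag_in_Gr2 skA rkA fr diagA (BA _ TB) T_neq0 f0).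
have [T1 T1B T1E] := interpolate_forms (delta_mx 0 0) dimB (f_inj 0).
have [T2 T2B T2E] := interpolate_forms (delta_mx 0 1) dimB (f_inj 0).
have [T3 T3B T3E] := interpolate_forms (delta_mx 0 2) dimB (f_inj 0).
pose s := form_mx (f 1) (triple3 T1 T2 T3).
have s_neq0 : \det s != 0.
  rewrite -unitfE -[_ \is a GRing.unit]/(s \in unitmx) -row_free_unit.
  apply: inj_row_free => c cs0.
  pose T := \sum_i c 0 i *: tnth (triple3 T1 T2 T3) i.
  have TB : T \in B.
    by apply: memv_suml => i _; rewrite memvZ //; move: i; apply: ord3P.
  have T0 : T = 0 by apply: (f_inj 1) => // j; rewrite form_mx_comb cs0 mxE.
  have fc j : (c *m form_mx (f 0) (triple3 T1 T2 T3)) 0 j = 0.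
    by rewrite -form_mx_comb -/T T0 linear0.
  have f1 : form_mx (f 0) (triple3 T1 T2 T3) = 1%:M.
    rewrite form_mx_triple3; apply/matrixP; apply: ord3P; apply: ord3P;
    by rewrite [LHS]mxE ?T1E ?T2E ?T3E !mxE.
  by apply/rowP=> j; have := fc j; rewrite f1 mulmx1 => ->; rewrite mxE.
pose rho := sqrtC (\det s)^-1.
have rho2 : rho ^+ 2 * \det s = 1 by rewrite sqrtCK mulVf.
have sE : \det s = f 1 0 T1 * (f 1 1 T2 * f 1 2 T3 - f 1 2 T2 * f 1 1 T3)
    - f 1 1 T1 * (f 1 0 T2 * f 1 2 T3 - f 1 2 T2 * f 1 0 T3)
    + f 1 2 T1 * (f 1 0 T2 * f 1 1 T3 - f 1 1 T2 * f 1 0 T3).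
  by rewrite det3 /s form_mx_triple3 !mxE.
have shT T := diag_shape skA rkA fr diagA (T := T).
have sh1 := shT _ (BA _ T1B); have sh2 := shT _ (BA _ T2B); have sh3 := shT _ (BA _ T3B).
move: sh1 sh2 sh3; rewrite -/f !T1E !T2E !T3E.
move: sE rho2.
move: (f 1 0 T1) (f 1 1 T1) (f 1 2 T1) (f 1 0 T2) (f 1 1 T2) (f 1 2 T2)
  (f 1 0 T3) (f 1 1 T3) (f 1 2 T3) => x1 u1 v1 x2 u2 v2 x3 u3 v3.
move=> -> rho2; rewrite !mxE /= => sh1 sh2 sh3.
have dg1 a b : a = 1 -> b = 1 -> dg a b = 1%:M.
  by move=> -> ->; apply: mx2P; rewrite !mxE.
have dg0 a b : a = 0 -> b = 0 -> dg a b = 0 :> 'M[F]_2.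
  by move=> -> ->; apply: mx2P; rewrite !mxE.
(* The first components of T1, T2, T3 are already standard, so only the second half of the frame
   changes. There T3, T2, T1 must kill the new K, L, C respectively, which are therefore multiples
   of the kernel vectors (v, -u, x). The remaining values are rho^2 \det s = 1. *)
exists (dg 1 (rho * v3) *m K + dg 0 (- (rho * u3)) *m L + dg 0 (rho * x3) *m C).
exists (dg 0 (- (rho * v2)) *m K + dg 1 (rho * u2) *m L + dg 0 (- (rho * x2)) *m C).
exists (dg 0 (rho * v1) *m K + dg 0 (- (rho * u1)) *m L + dg 1 (rho * x1) *m C).
split.
- exists T1 => //; split; rewrite (diag_comb _ _ _ _ _ _ _ _ _ _ _ _ (BA _ T1B) sh1);
  first [apply: dg0; ring | apply: dg1; [ring | rewrite -[RHS]rho2; ring]].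
- exists T2 => //; split; rewrite (diag_comb _ _ _ _ _ _ _ _ _ _ _ _ (BA _ T2B) sh2);
  first [apply: dg0; ring | apply: dg1; [ring | rewrite -[RHS]rho2; ring]].
- exists T3 => //; split; rewrite (diag_comb _ _ _ _ _ _ _ _ _ _ _ _ (BA _ T3B) sh3);
  first [apply: dg0; ring | apply: dg1; [ring | rewrite -[RHS]rho2; ring]].
Qed.

End DiagonalPlanes.

(** * Planes when the blocks U and V are scalar *)

Section ScalarPlanes.
Variables (F : numClosedFieldType) (A : {vspace 'M[F]_6}).
Hypothesis skA : skew_space A.
Hypothesis rkA : forall M, M \in A -> (\rank M <= 4)%N.
Implicit Types (B : {vspace 'M[F]_6}) (T M N : 'M[F]_6) (X U V : 'M[F]_2).
Variables K L C : 'M[F]_(2, 6).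
Hypothesis fr : frame A K L C.
Hypothesis scalA : forall T, T \in A ->
  exists u v, K *m T *m C^T = u%:M /\ L *m T *m C^T = v%:M.

Let u_ : {linear 'M[F]_6 -> F | *%R} := gram_entry K C 0 0.
Let v_ : {linear 'M[F]_6 -> F | *%R} := gram_entry L C 0 0.
Let x_ (a b : 'I_2) : {linear 'M[F]_6 -> F | *%R} := gram_entry K L a b.

Lemma scal_shape T : T \in A ->
  shape T K L C (K *m T *m L^T) (u_ T)%:M (v_ T)%:M /\ x_ 1 0 T = x_ 0 1 T.
Proof.
move=> TA; have [[KK LL CC KL KC LC] [Xs _ _ _ _ _]] := frame_blocks skA rkA fr TA.
split=> //; have [u [v [KCu LCv]]] := scalA TA.
by split; rewrite // /u_ /v_ /= /gram_entry ?KCu ?LCv mxE mulr1n.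
Qed.

Lemma scal_eq0 T : T \in A -> u_ T = 0 -> v_ T = 0 -> x_ 0 0 T = 0 -> x_ 0 1 T = 0 ->
  x_ 1 1 T = 0 -> T = 0.
Proof.
move=> TA u0 v0 x00 x01 x11; have [sh xs] := scal_shape TA.
apply: (frame_shape0 skA fr); first exact: skA.
have X0 : K *m T *m L^T = 0.
  by apply: mx2P; rewrite [RHS]mxE //; rewrite -[LHS]/(x_ 1 0 T) xs.
by move: sh; rewrite X0 u0 v0 !raddf0.
Qed.

Lemma scal_dim_le5 : (\dim A <= 5)%N.
Proof.
apply: (@dim_le_forms _ _ 5 A (fun j => nth u_ [:: u_; v_; x_ 0 0; x_ 0 1; x_ 1 1] j)) => T TA f0.
apply: (scal_eq0 TA).
- by have := f0 (@Ordinal 5 0 isT).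
- by have := f0 (@Ordinal 5 1 isT).
- by have := f0 (@Ordinal 5 2 isT).
- by have := f0 (@Ordinal 5 3 isT).
- by have := f0 (@Ordinal 5 4 isT).
Qed.

Definition disc T := x_ 0 0 T * x_ 1 1 T - x_ 0 1 T ^+ 2.

Lemma discE T : T \in A -> disc T = \det (K *m T *m L^T).
Proof.
move=> TA; have [_ xs] := scal_shape TA; rewrite det2 /disc expr2.
by rewrite -[(K *m T *m L^T) 1 0]/(x_ 1 0 T) xs.
Qed.

(** [pf4_gram] on K and C, where the diagonal blocks vanish, gives u^2 = 0; on L and C it gives v^2
    = 0, and on K and L it gives \det X = 0. *)
Lemma scal_rank2 T : T \in A -> (\rank T <= 2)%N -> [/\ u_ T = 0, v_ T = 0 & disc T = 0].
Proof.
move=> TA rkT; have skT := skA TA; have [[KK LL CC KL KC LC] _] := scal_shape TA.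
have sq0 (D E : 'M[F]_(2, 6)) c : D *m T *m D^T = 0 -> D *m T *m E^T = c%:M -> c = 0.
  move=> DD DE; have := pf4_gram D E skT rkT; rewrite DD DE mxE mul0r det_scalar => /esym/eqP.
  by rewrite expf_eq0 => /eqP.
split; [exact: sq0 KK KC | exact: sq0 LL LC |].
by rewrite discE // -(pf4_gram K L skT rkT) KK mxE mul0r.
Qed.

Lemma scal_in_Gr2 T : T \in A -> T != 0 -> u_ T = 0 -> v_ T = 0 -> disc T = 0 -> in_Gr2 T.
Proof.
move=> TA T_neq0 u0 v0; rewrite discE // => detX; have skT := skA TA; split=> //.
apply/eqP; rewrite eqn_leq skew_rank_ge2 // andbT.
have [[KK LL CC KL KC LC] xs] := scal_shape TA.
rewrite u0 raddf0 in KC; rewrite v0 raddf0 in LC.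
have /det0P[w w_neq0 wX] : \det (K *m T *m L^T) == 0 by apply/eqP.
have XT : (K *m T *m L^T)^T = K *m T *m L^T by apply: mx2P; rewrite [LHS]mxE.
have LK := gram_tr skT KL; have CK := gram_tr skT KC; have CL := gram_tr skT LC.
rewrite XT in LK; rewrite trmx0 oppr0 in CK; rewrite trmx0 oppr0 in CL.
have ker (y : 'rV[F]_6) : y *m T *m K^T = 0 -> y *m T *m L^T = 0 -> y *m T *m C^T = 0 ->
    y *m T = 0 by exact: (frame_kernel skA fr).
have gramE (y : 'rV[F]_2) (D E : 'M[F]_(2, 6)) : y *m D *m T *m E^T = y *m (D *m T *m E^T).
  by rewrite !mulmxA.
apply: (@rank_le2 _ _ (w *m K) (w *m L) (std2 F 0 *m C) (std2 F 1 *m C)).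
- move=> a b c d; rewrite !scalemxAl -addrA -mulmxDl.
  move=> /(frame_free skA fr)[wa wb /std2_free[-> ->]].
  have scale0 (t : F) : t *: w = 0 -> t = 0.
    by move=> /eqP; rewrite scaler_eq0 (negbTE w_neq0) orbF => /eqP.
  by rewrite (scale0 _ wa) (scale0 _ wb).
- by apply: ker; rewrite gramE ?KK ?wX ?KC ?mulmx0.
- by apply: ker; rewrite gramE ?LK ?LL ?LC ?mulmx0 // mulmxN wX oppr0.
- by apply: ker; rewrite gramE ?CK ?CL ?CC ?mulmx0.
- by apply: ker; rewrite gramE ?CK ?CL ?CC ?mulmx0.
Qed.

(* B meets the plane u = v = 0 in a point whose coordinates are given by the minors of
   (u, v) on a basis X of B; \det (form_mx (g a b) X) is its coordinate x_ a b. *)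
Lemma scal_general_misses : for_general_subspace 3 A (fun B => misses_Gr2 B).
Proof.
pose g a b := forms3 u_ v_ (x_ a b).
have [q00 q00_homog q00E] := det_form_plucker (g 0 0).
have [q01 q01_homog q01E] := det_form_plucker (g 0 1).
have [q11 q11_homog q11E] := det_form_plucker (g 1 1).
have [M1 [M2 [M3 [[M1A M2A M3A] [sh1 sh2 sh3] M_free]]]] := frame_basis fr.
have q_homog : q00 * q11 - q01 * q01 \is 2.-homog.
  rewrite rpredB //; first exact: (dhomogM q00_homog q11_homog).
  exact: (dhomogM q01_homog q01_homog).
have qE (X : 3.-tuple 'M[F]_6) : (q00 * q11 - q01 * q01).@[plucker X] =
    \det (form_mx (g 0 0) X) * \det (form_mx (g 1 1) X) - \det (form_mx (g 0 1) X) ^+ 2.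
  by rewrite mevalB !mevalM q00E q01E q11E expr2.
apply: (@general_of_homog _ _ _ _ _ _ _ <<[:: M1; M2; M3]>>%VS (triple3 M1 M2 M3) q_homog).
- by apply/span_subvP => M; rewrite !inE => /or3P[] /eqP ->.
- by rewrite /basis_of eqxx.
- rewrite qE !form_mx_triple3 !det3 !mxE /= /gram_entry.
  case: sh1 => _ _ _ -> -> ->; case: sh2 => _ _ _ -> -> ->; case: sh3 => _ _ _ -> -> ->.
  rewrite !mxE /= !mulr1n ?mulr0n.
  by rewrite (_ : _ - _ = 1) ?oner_neq0 //; ring.
move=> B X BA X_basis; rewrite qE => disc_neq0 T TB T_neq0 [_ T2].
have TA : T \in A by apply: (subvP BA).
have [|u0 v0 d0] := scal_rank2 TA; first by rewrite T2.
have [c TE] := basis_comb X_basis TB.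
have [k ck] : exists k, c 0 k != 0.
  apply: contrapT => c0; case/eqP: T_neq0; rewrite TE; apply: big1 => i _.
  have -> : c 0 i = 0 by apply/eqP/negPn/negP => ci; apply: c0; exists i.
  by rewrite scale0r.
have col2E a b : col' 2 (form_mx (g a b) X) = col' 2 (form_mx (g 0 0) X).
  by apply/matrixP=> i [[|[|j]] lt_j] //; rewrite !mxE.
(* Cramer's rule for T, on which u and v vanish. The cofactor involves only the columns of u and v,
   so it is the same for all (a, b), and the three determinants are proportional to the coordinates
   of T. *)
have lamE a b : \det (form_mx (g a b) X) * c 0 k = x_ a b T * cofactor (form_mx (g 0 0) X) k 2.
  have := congr1 (fun m => (c *m m) 0 k) (mul_mx_adj (form_mx (g a b) X)).
  rewrite mul_mx_scalar [X in _ = X]mxE => <-.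
  rewrite mulmxA mxE !big_ord_recl big_ord0 addr0 -!form_mx_comb -TE.
  rewrite [g a b _]/= -/u_ u0 mul0r add0r [g a b _]/= -/v_ v0 mul0r add0r.
  rewrite (_ : lift _ _ = 2); last exact: val_inj.
  by rewrite [(\adj _) _ _]mxE /cofactor col2E.
move/eqP: disc_neq0; apply.
apply: (mulIf (mulf_neq0 ck ck)); rewrite mul0r.
transitivity ((\det (form_mx (g 0 0) X) * c 0 k) * (\det (form_mx (g 1 1) X) * c 0 k)
  - (\det (form_mx (g 0 1) X) * c 0 k) ^+ 2); first by ring.
rewrite !lamE; transitivity (disc T * cofactor (form_mx (g 0 0) X) k 2 ^+ 2).
  by rewrite /disc; ring.
by rewrite d0 mul0r.
Qed.

(** B meets u = v = 0 in a single point T0, since a line there would contain a zero of [disc]. So T0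
    has an invertible block X, and B contains T1 and T2 with (u, v) equal to (1, 0) and (0, 1). *)
Lemma scal_plane_frame B : (B <= A)%VS -> \dim B = 3%N -> misses_Gr2 B ->
  exists K L C, frame B K L C.
Proof.
move=> /subvP BA dimB missB.
have disc_neq0 T : T \in B -> T != 0 -> u_ T = 0 -> v_ T = 0 -> disc T != 0.
  move=> TB T_neq0 u0 v0; apply/negP=> /eqP d0; apply: (missB T TB T_neq0).
  exact: scal_in_Gr2 (BA _ TB) T_neq0 u0 v0 d0.
have [|T0 [T0B T0_neq0 T0uv]] := @forms_common_zero _ _ 2 B (fun j => if j == 0 then u_ else v_).
  by rewrite dimB.
have u0 : u_ T0 = 0 by have := T0uv 0.
have v0 : v_ T0 = 0 by have := T0uv 1.
have dT0 := disc_neq0 _ T0B T0_neq0 u0 v0.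
have [a [b xab]] : exists a b, x_ a b T0 != 0.
  apply: contrapT => x0; case/negP: dT0; apply/eqP.
  have x0' a b : x_ a b T0 = 0 by apply/eqP/negPn/negP => xab; apply: x0; exists a, b.
  by rewrite /disc !x0' !mul0r expr0n subrr.
have f_inj T : T \in B -> (forall j, forms3 u_ v_ (x_ a b) j T = 0) -> T = 0.
  move=> TB f0; have uT : u_ T = 0 := f0 0; have vT : v_ T = 0 := f0 1.
  have xT : x_ a b T = 0 := f0 2.
  (* a rank 2 member of the pencil spanned by T0 and T *)
  pose be := x_ 0 0 T0 * x_ 1 1 T + x_ 0 0 T * x_ 1 1 T0 - 2%:R * x_ 0 1 T0 * x_ 0 1 T.
  have [t tE] : exists t, disc T0 * t ^+ 2 + be * t + disc T = 0.
    exists ((- be + sqrtC (be ^+ 2 - 4%:R * disc T0 * disc T)) / (2%:R * disc T0)).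
    pose r := sqrtC (be ^+ 2 - 4%:R * disc T0 * disc T).
    have r2 : r ^+ 2 = be ^+ 2 - 4%:R * disc T0 * disc T by rewrite sqrtCK.
    transitivity ((r ^+ 2 - be ^+ 2 + 4%:R * disc T0 * disc T) / (4%:R * disc T0)).
      by rewrite -/r; field.
    by rewrite r2; field.
  have dt : disc (T + t *: T0) = 0.
    by rewrite /disc !linearD !linearZ /= -[RHS]tE /be /disc /=; ring.
  have Tt0 : T + t *: T0 = 0.
    apply/eqP/negPn/negP => Tt_neq0.
    have uTt : u_ (T + t *: T0) = 0 by rewrite linearD linearZ /= uT u0; ring.
    have vTt : v_ (T + t *: T0) = 0 by rewrite linearD linearZ /= vT v0; ring.
    have TtB : T + t *: T0 \in B by rewrite memvD // memvZ.
    by have := disc_neq0 _ TtB Tt_neq0 uTt vTt; rewrite dt eqxx.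
  have t0 : t = 0.
    have := congr1 (x_ a b) Tt0; rewrite linearD linearZ linear0 /= xT add0r => /eqP.
    by rewrite mulf_eq0 (negbTE xab) orbF => /eqP.
  by move: Tt0; rewrite t0 scale0r addr0.
have [T1 T1B T1E] := interpolate_forms (delta_mx 0 0) dimB f_inj.
have [T2 T2B T2E] := interpolate_forms (delta_mx 0 1) dimB f_inj.
have u1 : u_ T1 = 1 by rewrite -[LHS]/(forms3 u_ v_ (x_ a b) 0 T1) T1E mxE.
have v1 : v_ T1 = 0 by rewrite -[LHS]/(forms3 u_ v_ (x_ a b) 1 T1) T1E mxE.
have u2 : u_ T2 = 0 by rewrite -[LHS]/(forms3 u_ v_ (x_ a b) 0 T2) T2E mxE.
have v2 : v_ T2 = 1 by rewrite -[LHS]/(forms3 u_ v_ (x_ a b) 1 T2) T2E mxE.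
have symX T : T \in A -> (K *m T *m L^T)^T = K *m T *m L^T.
  by move=> TA; have [_ xs] := scal_shape TA; apply: mx2P; rewrite [LHS]mxE.
have [sh0 xs0] := scal_shape (BA _ T0B); have [sh1 _] := scal_shape (BA _ T1B).
have [sh2 _] := scal_shape (BA _ T2B).
have q0T := symX _ (BA _ T0B); have q1T := symX _ (BA _ T1B); have q2T := symX _ (BA _ T2B).
rewrite discE ?BA // in dT0.
rewrite u0 v0 raddf0 in sh0; rewrite u1 v1 raddf0 in sh1; rewrite u2 v2 raddf0 in sh2.
have [h hU q0E] := sym2_factor xs0 dT0.
move: sh0 sh1 sh2 q0T q1T q2T q0E.
move: (K *m T0 *m L^T) (K *m T1 *m L^T) (K *m T2 *m L^T) => q0 q1 q2 sh0 sh1 sh2 q0T q1T q2T q0E.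
(* The shear removes the blocks q1 and q2 of T1 and T2. The zero summands only give K' and L' the
   form that [gram_combl] and [gram_combr] expect. *)
pose K' := K + q2 *m C + 0 *m C; pose L' := L + (- q1) *m C + 0 *m C.
have shear T q x y : T \in A -> shape T K L C q x%:M y%:M ->
    q^T = q -> shape T K' L' C (q - x *: q1 - y *: q2) x%:M y%:M.
  move=> TA [KK LL CC KL KC LC] qT; have skT := skA TA.
  have LK := gram_tr skT KL; have CK := gram_tr skT KC; have CL := gram_tr skT LC.
  rewrite tr_scalar_mx in CK; rewrite tr_scalar_mx in CL.
  rewrite /K' /L'; split=> //; rewrite ?gram_combl ?gram_combr ?KK ?LL ?CC ?KL ?KC ?LC ?LK ?CK ?CL
    ?raddfN /= ?q1T ?q2T ?trmx0 ?mulmx0 ?mul0mx ?addr0 ?add0r //.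
  - by rewrite mul_scalar_mx mulmxN mul_mx_scalar subrr.
  - by rewrite subr0 mulNmx mulmxN opprK mul_scalar_mx mul_mx_scalar addrC subrr.
  - by rewrite subr0 mulmxN mul_scalar_mx mul_mx_scalar.
have {}sh0 : shape T0 K' L' C q0 0 0.
  have := shear T0 q0 0 0 (BA _ T0B); rewrite !raddf0 => /(_ sh0 q0T).
  by rewrite !scale0r !subr0.
have {}sh1 : shape T1 K' L' C 0 1%:M 0.
  have := shear T1 q1 1 0 (BA _ T1B); rewrite !raddf0 => /(_ sh1 q1T).
  by rewrite scale1r scale0r subrr subr0.
have {}sh2 : shape T2 K' L' C 0 0 1%:M.
  have := shear T2 q2 0 1 (BA _ T2B); rewrite !raddf0 => /(_ sh2 q2T).
  by rewrite scale1r scale0r subr0 subrr.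
have hh : invmx h *m q0 *m (invmx h)^T = 1%:M.
  by rewrite q0E mulKmx // -trmx_mul mulVmx // trmx1.
exists (invmx h *m K'), (invmx h *m L'), (h^T *m C); split.
- exists T0 => //; have := shape_mul (invmx h) (invmx h) h^T sh0.
  by rewrite !(mulmx0, mul0mx) hh.
- exists T1 => //; have := shape_mul (invmx h) (invmx h) h^T sh1.
  by rewrite !(mulmx0, mul0mx) mulmx1 trmxK mulVmx.
- exists T2 => //; have := shape_mul (invmx h) (invmx h) h^T sh2.
  by rewrite !(mulmx0, mul0mx) mulmx1 trmxK mulVmx.
Qed.

End ScalarPlanes.

Lemma stable_low_rank (F : numClosedFieldType) (n : nat) (A : {vspace 'M[F]_6})
    (dimA : \dim A = n.+1)
    (A_Pf : forall M, M \in A -> M != 0 -> in_Pf M)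
    (stA : stable A) :
  [/\ (3 <= n)%N,
      for_general_subspace 3 A (fun B => misses_Gr2 B),
      exists2 e : 6.-tuple 'rV[F]_6, basis_of fullv e &
        forall B : {vspace 'M[F]_6},
          (B <= A)%VS -> \dim B = 3%N -> misses_Gr2 B -> SL_equiv B (pi_g e) &
      (n <= 5)%N].
Proof.
have skA : skew_space A.
  move=> M MA; have [->|M_neq0] := eqVneq M 0; first by rewrite trmx0 oppr0.
  by have [] := A_Pf M MA M_neq0.
have rkA M : M \in A -> (\rank M <= 4)%N.
  move=> MA; have [->|M_neq0] := eqVneq M 0; first by rewrite mxrank0.
  by have [] := A_Pf M MA M_neq0.
have kerA (u : 'rV[F]_6) : (forall M, M \in A -> u *m M = 0) -> u = 0.
  exact: (stable_common_kernel stA skA).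
have isoA (L : 'M[F]_(3, 6)) : row_free L -> ~ (forall M, M \in A -> L *m M *m L^T = 0).
  by have := @stable_isotropic _ A stA L.
have [K [L [C [fr normal]]]] :=
  exists_normal_frame skA rkA isoA (exists_frame skA rkA kerA isoA).
have dim_gt3 := frame_dim_gt3 skA fr isoA.
have plane_equiv : (forall B, (B <= A)%VS -> \dim B = 3%N -> misses_Gr2 B ->
      exists K L C, frame B K L C) ->
    exists2 e : 6.-tuple 'rV[F]_6, basis_of fullv e &
      forall B : {vspace 'M[F]_6},
        (B <= A)%VS -> \dim B = 3%N -> misses_Gr2 B -> SL_equiv B (pi_g e).
  move=> frB; exists (std_basis F) => [|B BA dimB missB]; first exact: std_basis_basis.
  have [K' [L' [C' fr']]] := frB B BA dimB missB.
  by apply: frame_SL_equiv dimB fr' => M MB; apply: skA; apply: (subvP BA).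
rewrite dimA ltnS in dim_gt3.
case: normal => [diagA | scalA].
- split=> //; first exact: (diag_general_misses skA rkA fr diagA).
    by apply: plane_equiv => B; apply: (diag_plane_frame skA rkA fr diagA).
  by have := diag_dim_le6 skA rkA fr diagA; rewrite dimA ltnS.
- split=> //; first exact: (scal_general_misses skA rkA fr scalA).
    by apply: plane_equiv => B; apply: (scal_plane_frame skA rkA fr scalA).
  by have := scal_dim_le5 skA rkA fr scalA; rewrite dimA ltnS => /leq_trans ->.
Qed.

Theorem theorem4p1 (R : realType) (n : nat) (A : {vspace 'M[R[i]]_6})
    (dimA : \dim A = n.+1)
    (A_Pf : forall M, M \in A -> M != 0 -> in_Pf M)
    (stA : stable A) :
  [/\ (3 <= n)%N,
      for_general_subspace 3 A (fun B => misses_Gr2 B),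
      exists2 e : 6.-tuple 'rV[R[i]]_6, basis_of fullv e &
        forall B : {vspace 'M[R[i]]_6},
          (B <= A)%VS -> \dim B = 3%N -> misses_Gr2 B -> SL_equiv B (pi_g e) &
      (n <= 5)%N].
Proof. exact: stable_low_rank. Qed.
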